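(* There is a polynomial time algorithm that, on input an $n$-dimensional SDDM matrix $M$ with $m$ nonzero entries and condition number at most $\kappa$, produces a sparse approximate inverse chain for $M$ that can be used to solve any linear equation in $M$ to any precision: given $M$, the chain, any vector $b\in\mathbb{R}^n$ and any $\epsilon>0$, one can compute an $\epsilon$-approximate solution to $Mx=b$ in work $O\big((m+n\log^{3}\kappa)\log(1/\epsilon)\big)$ and depth $O(\log n\,\log\kappa\,\log(1/\epsilon))$.
   Context: A symmetric matrix is diagonally dominant (SDD) if each diagonal entry is at least the sum of the absolute values of the other entries in its row. An SDDM matrix is a positive definite SDD matrix with non-positive off-diagonal entries. Any SDDM matrix $M$ can be written as $M=D-A$ with $D$ a nonnegative diagonal matrix and $A$ an entrywise nonnegative symmetric matrix. The condition number is the ratio of the largest eigenvalue to the smallest. For symmetric matrices, $X\succ Y$ (resp. $X\succcurlyeq Y$) means $X-Y$ is positive definite (resp. positive semidefinite), and $X\approx_{\epsilon}Y$ means $e^{\epsilon}X\succcurlyeq Y\succcurlyeq e^{-\epsilon}X$. Approximate inverse chain: two sequences of matrices $D_1,\dots,D_d$ and $A_1,\dots,A_d$ are an approximate inverse chain for an SDDM matrix $M_0=D_0-A_0$ if for all $i$, $D_i$ is a nonnegative diagonal matrix, $A_i$ is an entrywise nonnegative symmetric matrix, $M_i:=D_i-A_i\succ 0$, and there exist numbers $\epsilon_0,\dots,\epsilon_d$ with $\sum_{i=0}^d\epsilon_i\le 2$ such that (a) $M_i\approx_{\epsilon_{i-1}}D_{i-1}-A_{i-1}D_{i-1}^{-1}A_{i-1}$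 for all $1\le i\le d$; (b) $D_i\approx_{\epsilon_{i-1}}D_{i-1}$ for all $1\le i\le d$; (c) $D_d\approx_{\epsilon_d}M_d$. A chain for $M$ means a chain for a decomposition $M=M_0=D_0-A_0$ with $D_0$ a nonnegative diagonal matrix and $A_0$ an entrywise nonnegative symmetric matrix. ''Sparse'' refers to the chain matrices having few nonzero entries, as quantified by the work bound. $\tilde x$ is an $\epsilon$-approximate solution to $Mx=b$ if $\|x-\tilde x\|_M\le\epsilon\|x\|_M$, where $x=M^{-1}b$ and $\|x\|_M=(x^TMx)^{1/2}$. For a parallel algorithm, work is the total number of operations performed and depth is the parallel time; arithmetic is exact. In $O(\cdot)$ bounds each logarithm is read as at least $1$. *)

(* Defs.v *)
From HB Require Import structures.
From mathcomp Require Import all_boot all_order all_algebra.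
From mathcomp Require Import all_classical all_reals all_analysis.
Set Implicit Arguments. Unset Strict Implicit. Unset Printing Implicit Defensive.
Import Order.TTheory GRing.Theory Num.Theory.
Local Open Scope classical_set_scope.
Local Open Scope ring_scope.

(** * Matrices *)

Definition quad (R : realType) n (M : 'M[R]_n) (x : 'cV[R]_n) : R :=
  (x^T *m M *m x) 0 0.

Definition posdef (R : realType) n (M : 'M[R]_n) : Prop :=
  M^T = M /\ forall x : 'cV[R]_n, x != 0 -> 0 < quad M x.

Definition possemidef (R : realType) n (M : 'M[R]_n) : Prop :=
  M^T = M /\ forall x : 'cV[R]_n, 0 <= quad M x.

Definition approx (R : realType) n (e : R) (X Y : 'M[R]_n) : Prop :=
  possemidef (expR e *: X - Y) /\ possemidef (Y - expR (- e) *: X).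

Definition sdd (R : realType) n (M : 'M[R]_n) : Prop :=
  M^T = M /\ forall i, \sum_(j | j != i) `|M i j| <= M i i.

Definition sddm (R : realType) n (M : 'M[R]_n) : Prop :=
  [/\ posdef M, sdd M & forall i j, i != j -> M i j <= 0].

Definition entrywise_nonneg (R : realType) n (M : 'M[R]_n) : Prop :=
  forall i j, 0 <= M i j.

(* For a symmetric matrix with n > 0 the set of eigenvalues is finite and
   nonempty, so [sup] and [inf] are its maximum and minimum. *)
Definition cond_number (R : realType) n (M : 'M[R]_n) : R :=
  sup [set a : R | eigenvalue M a] / inf [set a : R | eigenvalue M a].

Definition nnz (R : realType) n (M : 'M[R]_n) : nat :=
  #|[set p : 'I_n * 'I_n | M p.1 p.2 != 0]%SET|.

Definition mxnorm (R : realType) n (M : 'M[R]_n) (x : 'cV[R]_n) : R :=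
  Num.sqrt (quad M x).

Definition approx_solution (R : realType) n (M : 'M[R]_n) (b : 'cV[R]_n)
    (e : R) (y : 'cV[R]_n) : Prop :=
  let x := invmx M *m b in mxnorm M (x - y) <= e * mxnorm M x.

(* The logarithm used in asymptotic bounds, read as at least 1. *)
Definition lg (R : realType) (x : R) : R := Num.max 1 (ln x).

(* The chain is D 0, ..., D d and A 0, ..., A d; the values of D and A beyond
   d are irrelevant. *)
Definition approx_inverse_chain (R : realType) n (M : 'M[R]_n)
    (d : nat) (D A : nat -> 'M[R]_n) : Prop :=
  [/\ M = D 0%N - A 0%N,
      forall i, (i <= d)%N ->
        [/\ is_diag_mx (D i), entrywise_nonneg (D i),
            (A i)^T = A i, entrywise_nonneg (A i) & posdef (D i - A i)]
    & exists eps : nat -> R,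
        [/\ \sum_(0 <= i < d.+1) eps i <= 2,
            forall i, (i < d)%N ->
              approx (eps i) (D i.+1 - A i.+1)
                     (D i - A i *m invmx (D i) *m A i),
            forall i, (i < d)%N -> approx (eps i) (D i.+1) (D i)
          & approx (eps d) (D d) (D d - A d)]].

(** * A parallel random access machine with exact real arithmetic

   The machine has arrays of natural numbers and arrays of reals, each named by
   a constant.  Integers support only operations that lengthen their binary
   expansion by at most one bit, and there is no rounding from reals to
   integers, so that the unit-cost measure is a meaningful one.  Reals can only
   be moved, combined by field operations (with x / 0 = 0) and compared; the
   only real constants available to a program are numerals. *)

Inductive nexp : Type :=
| NConst of nat
| NProc                      (* the number of the executing processor *)
| NGet of nat & nexp         (* array name, index *)
| NAdd of nexp & nexp
| NSub of nexp & nexp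
| NHalf of nexp.

Inductive rexp : Type :=
| RConst of nat
| RGet of nat & nexp
| RAdd of rexp & rexp
| RSub of rexp & rexp
| RMul of rexp & rexp
| RDiv of rexp & rexp.

Inductive bexp : Type :=
| BTrue
| BNLt of nexp & nexp
| BRLt of rexp & rexp
| BNot of bexp
| BAnd of bexp & bexp.

(* [ParN L g a i e]: processors 0, ..., L - 1 synchronously evaluate the guard
   [g], the index [i] and the value [e] in the current memory, and then each
   processor whose guard holds writes its value in cell [i] of the natural
   number array [a].  [ParR] is the same for an array of reals. *)
Inductive cmd : Type :=
| Skip
| ParN of nexp & bexp & nat & nexp & nexp
| ParR of nexp & bexp & nat & nexp & rexp
| Seq of cmd & cmd
| If of bexp & cmd & cmd
| While of bexp & cmd.

Record memory (R : realType) := Mem {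
  nmem : nat -> nat -> nat;
  rmem : nat -> nat -> R }.

Fixpoint neval (R : realType) (s : memory R) (p : nat) (e : nexp) : nat :=
  match e with
  | NConst k => k
  | NProc => p
  | NGet a i => nmem s a (neval s p i)
  | NAdd e1 e2 => (neval s p e1 + neval s p e2)%N
  | NSub e1 e2 => (neval s p e1 - neval s p e2)%N
  | NHalf e1 => (neval s p e1)./2
  end.

Fixpoint reval (R : realType) (s : memory R) (p : nat) (e : rexp) : R :=
  match e with
  | RConst k => k%:R
  | RGet a i => rmem s a (neval s p i)
  | RAdd e1 e2 => reval s p e1 + reval s p e2
  | RSub e1 e2 => reval s p e1 - reval s p e2
  | RMul e1 e2 => reval s p e1 * reval s p e2
  | RDiv e1 e2 => reval s p e1 / reval s p e2
  end.

Fixpoint beval (R : realType) (s : memory R) (p : nat) (e : bexp) : bool :=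
  match e with
  | BTrue => true
  | BNLt e1 e2 => (neval s p e1 < neval s p e2)%N
  | BRLt e1 e2 => reval s p e1 < reval s p e2
  | BNot e1 => ~~ beval s p e1
  | BAnd e1 e2 => beval s p e1 && beval s p e2
  end.

(* Every constant, memory access and operation costs 1. *)
Fixpoint ncost (e : nexp) : nat :=
  match e with
  | NConst _ | NProc => 1
  | NGet _ e1 | NHalf e1 => (ncost e1).+1
  | NAdd e1 e2 | NSub e1 e2 => (ncost e1 + ncost e2).+1
  end.

Fixpoint rcost (e : rexp) : nat :=
  match e with
  | RConst _ => 1
  | RGet _ i => (ncost i).+1
  | RAdd e1 e2 | RSub e1 e2 | RMul e1 e2 | RDiv e1 e2 =>
      (rcost e1 + rcost e2).+1
  end.

Fixpoint bcost (e : bexp) : nat :=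
  match e with
  | BTrue => 1
  | BNLt e1 e2 => (ncost e1 + ncost e2).+1
  | BRLt e1 e2 => (rcost e1 + rcost e2).+1
  | BNot e1 => (bcost e1).+1
  | BAnd e1 e2 => (bcost e1 + bcost e2).+1
  end.

(* Concurrent reads are allowed, concurrent writes are not. *)
Definition exclusive_write (R : realType) (s : memory R) (L : nexp) (g : bexp)
    (i : nexp) : Prop :=
  forall p q, (p < neval s 0 L)%N -> (q < neval s 0 L)%N ->
    beval s p g -> beval s q g -> neval s p i = neval s q i -> p = q.

Definition writer (R : realType) (s : memory R) (L : nexp) (g : bexp) (i : nexp)
    (x : nat) : option 'I_(neval s 0 L) :=
  [pick p : 'I_(neval s 0 L) | beval s p g && (neval s p i == x)].

Definition writeN (R : realType) (s : memory R) (L : nexp) (g : bexp) (a : nat)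
    (i e : nexp) : memory R :=
  Mem (fun a' x => if a' == a then
                     if writer s L g i x is Some p then neval s p e
                     else nmem s a' x
                   else nmem s a' x)
      (rmem s).

Definition writeR (R : realType) (s : memory R) (L : nexp) (g : bexp) (a : nat)
    (i : nexp) (e : rexp) : memory R :=
  Mem (nmem s)
      (fun a' x => if a' == a then
                     if writer s L g i x is Some p then reval s p e
                     else rmem s a' x
                   else rmem s a' x).

(* [exec c s s' w t]: started in memory [s], the program [c] terminates in
   memory [s'] with work [w] and depth [t]. *)
Inductive exec (R : realType) :
    cmd -> memory R -> memory R -> nat -> nat -> Prop :=
| ExecSkip s : exec Skip s s 1 1
| ExecParN s L g a i e :
    exclusive_write s L g i ->
    let c := (bcost g + ncost i + ncost e).+1 in
    exec (ParN L g a i e) s (writeN s L g a i e)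
      (ncost L + neval s 0 L * c).+1 (ncost L + c).+1
| ExecParR s L g a i e :
    exclusive_write s L g i ->
    let c := (bcost g + ncost i + rcost e).+1 in
    exec (ParR L g a i e) s (writeR s L g a i e)
      (ncost L + neval s 0 L * c).+1 (ncost L + c).+1
| ExecSeq c1 c2 s s1 s2 w1 w2 t1 t2 :
    exec c1 s s1 w1 t1 -> exec c2 s1 s2 w2 t2 ->
    exec (Seq c1 c2) s s2 (w1 + w2)%N (t1 + t2)%N
| ExecIf b c1 c2 s s' w t :
    exec (if beval s 0 b then c1 else c2) s s' w t ->
    exec (If b c1 c2) s s' (bcost b + w).+1 (bcost b + t).+1
| ExecWhileFalse b c s :
    beval s 0 b = false ->
    exec (While b c) s s (bcost b).+1 (bcost b).+1
| ExecWhileTrue b c s s1 s2 w1 w2 t1 t2 :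
    beval s 0 b ->
    exec c s s1 w1 t1 -> exec (While b c) s1 s2 w2 t2 ->
    exec (While b c) s s2 (bcost b + w1 + w2).+1 (bcost b + t1 + t2).+1.

(** * Data representation *)

Definition rows (R : realType) n (M : 'M[R]_n) : seq 'rV[R]_n :=
  [seq row i M | i <- enum 'I_n].

(* (column, value) pairs of the nonzero entries, row by row *)
Definition entries (R : realType) n (rs : seq 'rV[R]_n) : seq (nat * R) :=
  flatten [seq [seq (nat_of_ord j, r 0 j) | j <- enum 'I_n & r 0 j != 0]
          | r : 'rV[R]_n <- rs].

(* Compressed sparse row format: cell i of array [ptr] is the position of the
   first nonzero entry of row i in the arrays [col] and [val]. *)
Definition stores_rows (R : realType) (s : memory R) (ptr col val : nat) n
    (rs : seq 'rV[R]_n) : Prop :=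
  (forall i, (i <= size rs)%N -> nmem s ptr i = size (entries (take i rs))) /\
  (forall k, (k < size (entries rs))%N ->
     (nmem s col k, rmem s val k) = nth (0%N, 0) (entries rs) k).

Definition stores_vec (R : realType) (s : memory R) (a : nat) (v : seq R) : Prop :=
  forall k, (k < size v)%N -> rmem s a k = nth 0 v k.

(* Natural number arrays 0-2 and real array 0 hold the input matrix. *)
Definition stores_matrix (R : realType) (s : memory R) n (M : 'M[R]_n) : Prop :=
  nmem s 0 0 = n /\ stores_rows s 1 2 0 (rows M).

(* Natural number arrays 3-5 and real arrays 1-2 hold a chain: A 0, ..., A d
   are stacked into one sparse matrix with (d + 1) n rows, and the diagonals of
   D 0, ..., D d are concatenated. *)
Definition stores_chain (R : realType) (s : memory R) n (d : nat)
    (D A : nat -> 'M[R]_n) : Prop :=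
  [/\ nmem s 3 0 = d,
      stores_rows s 4 5 1 (flatten [seq rows (A i) | i <- iota 0 d.+1])
    & stores_vec s 2
        (flatten [seq [seq D i j j | j <- enum 'I_n] | i <- iota 0 d.+1])].

(* Real arrays 3 and 4 hold the right-hand side and the precision, and real
   array 5 receives the solution. *)
Definition stores_rhs (R : realType) (s : memory R) n (b : 'cV[R]_n) (e : R) :
    Prop :=
  stores_vec s 3 [seq b j 0 | j <- enum 'I_n] /\ rmem s 4 0 = e.

Definition read_solution (R : realType) (s : memory R) n : 'cV[R]_n :=
  \col_(j < n) rmem s 5 j.

(* Main.v *)
(* Take D = 2 diag(M) on every level and A_0 = D - M, which is positive
   semidefinite.  For a level M_i = D - A_i the matrix N = D - A_i D^-1 A_i has
   nonpositive off-diagonal entries and nonnegative row sums, hence is a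
   nonnegative combination of rank one edge matrices.  The deterministic barrier
   argument of Batson, Spielman and Srivastava, run relative to N with parameter
   q = 30 d, selects n q^2 weighted edges whose sum B satisfies
   (1 - 5/q) N <= B / u <= N, and the next level is A_{i+1} = D - B / u.
   If M_i >= lambda D then N >= (2 lambda - lambda^2) D, so lambda grows by 5/4
   per level until it reaches 1/2.  Since M >= D / (2 kappa), O(log kappa) levels
   suffice, with errors 1/d; d levels with O(n d^2) entries give n log^3 kappa.

   The identity M_i^-1 = (D^-1 + (1 + D^-1 A_i) N^-1 (1 + A_i D^-1)) / 2 turns
   the chain into an operator Z with Z / 2 <= M^-1 <= 2 Z that is applied in two
   passes over the chain, and x += Z (b - M x) / 2 contracts the squared M-norm
   of the error by 3/4.  A sparse matrix-vector product is a prefix sum over the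
   stored entries, computed on a binary heap in logarithmic depth.

   The machine cannot round reals to integers, so d is found by testing whether
   (5/4)^k M - D is positive definite for k = 0, 1, ...; this is read off the
   signs of the Gauss-Jordan pivots. *)
From HB Require Import structures.
Require Import Defs.
From mathcomp Require Import all_boot all_order all_algebra.
From mathcomp Require Import all_classical all_reals all_analysis.
From mathcomp Require Import ring lra zify.
Set Implicit Arguments. Unset Strict Implicit. Unset Printing Implicit Defensive.
Import Order.TTheory GRing.Theory Num.Theory.
Local Open Scope ring_scope.

(** * Quadratic forms and rank one updates *)

Section QuadraticForms.
Variables (R : realType) (n : nat).
Implicit Types (M V X Y Q D : 'M[R]_n) (x y u v : 'cV[R]_n).

(** Two choices shape the argument. The diagonal [D] is the same on every level, so condition (b) of
    a chain holds trivially and all levels are compared relative to one matrix. And the [A i] stay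
    positive semidefinite: an eigenvalue of D^-1 A near -1 would be squared to one near 1 and leave
    N almost singular. The doubling D = 2 diag(M) secures this at level 0; it survives because the
    sparsifier errs on one side only, D - A_{i+1} <= N, so that A_{i+1} >= A_i D^-1 A_i. The factor
    30 in q makes the loss per level 5/q = 1/(6d), hence 1/6 over all levels, small enough for the
    growth rate 5/4 and for Z / 2 <= M^-1. The machine has no random bits, which rules out sampling
    edges; the barrier argument is deterministic and its number of edges has no factor log n.
    Programs are verified with two notions of a run: the construction is bounded in work only, the
    solver in work and depth. What a command leaves untouched is read off the syntactic list of
    arrays that it writes. *)

Definition dot u v : R := (u^T *m v) 0 0.
(** The Loewner order on forms alone; symmetry is kept apart, since most comparisons only use values
    of forms. *)
Definition lemx X Y := forall x, quad X x <= quad Y x.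

Lemma quadE M x : quad M x = dot x (M *m x).
Proof. by rewrite /quad /dot mulmxA. Qed.

Lemma dotC u v : dot u v = dot v u.
Proof. by rewrite /dot !mxE; apply: eq_bigr => i _; rewrite !mxE mulrC. Qed.

Lemma dotDr u v x : dot u (v + x) = dot u v + dot u x.
Proof. by rewrite /dot mulmxDr mxE. Qed.

Lemma dotZr c u v : dot u (c *: v) = c * dot u v.
Proof. by rewrite /dot -scalemxAr mxE. Qed.

Lemma dotDl u v x : dot (v + x) u = dot v u + dot x u.
Proof. by rewrite !(dotC _ u) dotDr. Qed.

Lemma dotZl c u v : dot (c *: v) u = c * dot v u.
Proof. by rewrite !(dotC _ u) dotZr. Qed.

Lemma dot0r u : dot u 0 = 0.
Proof. by rewrite /dot mulmx0 mxE. Qed.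

Lemma dot_mulmx M x y : dot x (M *m y) = dot (M^T *m x) y.
Proof. by rewrite /dot trmx_mul trmxK mulmxA. Qed.

Lemma dot_symmx M x y : M^T = M -> dot x (M *m y) = dot y (M *m x).
Proof. by move=> sM; rewrite dot_mulmx sM dotC. Qed.

Lemma dotvv_ge0 x : 0 <= dot x x.
Proof. by rewrite /dot mxE sumr_ge0 // => i _; rewrite mxE -expr2 sqr_ge0. Qed.

Lemma dotvv_eq0 x : (dot x x == 0) = (x == 0).
Proof.
apply/idP/eqP => [|->]; last by rewrite dot0r.
rewrite /dot mxE psumr_eq0 => [/allP h|i _]; last by rewrite mxE -expr2 sqr_ge0.
apply/matrixP => i j; rewrite ord1 mxE; have := h i (mem_index_enum i).
by rewrite mxE -expr2 sqrf_eq0 => /eqP.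
Qed.

Lemma quad1 x : quad 1%:M x = dot x x.
Proof. by rewrite quadE mul1mx. Qed.

Lemma quadD X Y x : quad (X + Y) x = quad X x + quad Y x.
Proof. by rewrite !quadE mulmxDl dotDr. Qed.

Lemma quadZ c X x : quad (c *: X) x = c * quad X x.
Proof. by rewrite !quadE -scalemxAl dotZr. Qed.

Lemma quadN X x : quad (- X) x = - quad X x.
Proof. by rewrite -scaleN1r quadZ mulN1r. Qed.

Lemma quadB X Y x : quad (X - Y) x = quad X x - quad Y x.
Proof. by rewrite quadD quadN. Qed.

Lemma quad0 X : quad X 0 = 0.
Proof. by rewrite quadE mulmx0 dot0r. Qed.

Lemma quad0m x : quad 0 x = 0.
Proof. by rewrite quadE mul0mx dot0r. Qed.

Lemma quad_scale c X x : quad X (c *: x) = c ^+ 2 * quad X x.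
Proof. by rewrite !quadE -scalemxAr dotZr dotZl mulrA expr2. Qed.

Lemma quad_addv c X x y : X^T = X ->
  quad X (x + c *: y) = quad X x + 2 * c * dot y (X *m x) + c ^+ 2 * quad X y.
Proof.
move=> sX; rewrite !quadE mulmxDr -scalemxAr dotDl !dotDr !dotZl !dotZr.
by rewrite (dot_symmx x y sX) expr2; ring.
Qed.

Lemma quad_conj M X x : quad (M^T *m X *m M) x = quad X (M *m x).
Proof. by rewrite /quad trmx_mul !mulmxA. Qed.

Lemma posdefW X : posdef X -> possemidef X.
Proof.
move=> [sX pX]; split => // x; have [->|/pX/ltW //] := eqVneq x 0.
by rewrite quad0.
Qed.

Lemma posdefD X Y : posdef X -> possemidef Y -> posdef (X + Y).
Proof.
move=> [sX pX] [sY pY]; split=> [|x x0]; first by rewrite linearD /= sX sY.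
by rewrite quadD ltr_wpDr // pX.
Qed.

Lemma possemidefZ c X : 0 <= c -> possemidef X -> possemidef (c *: X).
Proof.
move=> c0 [sX pX]; split=> [|x]; first by rewrite linearZ /= sX.
by rewrite quadZ mulr_ge0.
Qed.

Lemma posdefZ c X : 0 < c -> posdef X -> posdef (c *: X).
Proof.
move=> c0 [sX pX]; split=> [|x x0]; first by rewrite linearZ /= sX.
by rewrite quadZ mulr_gt0 // pX.
Qed.

Lemma possemidef_conj M X : possemidef X -> possemidef (M^T *m X *m M).
Proof.
move=> [sX pX]; split=> [|x]; first by rewrite !trmx_mul trmxK sX mulmxA.
by rewrite quad_conj.
Qed.

Lemma posdef_le X Y : posdef X -> lemx X Y -> Y^T = Y -> posdef Y.
Proof. by move=> [_ pX] XY sY; split=> // x /pX; move/lt_le_trans; apply. Qed.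

Lemma lemx_trans X Y V : lemx X Y -> lemx Y V -> lemx X V.
Proof. by move=> h1 h2 x; apply: le_trans (h2 x). Qed.

Lemma posdef_unit X : posdef X -> X \in unitmx.
Proof.
move=> [sX pX]; rewrite -row_free_unit; apply: inj_row_free => v vX.
apply/eqP/contraT => v0; have /pX : v^T != 0 by rewrite trmx_eq0.
by rewrite /quad trmxK vX mul0mx mxE ltxx.
Qed.

Lemma trmx_invmx_sym X : X^T = X -> (invmx X)^T = invmx X.
Proof. by move=> sX; rewrite trmx_inv sX. Qed.

Lemma mulmxVK_unit X v : X \in unitmx -> X *m (invmx X *m v) = v.
Proof. by move=> uX; rewrite mulmxA mulmxV // mul1mx. Qed.

Lemma quad_inv X v : posdef X -> quad (invmx X) v = quad X (invmx X *m v).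
Proof.
move=> pX; rewrite !quadE mulmxVK_unit ?posdef_unit //.
by rewrite dotC.
Qed.

Lemma posdef_inv X : posdef X -> posdef (invmx X).
Proof.
move=> pX; have uX := posdef_unit pX; split.
  by rewrite trmx_invmx_sym //; case: pX.
move=> x x0; rewrite quad_inv //; apply: pX.2; apply: contra x0 => /eqP h.
by rewrite -(mulmxVK_unit x uX) h mulmx0.
Qed.

(** The form at y + c x is a nonnegative polynomial in c; its value at the minimiser gives the
    inequality. *)
Lemma psd_CauchySchwarz V x y : possemidef V ->
  dot x (V *m y) ^+ 2 <= quad V x * quad V y.
Proof.
move=> [sV pV]; set b := dot _ _.
have hc c : 0 <= quad V y + 2 * c * b + c ^+ 2 * quad V x.
  by rewrite /b -quad_addv.
have [x0|x0] := eqVneq (quad V x) 0.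
  (* When [quad V x] = 0 the polynomial is affine in c, and for b != 0 a suitable c gives it the
     value -1. *)
  rewrite x0 mul0r; have [->|b0] := eqVneq b 0; first by rewrite expr0n.
  have := hc (- (quad V y + 1) / (2 * b)); rewrite x0 mulr0 addr0.
  have -> : 2 * (- (quad V y + 1) / (2 * b)) * b = - (quad V y + 1) by field.
  by lra.
have xp : 0 < quad V x by rewrite lt_def x0 pV.
have := hc (- b / quad V x).
have -> : quad V y + 2 * (- b / quad V x) * b + (- b / quad V x) ^+ 2 * quad V x
  = quad V y - b ^+ 2 / quad V x by field.
by rewrite subr_ge0 ler_pdivrMr // mulrC.
Qed.

(** Cauchy-Schwarz for V at V^-1 v and x, where <V^-1 v, V x> = <v, x>. *)
Lemma inv_CauchySchwarz V v x : posdef V ->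
  dot v x ^+ 2 <= quad (invmx V) v * quad V x.
Proof.
move=> pV; have sV := pV.1.
have := psd_CauchySchwarz (invmx V *m v) x (posdefW pV).
rewrite -quad_inv //; congr (_ ^+ 2 <= _).
by rewrite dot_symmx // mulmxVK_unit ?posdef_unit // dotC.
Qed.

(* The form of X^-1 is the maximum over z of 2 <v, z> - quad X z, attained at
   z = X^-1 v; this maximum decreases as X grows. *)
Lemma lemx_inv X Y : posdef X -> posdef Y -> lemx X Y ->
  lemx (invmx Y) (invmx X).
Proof.
move=> pX pY XY v; set z := invmx Y *m v; set a := invmx X *m v.
have sX := pX.1.
have qa : quad (invmx X) v = quad X a by rewrite quad_inv.
have qz : quad (invmx Y) v = quad Y z by rewrite quad_inv.
have vz : dot z (X *m a) = quad Y z.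
  by rewrite /a mulmxVK_unit ?posdef_unit // -qz quadE dotC.
have := (posdefW pX).2 (a + (-1) *: z).
rewrite quad_addv // vz qa qz => h.
have := XY z; lra.
Qed.

(** Put z = D^-1 Q v; then <z, Q v> and the form of Q D^-1 Q at v both equal D(z). Nonnegativity of
    Q at v - z / c, together with Q(z) <= c D(z), gives D(z) <= c Q(v). No matrix square root is
    involved. *)
Lemma psd_sandwich c Q D : 0 < c -> possemidef Q -> posdef D ->
  lemx Q (c *: D) -> lemx (Q *m invmx D *m Q) (c *: Q).
Proof.
move=> c0 pQ pD QD v; have sQ := pQ.1; have uD := posdef_unit pD.
set z := invmx D *m (Q *m v).
have qz : quad (Q *m invmx D *m Q) v = quad D z.
  by rewrite -{1}sQ quad_conj quad_inv.
have zv : dot z (Q *m v) = quad D z.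
  by rewrite quadE /z mulmxVK_unit.
have := pQ.2 (v + (- c^-1) *: z).
rewrite quad_addv // zv qz quadZ => h.
have := QD z; rewrite quadZ => h2.
have h3 : (c^-1) ^+ 2 * quad Q z <= c^-1 * quad D z.
  rewrite expr2 -mulrA ler_pM2l ?invr_gt0 // mulrC ler_pdivrMr //.
  by rewrite mulrC.
have h4 : c^-1 * quad D z <= quad Q v.
  rewrite sqrrN in h; set A := c^-1 ^+ 2 * _ in h h3.
  rewrite mulrN mulNr -mulrA in h; lra.
by rewrite mulrC -ler_pdivrMr // mulrC.
Qed.

End QuadraticForms.

Section RankOneUpdates.
Variables (R : realType) (n : nat).
Implicit Types (X Y : 'M[R]_n) (x v : 'cV[R]_n).

Lemma quad_rank1 v x : quad (v *m v^T) x = dot v x ^+ 2.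
Proof.
rewrite /quad !mulmxA -[_ *m v^T *m x]mulmxA mxE big_ord_recl big_ord0 addr0.
have -> : (x^T *m v) 0 0 = dot v x by rewrite dotC.
by rewrite expr2.
Qed.

Lemma mxtrace_rank1 v X : \tr (v *m v^T *m X) = quad X v.
Proof.
rewrite -mulmxA mxtrace_mulC [v^T *m X *m v]mx11_scalar mxtrace_scalar.
by rewrite mulr1n.
Qed.

Lemma invmx_eq X Y : X *m Y = 1%:M -> invmx X = Y.
Proof.
move=> XY; have [uX _] := mulmx1_unit XY.
by rewrite -[LHS]mulmx1 -XY mulKmx.
Qed.

Lemma rank1_sym v : (v *m v^T)^T = v *m v^T.
Proof. by rewrite trmx_mul trmxK. Qed.

Lemma rank1_psd v : possemidef (v *m v^T).
Proof.
by split=> [|x]; [rewrite rank1_sym | rewrite quad_rank1 sqr_ge0].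
Qed.

Lemma ShermanMorrison Y v (c : R) (W := invmx Y) : Y \in unitmx ->
  1 + c * quad W v != 0 ->
  invmx (Y + c *: (v *m v^T)) =
    W - (c / (1 + c * quad W v)) *: (W *m (v *m v^T) *m W).
Proof.
move=> uY h; set s := quad W v; apply: invmx_eq.
have hs : v *m v^T *m (W *m (v *m v^T) *m W) = s *: (v *m v^T *m W).
  have -> : v *m v^T *m (W *m (v *m v^T) *m W) =
      v *m (v^T *m W *m v) *m v^T *m W by rewrite !mulmxA.
  rewrite [v^T *m W *m v]mx11_scalar -/(quad W v) -/s mul_mx_scalar.
  by rewrite -!scalemxAl.
rewrite mulmxDl !mulmxBr mulmxV // -!scalemxAr -!scalemxAl hs.
rewrite !mulmxA mulmxV // mul1mx !scalerA.
rewrite -addrA [X in _ + X](_ : _ = 0) ?addr0 //.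
rewrite -scalerBl addrC -scalerBl -[RHS](scale0r (v *m v^T *m W)).
by congr (_ *: _); rewrite -/s in h *; field.
Qed.

Lemma posdef_rank1D Y v c : 0 <= c -> posdef Y -> posdef (Y + c *: (v *m v^T)).
Proof.
by move=> c0 pY; apply: posdefD => //; apply: possemidefZ => //; apply: rank1_psd.
Qed.

Lemma posdef_rank1B Y v c : 0 <= c -> posdef Y -> c * quad (invmx Y) v < 1 ->
  posdef (Y - c *: (v *m v^T)).
Proof.
move=> c0 pY h; split=> [|x x0].
  by rewrite linearB linearZ /= rank1_sym pY.1.
rewrite quadB quadZ quad_rank1 subr_gt0.
have := inv_CauchySchwarz v x pY => CS; have q0 := pY.2 x x0.
apply: le_lt_trans (ler_wpM2l c0 CS) _.
by rewrite mulrA -[ltRHS]mul1r ltr_pM2r.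
Qed.

End RankOneUpdates.

(** * Weighted sums of rank one matrices and their traces *)

Section Gram.
Variables (R : realType) (n : nat) (I : finType).
Variables (w : I -> R) (g : I -> 'cV[R]_n).

(** With N in this form a trace against N is a weighted sum over edges, so comparing two traces
    yields a single edge that does at least as well as the average. *)
Definition gram : 'M[R]_n := \sum_p w p *: (g p *m (g p)^T).

Lemma mxtrace_gram X : \tr (gram *m X) = \sum_p w p * quad X (g p).
Proof.
rewrite /gram mulmx_suml linear_sum; apply: eq_bigr => p _.
by rewrite -scalemxAl linearZ /= mxtrace_rank1.
Qed.

Lemma quad_gram x : quad gram x = \sum_p w p * dot (g p) x ^+ 2.
Proof.
rewrite /gram -[RHS]/(\sum_(p <- index_enum I) _).
elim/big_ind2: _ => [|a b c d|p _]; first exact: quad0m.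
  by move=> <- <-; rewrite quadD.
by rewrite quadZ quad_rank1.
Qed.

Lemma gram_sym : gram^T = gram.
Proof.
rewrite /gram linear_sum; apply: eq_bigr => p _ /=.
by rewrite linearZ /= rank1_sym.
Qed.

Hypothesis w_ge0 : forall p, 0 <= w p.

Lemma mxtrace_gram_ge0 X : possemidef X -> 0 <= \tr (gram *m X).
Proof.
by move=> [_ pX]; rewrite mxtrace_gram sumr_ge0 // => p _; rewrite mulr_ge0.
Qed.

Lemma mxtrace_gram_le X Y : lemx X Y -> \tr (gram *m X) <= \tr (gram *m Y).
Proof.
by move=> XY; rewrite !mxtrace_gram ler_sum // => p _; rewrite ler_wpM2l.
Qed.

(** Each term satisfies <g, x>^2 <= X^-1(g) X(x), and the weighted sum of the factors X^-1(g) is the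
    trace. *)
Lemma gram_le_mxtrace X : posdef X ->
  lemx gram (\tr (gram *m invmx X) *: X).
Proof.
move=> pX x; rewrite quadZ quad_gram mxtrace_gram mulr_suml ler_sum // => p _.
by rewrite -mulrA ler_wpM2l // inv_CauchySchwarz.
Qed.

Hypothesis n_gt0 : (0 < n)%N.
Hypothesis gram_pd : posdef gram.

(** A zero trace forces w(p) = 0 or g(p) = 0 for every p, and then the form of [gram] vanishes at
    the all-ones vector, which is nonzero because n > 0. *)
Lemma mxtrace_gram_gt0 X : posdef X -> 0 < \tr (gram *m X).
Proof.
move=> pX; rewrite lt_def mxtrace_gram_ge0 ?andbT; last exact: posdefW.
apply/eqP => h0; pose x : 'cV[R]_n := const_mx 1.
have x0 : x != 0.
  apply/eqP => /matrixP /(_ (Ordinal n_gt0) 0); rewrite !mxE.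
  by move/eqP; rewrite oner_eq0.
have pX' : possemidef X by exact: posdefW.
move: (gram_pd.2 _ x0); rewrite quad_gram big1 ?ltxx // => p _.
move/eqP: h0; rewrite mxtrace_gram psumr_eq0 => [|i _]; last first.
  by rewrite mulr_ge0 // pX'.2.
move/allP/(_ p (mem_index_enum p)); rewrite mulf_eq0 => /orP[/eqP->|].
  by rewrite mul0r.
have [->|/pX.2] := eqVneq (g p) 0; last by rewrite lt_def => /andP[/negPf->].
by rewrite dotC dot0r expr0n /= mulr0.
Qed.

End Gram.

(** * The barrier argument of Batson, Spielman and Srivastava *)

Section BarrierShift.
Variables (R : realType) (n : nat) (I : finType).
Variables (w : I -> R) (g : I -> 'cV[R]_n).
Hypothesis w_ge0 : forall p, 0 <= w p.
Hypothesis n_gt0 : (0 < n)%N.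
Local Notation N := (gram w g).
Hypothesis N_pd : posdef N.

Lemma sandwich_pd W : posdef W -> posdef (W *m N *m W).
Proof.
move=> pW; split=> [|x x0]; first by rewrite !trmx_mul pW.1 N_pd.1 mulmxA.
rewrite -{1}pW.1 quad_conj; apply: N_pd.2; apply: contra x0 => /eqP h.
by rewrite -(mulKmx (posdef_unit pW) x) h mulmx0.
Qed.

Let tr_rank1_sandwich W v :
  \tr (N *m (W *m (v *m v^T) *m W)) = quad (W *m N *m W) v.
Proof.
rewrite -mxtrace_rank1 -!mulmxA mxtrace_mulC -!mulmxA mxtrace_mulC.
by rewrite -!mulmxA mxtrace_mulC -!mulmxA mxtrace_mulC -!mulmxA.
Qed.

(** Here X = u N - A and the potential is tr(N X^-1). Raising u by [delta] lowers it by at least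
    [delta] tr(N K); by the Sherman-Morrison formula the new edge raises it by c K(v) / (1 - c
    W(v)). The hypothesis on c says that the gain covers this cost. *)
Lemma upper_barrier X v (c delta : R) (W := invmx (X + delta *: N))
    (K := W *m N *m W) :
  posdef X -> 0 < delta -> 0 <= c -> v != 0 ->
  c * (quad K v / (delta * \tr (N *m K)) + quad W v) <= 1 ->
  posdef (X + delta *: N - c *: (v *m v^T)) /\
  \tr (N *m invmx (X + delta *: N - c *: (v *m v^T))) <= \tr (N *m invmx X).
Proof.
move=> pX d0 c0 v0 hc; set Y := X + delta *: N in W K hc *.
have pY : posdef Y by apply: posdefD => //; apply/posdefW/posdefZ.
have pW : posdef W by exact: posdef_inv.
have pK : posdef K by exact: sandwich_pd.
have t0 : 0 < \tr (N *m K) by exact: mxtrace_gram_gt0.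
have k0 : 0 < quad K v by exact: pK.2.
have kt0 : 0 < quad K v / (delta * \tr (N *m K)) by rewrite divr_gt0 // mulr_gt0.
have cs1 : c * quad W v < 1.
  have [->|c1] := eqVneq c 0; first by rewrite mul0r ltr01.
  have cp : 0 < c by rewrite lt_def c1.
  by apply: lt_le_trans hc; rewrite ltr_pM2l // ltrDr.
have pZ := posdef_rank1B c0 pY cs1; split=> //.
rewrite -scaleNr ShermanMorrison ?posdef_unit //; last first.
  by rewrite mulNr subr_eq0 eq_sym lt_eqF.
rewrite -/W mulNr.
set V := invmx X; have pV : posdef V by exact: posdef_inv.
have YV : V = W + delta *: (W *m N *m V).
  have e : W *m (Y *m V) = V by rewrite mulmxA mulVmx ?mul1mx // posdef_unit.
  rewrite -{1}e /Y mulmxDl mulmxV ?posdef_unit // mulmxDr mulmx1.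
  by rewrite -scalemxAl -scalemxAr !mulmxA.
have VY : V = W + delta *: (V *m N *m W).
  have := congr1 trmx YV; rewrite linearD linearZ /= !trmx_mul.
  by rewrite pV.1 pW.1 N_pd.1 mulmxA.
(* The resolvent identity used twice. The second order term is positive semidefinite, so dropping it
   only underestimates the gain from the shift. *)
have VE : V = W + delta *: K + delta ^+ 2 *: ((N *m W)^T *m V *m (N *m W)).
  rewrite {1}YV {1}VY mulmxDr scalerDr -addrA; congr (_ + (_ + _)).
  by rewrite -scalemxAr scalerA -expr2 trmx_mul pW.1 N_pd.1 !mulmxA.
rewrite mulmxBr -scalemxAr linearB linearZ /= tr_rank1_sandwich -/K.
have -> : \tr (N *m V) = \tr (N *m W) + delta * \tr (N *m K) +
    delta ^+ 2 * \tr (N *m ((N *m W)^T *m V *m (N *m W))).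
  by rewrite {1}VE !mulmxDr -!scalemxAr !linearD !linearZ.
have := mxtrace_gram_ge0 g w_ge0
  (possemidef_conj (N *m W) (posdefW pV)).
move: (\tr (N *m ((N *m W)^T *m V *m (N *m W)))) => r r0.
rewrite -addrA lerD2l mulNr opprK.
apply: (@le_trans _ _ (delta * \tr (N *m K))); last first.
  by rewrite lerDl mulr_ge0 // sqr_ge0.
rewrite mulrAC ler_pdivrMr; last by rewrite mulNr subr_gt0.
have : c * quad K v + delta * \tr (N *m K) * (c * quad W v) <=
     delta * \tr (N *m K).
  have := ler_wpM2l (ltW (mulr_gt0 d0 t0)) hc; rewrite mulr1; apply: le_trans.
  rewrite le_eqVlt; apply/orP; left; apply/eqP; field.
  by rewrite !gt_eqF.
lra.
Qed.

(** A potential of at most 1/q gives N <= X / q, hence X - N >= (1 - 1/q) X, and the trace grows by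
    at most the factor 1 / (1 - 1/q). *)
Lemma lower_barrier_pd X (q : R) : posdef X -> 1 < q ->
  \tr (N *m invmx X) <= q^-1 ->
  posdef (X - N) /\ \tr (N *m invmx (X - N)) <= (q - 1)^-1.
Proof.
move=> pX q1 hq.
have q0 : 0 < q by exact: lt_trans q1.
have h x : (1 - q^-1) * quad X x <= quad (X - N) x.
  rewrite quadB mulrBl mul1r lerD2l lerN2.
  apply: le_trans (gram_le_mxtrace g w_ge0 pX x) _; rewrite quadZ.
  by rewrite ler_wpM2r // (posdefW pX).2.
have c0 : 0 < 1 - q^-1 by rewrite subr_gt0 invf_lt1.
have pcX : posdef ((1 - q^-1) *: X) by exact: posdefZ.
have pY : posdef (X - N).
  apply: posdef_le pcX _ _ => [x|]; first by rewrite quadZ.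
  by rewrite linearB /= pX.1 N_pd.1.
split=> //.
have le : lemx (invmx (X - N)) (invmx ((1 - q^-1) *: X)).
  by apply: lemx_inv => // x; rewrite quadZ.
apply: le_trans (mxtrace_gram_le g w_ge0 le) _.
rewrite invmxZ ?posdef_unit //.
rewrite -scalemxAr linearZ /= mulrC.
apply: le_trans (ler_wpM2r _ hq) _; first by rewrite invr_ge0 ltW.
rewrite -invfM mulrBr mulr1 mulfV ?gt_eqF // .
Qed.

(** The mirror image, for X = A - l N: the shift by N costs at most tr(N K), and the new edge
    recovers c K(v) / (1 + c W(v)). The second order term of the resolvent expansion again has the
    favourable sign. *)
Lemma lower_barrier X v (c : R) (W := invmx (X - N)) (K := W *m N *m W) :
  posdef X -> posdef (X - N) -> 0 <= c ->
  1 <= c * (quad K v / \tr (N *m K) - quad W v) ->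
  posdef (X - N + c *: (v *m v^T)) /\
  \tr (N *m invmx (X - N + c *: (v *m v^T))) <= \tr (N *m invmx X).
Proof.
move=> pX pY c0 hc; set Y := X - N in W K hc pY *.
have pW : posdef W by exact: posdef_inv.
have pK : posdef K by exact: sandwich_pd.
have t0 : 0 < \tr (N *m K) by exact: mxtrace_gram_gt0.
split; first exact: posdef_rank1D.
have s0 : 0 <= c * quad W v by rewrite mulr_ge0 // (posdefW pW).2.
have s1 : 0 < 1 + c * quad W v by rewrite ltr_pwDl.
rewrite ShermanMorrison ?posdef_unit // ?gt_eqF //.
rewrite -/W mulmxBr -scalemxAr linearB linearZ /= tr_rank1_sandwich -/K.
set V := invmx X; have pV : posdef V by exact: posdef_inv.
have WV : W = V + W *m N *m V.
  have : W *m (Y *m V) = V by rewrite mulmxA mulVmx ?mul1mx // posdef_unit.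
  rewrite /Y mulmxBl mulmxV ?posdef_unit // mulmxBr mulmx1 => {1}<-.
  by rewrite !mulmxA subrK.
have VW : W = V + V *m N *m W.
  have := congr1 trmx WV; rewrite linearD /= !trmx_mul.
  by rewrite pV.1 pW.1 N_pd.1 mulmxA.
have WE : W = V + K - (N *m W)^T *m V *m (N *m W).
  rewrite trmx_mul pW.1 N_pd.1 /K {2}WV !mulmxDl !mulmxA.
  by rewrite -addrA addrK -VW.
have {1}-> : \tr (N *m W) = \tr (N *m V) + \tr (N *m K) -
    \tr (N *m ((N *m W)^T *m V *m (N *m W))).
  by rewrite {1}WE mulmxBr mulmxDr linearB linearD.
have := mxtrace_gram_ge0 g w_ge0
  (possemidef_conj (N *m W) (posdefW pV)).
move: (\tr (N *m ((N *m W)^T *m V *m (N *m W)))) => r r0.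
suff : \tr (N *m K) <= c / (1 + c * quad W v) * quad K v by lra.
rewrite mulrAC ler_pdivlMr //.
have := ler_wpM2l (ltW t0) hc; rewrite mulr1 => h.
suff : \tr (N *m K) * (c * (quad K v / \tr (N *m K) - quad W v)) =
   c * quad K v - \tr (N *m K) * (c * quad W v) by lra.
by field; rewrite gt_eqF.
Qed.

End BarrierShift.

Section BarrierStep.
Variables (R : realType) (n : nat) (I : finType).
Variables (w : I -> R) (g : I -> 'cV[R]_n).
Hypothesis w_ge0 : forall p, 0 <= w p.
Hypothesis n_gt0 : (0 < n)%N.
Local Notation N := (gram w g).
Hypothesis N_pd : posdef N.

(** The traces blow up as A approaches l N or u N, so bounding them leaves room for the next shift
    of the barriers. *)
Definition barrier (q u l : R) (A : 'M[R]_n) : Prop :=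
  [/\ A^T = A, posdef (u *: N - A), posdef (A - l *: N),
      \tr (N *m invmx (u *: N - A)) <= q^-1
    & \tr (N *m invmx (A - l *: N)) <= q^-1].

(** For t > 0, adding the edge with coefficient [w p / t] respects the upper barrier if t is at
    least [upper_cost], and the lower barrier if t is at most [lower_cost]. An edge is usable when
    the first number is below the second. *)
Definition upper_cost (delta : R) (W : 'M[R]_n) (p : I) : R :=
  let K := W *m N *m W in
  w p * (quad K (g p) / (delta * \tr (N *m K)) + quad W (g p)).

Definition lower_cost (W : 'M[R]_n) (p : I) : R :=
  let K := W *m N *m W in
  w p * (quad K (g p) / \tr (N *m K) - quad W (g p)).

(** The distance n q of the first barriers comes from tr(N (n q N)^-1) = n / (n q) = 1/q. *)
Lemma barrier_init (q : R) : 0 < q -> barrier q (n%:R * q) (- (n%:R * q)) 0.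
Proof.
move=> q0; have nq0 : 0 < n%:R * q by rewrite mulr_gt0 // ltr0n.
have e : \tr (N *m invmx ((n%:R * q) *: N)) = q^-1.
  rewrite invmxZ; last by apply: posdef_unit; exact: posdefZ.
  rewrite -scalemxAr mulmxV ?posdef_unit // linearZ /= mxtrace1.
  by field; rewrite !gt_eqF // ltr0n.
split; rewrite ?trmx0 ?subr0 ?sub0r -?scaleNr ?opprK ?e //; exact: posdefZ.
Qed.

Lemma sum_upper_cost delta W : 0 < delta -> posdef W ->
  \sum_p upper_cost delta W p = delta^-1 + \tr (N *m W).
Proof.
move=> d0 pW; rewrite /upper_cost; set K := W *m N *m W.
have t0 : 0 < \tr (N *m K) by apply: mxtrace_gram_gt0 => //; exact: sandwich_pd.
under eq_bigr do rewrite mulrDr mulrA.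
rewrite big_split /= -mulr_suml -!mxtrace_gram; congr (_ + _).
by field; rewrite !gt_eqF.
Qed.

Lemma sum_lower_cost W : posdef W ->
  \sum_p lower_cost W p = 1 - \tr (N *m W).
Proof.
move=> pW; rewrite /lower_cost; set K := W *m N *m W.
have t0 : 0 < \tr (N *m K) by apply: mxtrace_gram_gt0 => //; exact: sandwich_pd.
under eq_bigr do rewrite mulrBr mulrA.
rewrite big_split /= -mulr_suml sumrN -!mxtrace_gram; congr (_ - _).
by rewrite mulfV // gt_eqF.
Qed.

Lemma barrier_step (q u l : R) (A : 'M[R]_n) (delta := q / (q - 3))
    (WU := invmx ((u + delta) *: N - A)) (WL := invmx (A - (l + 1) *: N)) :
  3 < q -> barrier q u l A ->
  [/\ posdef ((u + delta) *: N - A), posdef (A - (l + 1) *: N),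
      exists p, upper_cost delta WU p < lower_cost WL p
    & forall p, upper_cost delta WU p < lower_cost WL p ->
        0 <= w p / lower_cost WL p /\
       barrier q (u + delta) (l + 1)
          (A + (w p / lower_cost WL p) *: (g p *m (g p)^T))].
Proof.
move=> q3 [sA pU pL tU tL].
have d0 : 0 < delta by rewrite divr_gt0; lra.
have UE : (u + delta) *: N - A = (u *: N - A) + delta *: N.
  by rewrite scalerDl addrAC.
have LE : A - (l + 1) *: N = (A - l *: N) - N.
  by rewrite scalerDl scale1r opprD addrA.
have pU' : posdef ((u + delta) *: N - A).
  by rewrite UE; apply: posdefD => //; apply/posdefW/posdefZ.
have q1 : 1 < q by lra.
have [pL' tL'] := lower_barrier_pd w_ge0 N_pd pL q1 tL.
rewrite -LE in pL' tL'.
have pWU : posdef WU by exact: posdef_inv.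
have pWL : posdef WL by exact: posdef_inv.
have tU' : \tr (N *m WU) <= q^-1.
  apply: le_trans tU; apply: mxtrace_gram_le => //; apply: lemx_inv => // x.
  by rewrite UE [leRHS]quadD lerDl quadZ mulr_ge0 ?(posdefW N_pd).2 // ltW.
split=> //.
  have sumlt : \sum_p upper_cost delta WU p < \sum_p lower_cost WL p.
    rewrite sum_upper_cost // sum_lower_cost // ltrBrDr.
    have -> : delta^-1 = 1 - 3 * q^-1 by rewrite /delta; field; lra.
    have h2 : (q - 1)^-1 < 2 * q^-1.
      rewrite -subr_gt0 (_ : _ - _ = (q - 2) / (q * (q - 1))); last first.
        by field; lra.
      by rewrite divr_gt0 ?mulr_gt0 //; lra.
    lra.
  apply: contrapT => /forallNP h.
  have : \sum_p lower_cost WL p <= \sum_p upper_cost delta WU p.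
    by apply: ler_sum => p _; rewrite leNgt; apply/negP; exact: h.
  by rewrite leNgt sumlt.
move=> p ltp; set L := lower_cost WL p in ltp *; set c := w p / L.
have pKU : posdef (WU *m N *m WU) by exact: sandwich_pd.
have tKU : 0 < \tr (N *m (WU *m N *m WU)) by exact: mxtrace_gram_gt0.
have U0 : 0 <= upper_cost delta WU p.
  rewrite /upper_cost mulr_ge0 // addr_ge0 ?(posdefW pWU).2 //.
  by rewrite divr_ge0 ?(posdefW pKU).2 // mulr_ge0 ?ltW.
have L0 : 0 < L by exact: le_lt_trans ltp.
have c0 : 0 <= c by rewrite divr_ge0 // ltW.
have g0 : g p != 0.
  apply/eqP => g0; move: L0; rewrite /L /lower_cost g0 !quad0 mul0r subr0.
  by rewrite mulr0 ltxx.
split=> //.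
have [|pU2 tU2] := upper_barrier w_ge0 n_gt0 N_pd pU d0 c0 g0.
  rewrite -UE -/WU /c mulrAC ler_pdivrMr // mul1r ltW //.
rewrite LE in pL'.
have [|pL2 tL2] := lower_barrier w_ge0 n_gt0 N_pd (v := g p) pL pL' c0.
  by rewrite -LE -/WL /c mulrAC ler_pdivlMr // mul1r.
have e1 : (u + delta) *: N - (A + c *: (g p *m (g p)^T)) =
    u *: N - A + delta *: N - c *: (g p *m (g p)^T).
  by rewrite opprD addrA UE.
have e2 : A + c *: (g p *m (g p)^T) - (l + 1) *: N =
    A - l *: N - N + c *: (g p *m (g p)^T).
  by rewrite addrAC LE.
split; rewrite ?e1 ?e2 //.
- by rewrite linearD linearZ /= rank1_sym sA.
- exact: le_trans tU2 tU.
- exact: le_trans tL2 tL.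
Qed.

End BarrierStep.

(** * Laplacian-like matrices and chains *)

Section LaplacianLike.
Variables (R : realType) (n : nat).
Implicit Types (M N A : 'M[R]_n).

Definition lap M : Prop :=
  [/\ M^T = M, forall i j, i != j -> M i j <= 0 & forall i, 0 <= \sum_j M i j].

(** The pair (i, i) stands for e_i, a loop that carries the excess of row i; the other pairs stand
    for e_i - e_j. *)
Definition edge (p : 'I_n * 'I_n) : 'cV[R]_n :=
  \col_i ((i == p.1)%:R - ((i == p.2) && (p.1 != p.2))%:R).

(** An unordered pair occurs as two ordered pairs, hence the half. *)
Definition edge_weight N (p : 'I_n * 'I_n) : R :=
  if p.1 == p.2 then \sum_j N p.1 j else - N p.1 p.2 / 2.

Lemma quad_sum M x : quad M x = \sum_i \sum_j M i j * (x i 0 * x j 0).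
Proof.
rewrite quadE /dot mxE; apply: eq_bigr => i _; rewrite !mxE mulr_sumr.
by apply: eq_bigr => j _; rewrite mulrCA.
Qed.

(** Polarisation at e_i, e_j and e_i + e_j recovers the entry (i, j). *)
Lemma quad_inj M N : M^T = M -> N^T = N -> (forall x, quad M x = quad N x) ->
  M = N.
Proof.
move=> sM sN h; apply/matrixP => i j.
pose e (k : 'I_n) : 'cV[R]_n := \col_l (l == k)%:R.
have ent (X : 'M[R]_n) k l : dot (e k) (X *m e l) = X k l.
  rewrite /dot mxE (bigD1 k) //= big1 ?addr0 => [|a ak].
    rewrite !mxE eqxx mul1r (bigD1 l) //= big1 ?addr0 => [|b bl].
      by rewrite mxE eqxx mulr1.
    by rewrite mxE (negPf bl) mulr0.
  by rewrite !mxE (negPf ak) mul0r.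
have sX (X : 'M[R]_n) : X^T = X -> quad X (e j + 1 *: e i) =
    quad X (e j) + 2 * X i j + quad X (e i).
  by move=> /quad_addv->; rewrite ent mulr1 expr1n mul1r.
have := h (e j + 1 *: e i); rewrite !sX // !h => /addIr /addrI.
by move/mulfI; apply; rewrite pnatr_eq0.
Qed.

Lemma dot_edge p x :
  dot (edge p) x = x p.1 0 - (p.1 != p.2)%:R * x p.2 0.
Proof.
rewrite /dot mxE; under eq_bigr do rewrite !mxE mulrBl.
rewrite sumrB (bigD1 p.1) //= big1 ?addr0 => [|i /negPf->]; last by rewrite mul0r.
rewrite eqxx mul1r; congr (_ - _).
rewrite (bigD1 p.2) //= big1 ?addr0 => [|i /negPf->]; last by rewrite mul0r.
by rewrite eqxx.
Qed.

Lemma edge_weight_ge0 N p : lap N -> 0 <= edge_weight N p.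
Proof.
move=> [_ h1 h2]; rewrite /edge_weight; case: ifPn => [_|/h1 h]; first exact: h2.
by rewrite divr_ge0 // oppr_ge0.
Qed.

(** This is x^T N x = sum_i r_i x_i^2 - sum_{i,j} (N_ij / 2) (x_i - x_j)^2 with r_i the row sums.
    After expansion the two sides differ by the sums of N_ij x_i^2 and of N_ij x_j^2, which agree by
    symmetry. *)
Lemma gram_edge N : N^T = N -> gram (edge_weight N) edge = N.
Proof.
move=> sN; apply: quad_inj => //; first exact: gram_sym.
move=> x; rewrite quad_gram.
pose F (i j : 'I_n) : R := (i == j)%:R * (\sum_k N i k) * x i 0 ^+ 2
   - N i j / 2 * (x i 0 - x j 0) ^+ 2.
have -> : \sum_p edge_weight N p * dot (edge p) x ^+ 2 = \sum_i \sum_j F i j.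
  rewrite pair_bigA; apply: eq_bigr => -[i j] _ /=.
  rewrite dot_edge /edge_weight /F /=; have [<-|ij] := eqVneq i j.
    by rewrite subrr mul0r subr0 expr0n mulr0 subr0 mul1r.
  by rewrite !mul0r sub0r mul1r mulNr mulNr.
have -> : \sum_i \sum_j F i j = \sum_i \sum_j
    (N i j * x i 0 ^+ 2 - N i j / 2 * (x i 0 - x j 0) ^+ 2).
  apply: eq_bigr => i _; rewrite !sumrB; congr (_ - _).
  rewrite (bigD1 i) //= [X in _ + X]big1 ?addr0 => [|j ji].
    by rewrite eqxx mul1r mulr_suml.
  by rewrite eq_sym (negPf ji) !mul0r.
have symm (f : 'I_n -> 'I_n -> R) : \sum_i \sum_j N i j * f i j =
    \sum_i \sum_j N i j * f j i.
  rewrite exchange_big; apply: eq_bigr => i _; apply: eq_bigr => j _ /=.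
  by rewrite -{1}sN mxE.
rewrite quad_sum; apply/eqP; rewrite -subr_eq0; apply/eqP.
have two : (2 : R) != 0 by rewrite pnatr_eq0.
apply: (mulIf two); rewrite mul0r.
suff -> : (\sum_i \sum_j (N i j * x i 0 ^+ 2 - N i j / 2 * (x i 0 - x j 0) ^+ 2) -
  \sum_i \sum_j N i j * (x i 0 * x j 0)) * 2 =
  \sum_i \sum_j N i j * x i 0 ^+ 2 - \sum_i \sum_j N i j * x j 0 ^+ 2.
  by rewrite (symm (fun i _ => x i 0 ^+ 2)) subrr.
rewrite -!sumrB mulr_suml; apply: eq_bigr => i _.
rewrite -!sumrB mulr_suml; apply: eq_bigr => j _.
by field.
Qed.

Lemma lapD M N : lap M -> lap N -> lap (M + N).
Proof.
move=> [sM oM rM] [sN oN rN]; split=> [|i j ij|i].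
- by rewrite linearD /= sM sN.
- by rewrite mxE -[leRHS]addr0 lerD ?oM ?oN.
- by under eq_bigr do rewrite mxE; rewrite big_split addr_ge0 ?rM ?rN.
Qed.

Lemma lapZ c M : 0 <= c -> lap M -> lap (c *: M).
Proof.
move=> c0 [sM oM rM]; split=> [|i j ij|i].
- by rewrite linearZ /= sM.
- by rewrite mxE mulr_ge0_le0 ?oM.
- by under eq_bigr do rewrite mxE; rewrite -mulr_sumr mulr_ge0.
Qed.

Lemma lap0 : lap 0.
Proof.
by split=> [|i j _|i]; rewrite ?trmx0 ?mxE // big1 // => j _; rewrite mxE.
Qed.

Lemma edge_rank1E p i j : (edge p *m (edge p)^T) i j = edge p i 0 * edge p j 0.
Proof. by rewrite mxE big_ord_recl big_ord0 addr0 !mxE. Qed.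

Lemma lap_edge p : lap (edge p *m (edge p)^T).
Proof.
split=> [|i j ij|i]; first exact: rank1_sym.
  rewrite edge_rank1E !mxE; case: p => a b /=.
  have h1 : (i == a) && (j == a) = false.
    by apply: contraNF ij => /andP[/eqP-> /eqP->].
  have h2 : (i == b) && (j == b) = false.
    by apply: contraNF ij => /andP[/eqP-> /eqP->].
  move: h1 h2; case: (i == a); case: (j == a) => //; case: (i == b);
    by case: (j == b) => //; case: (a == b) => //= _ _; lra.
under eq_bigr do rewrite edge_rank1E.
rewrite -mulr_sumr; have -> : \sum_j edge p j 0 = 1 - (p.1 != p.2)%:R.
  have := dot_edge p (const_mx 1); rewrite /dot !mxE mulr1 => <-.
  by apply: eq_bigr => k _; rewrite !mxE mulr1.
rewrite !mxE; have [<-|_] := eqVneq p.1 p.2; last by rewrite subrr mulr0.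
by rewrite andbF !subr0 mulr1 ler0n.
Qed.

End LaplacianLike.

(** * Counting nonzero entries *)

Section Sparsity.
Variables (R : realType) (n : nat).
Implicit Types (M N : 'M[R]_n).

Lemma nnz_sub M N : (forall i j, N i j = 0 -> M i j = 0) -> (nnz M <= nnz N)%N.
Proof.
move=> h; apply: subset_leq_card; apply/fintype.subsetP => -[i j]; rewrite !inE /=.
by apply: contra => /eqP /h ->.
Qed.

Lemma nnzD M N : (nnz (M + N) <= nnz M + nnz N)%N.
Proof.
rewrite /nnz; apply: leq_trans (leq_card_setU _ _); apply: subset_leq_card.
apply/fintype.subsetP => -[i j]; rewrite !inE /= mxE.
have [->|//] := eqVneq (M i j) 0; have [->|//] := eqVneq (N i j) 0.
by rewrite addr0 eqxx.
Qed.

Lemma nnzZ c M : (nnz (c *: M) <= nnz M)%N.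
Proof. by apply: nnz_sub => i j h; rewrite mxE h mulr0. Qed.

Lemma nnzN M : (nnz (- M) <= nnz M)%N.
Proof. by apply: nnz_sub => i j h; rewrite mxE h oppr0. Qed.

Lemma nnz_diag (d : 'rV[R]_n) : (nnz (diag_mx d) <= n)%N.
Proof.
rewrite /nnz -[leqRHS]card_ord.
rewrite -(card_imset _ (_ : injective (fun i : 'I_n => (i, i)))) => [|i j []//].
apply: subset_leq_card; apply/fintype.subsetP => -[i j]; rewrite !inE /= mxE.
have [<-|_] := eqVneq i j; last by rewrite mulr0n eqxx.
by move=> _; apply/imsetP; exists i.
Qed.

Lemma nnz0 : nnz (0 : 'M[R]_n) = 0%N.
Proof.
by apply/eqP; rewrite cards_eq0; apply/eqP/setP => p; rewrite !inE mxE eqxx.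
Qed.

Lemma nnz_edge (p : 'I_n * 'I_n) : (nnz (edge R p *m (edge R p)^T) <= 4)%N.
Proof.
have h : (#|[set p.1; p.2]| <= 2)%N by rewrite cards2; case: (_ == _).
apply: (@leq_trans #|finset.setX [set p.1; p.2] [set p.1; p.2]|); last first.
  by rewrite cardsX; apply: (leq_mul h h).
apply: subset_leq_card; apply/fintype.subsetP => -[i j]; rewrite !inE /= edge_rank1E.
have e k : edge R p k 0 != 0 -> (k == p.1) || (k == p.2).
  by rewrite mxE; case: (k == p.1); case: (k == p.2) => //=; rewrite subr0 eqxx.
by rewrite mulf_eq0 negb_or => /andP[/e-> /e->].
Qed.

Lemma nnz_le_sqr M : (nnz M <= n * n)%N.
Proof. by apply: leq_trans (max_card _) _; rewrite card_prod card_ord. Qed.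

End Sparsity.

(** * One level of the chain *)

Section Levels.
Variables (R : realType) (n : nat).
Variable d : 'rV[R]_n.
Hypothesis d_gt0 : forall i, 0 < d 0 i.
Local Notation D := (diag_mx d).
Implicit Types (A : 'M[R]_n).

Definition reduced A : 'M[R]_n := D - A *m invmx D *m A.

(** [lam] is the quality of a level, the quantity that grows along the chain. Semidefiniteness of
    [A] is there for [psd_sandwich]. *)
Definition level (lam : R) A : Prop :=
  [/\ A^T = A, entrywise_nonneg A, possemidef A, lap (D - A)
    & lemx (lam *: D) (D - A)].

Lemma quad_diag x : quad D x = \sum_i d 0 i * x i 0 ^+ 2.
Proof.
rewrite quad_sum; apply: eq_bigr => i _; rewrite (bigD1 i) //= big1 => [|j ji].
  by rewrite mxE eqxx mulr1n addr0.
by rewrite mxE eq_sym (negPf ji) mulr0n mul0r.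
Qed.

Lemma diag_mx_sym : D^T = D.
Proof. exact: tr_diag_mx. Qed.

Lemma diag_posdef : posdef D.
Proof.
split=> [|x x0]; first exact: diag_mx_sym.
have t0 i : 0 <= d 0 i * x i 0 ^+ 2 by rewrite mulr_ge0 ?sqr_ge0 // ltW.
rewrite quad_diag lt_def sumr_ge0 // andbT; apply: contra x0.
rewrite psumr_eq0 // => /allP h; apply/eqP/matrixP => i j; rewrite ord1 mxE.
have := h i (mem_index_enum i); rewrite mulf_eq0 sqrf_eq0 gt_eqF //= => /eqP//.
Qed.

Lemma invmx_diag : invmx D = diag_mx (\row_i (d 0 i)^-1).
Proof.
apply: invmx_eq; apply/matrixP => i j; rewrite mul_diag_mx !mxE.
have [->|] := eqVneq i j; last by rewrite !mulr0n mulr0.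
by rewrite !mulr1n mulfV // gt_eqF.
Qed.

Lemma mul_invmx_diag A i j : (A *m invmx D) i j = A i j / d 0 j.
Proof. by rewrite invmx_diag mul_mx_diag !mxE. Qed.

Lemma mul_invmx_diagl m (A : 'M[R]_(n, m)) i j : (invmx D *m A) i j = A i j / d 0 i.
Proof. by rewrite invmx_diag mul_diag_mx !mxE mulrC. Qed.

Lemma level_weaken lam lam' A : lam' <= lam -> level lam A -> level lam' A.
Proof.
move=> ll [h1 h2 h3 h4 h5]; split=> //; apply: lemx_trans h5 => x.
by rewrite !quadZ ler_wpM2r // (posdefW diag_posdef).2.
Qed.

Lemma reduced_sym A : A^T = A -> (reduced A)^T = reduced A.
Proof.
move=> sA; rewrite linearB /= !trmx_mul sA diag_mx_sym mulmxA; congr (_ - _).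
by rewrite trmx_invmx_sym // diag_mx_sym.
Qed.

(** The rows of D^-1 A sum to at most 1, so the row sums of A D^-1 A do not exceed those of A, which
    are at most the diagonal of D. *)
Lemma reduced_lap lam A : level lam A -> lap (reduced A).
Proof.
move=> [sA nA pA [_ _ rA] _].
have EE i j : (A *m invmx D *m A) i j = \sum_k A i k / d 0 k * A k j.
  by rewrite mxE; apply: eq_bigr => k _; rewrite mul_invmx_diag.
have RE i j : reduced A i j = d 0 i *+ (i == j) - \sum_k A i k / d 0 k * A k j.
  by rewrite -EE /reduced mxE [X in _ + X]mxE mxE.
have rsA i : \sum_j A i j <= d 0 i.
  rewrite -subr_ge0; have := rA i.
  under eq_bigr do rewrite !mxE.
  rewrite sumrB (bigD1 i) //= eqxx mulr1n [X in _ + X - _]big1 ?addr0 //.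
  by move=> j; rewrite eq_sym => /negPf->.
split=> [|i j ij|i]; first exact: reduced_sym.
  rewrite RE (negPf ij) mulr0n sub0r oppr_le0.
  by rewrite sumr_ge0 // => k _; rewrite mulr_ge0 // divr_ge0 // ltW.
under eq_bigr => j _ do rewrite RE.
rewrite sumrB (bigD1 i) //= eqxx mulr1n [X in _ + X - _]big1 ?addr0; last first.
  by move=> j; rewrite eq_sym => /negPf->.
rewrite subr_ge0; apply: le_trans (rsA i); rewrite exchange_big /=.
apply: ler_sum => k _; rewrite -mulr_sumr -[leRHS]mulr1 -mulrA ler_wpM2l //.
by rewrite mulrC ler_pdivrMr // mul1r.
Qed.

Lemma level_le lam A : level lam A -> lemx A ((1 - lam) *: D).
Proof. by case=> _ _ _ _ h x; have := h x; rewrite !quadZ quadB; lra. Qed.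

(** From A <= (1 - lam) D, [psd_sandwich] gives A D^-1 A <= (1 - lam) A <= (1 - lam)^2 D, and 1 - (1
    - lam)^2 = 2 lam - lam^2. *)
Lemma reduced_bounds lam A : 0 < lam -> lam < 1 -> level lam A ->
  lemx ((2 * lam - lam ^+ 2) *: D) (reduced A) /\ lemx (reduced A) D.
Proof.
move=> l0 l1 lA; have [sA nA pA rA hA] := lA; split=> x; last first.
  rewrite /reduced quadB lerBlDr lerDl -{1}sA quad_conj.
  by apply: (posdefW _).2; apply: posdef_inv; exact: diag_posdef.
have c0 : 0 < 1 - lam by rewrite subr_gt0.
have := psd_sandwich c0 pA diag_posdef (level_le lA) x.
rewrite quadZ /reduced !(quadB, quadZ) => h.
have h2 : 0 <= (1 - lam) * (quad D x - quad A x - lam * quad D x).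
  by rewrite mulr_ge0 ?(ltW c0) // subr_ge0; have := hA x; rewrite quadZ quadB.
rewrite expr2; lra.
Qed.

Lemma reduced_posdef lam A : 0 < lam -> lam < 1 -> level lam A ->
  posdef (reduced A).
Proof.
move=> l0 l1 lA; have [h _] := reduced_bounds l0 l1 lA.
apply: (posdef_le _ h); last by apply: reduced_sym; case: lA.
apply: posdefZ; last exact: diag_posdef.
by rewrite (_ : _ - _ = lam * (2 - lam)); [rewrite mulr_gt0 //; lra | ring].
Qed.

Definition level_step (eta : R) (k : nat) A A' : Prop :=
  [/\ lap (D - A'), (nnz (D - A') <= k)%N,
      lemx ((1 - eta) *: reduced A) (D - A') & lemx (D - A') (reduced A)].

(** D - A' <= D - A D^-1 A makes A' positive semidefinite, so its diagonal is nonnegative; off the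
    diagonal the signs come from [lap (D - A')]. *)
Lemma level_next eta k lam A A' : 0 < lam -> lam < 1 -> eta < 1 ->
  level lam A -> level_step eta k A A' ->
  level ((1 - eta) * (2 * lam - lam ^+ 2)) A'.
Proof.
move=> l0 l1 e1 lA [lM kM h1 h2]; have [h3 h4] := reduced_bounds l0 l1 lA.
have [sA nA pA rA hA] := lA.
have sA' : A'^T = A'.
  have [sM _ _] := lM.
  have : (D - (D - A'))^T = D - (D - A') by rewrite linearB /= sM diag_mx_sym.
  by rewrite opprB addrC subrK.
have pA' : possemidef A'.
  split=> // x; have := h2 x; rewrite /reduced !quadB.
  rewrite -{1}sA quad_conj => h.
  have := (posdefW (posdef_inv diag_posdef)).2 (A *m x); lra.
have ent (X : 'M[R]_n) i : X i i = quad X (delta_mx i 0).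
  rewrite quad_sum (bigD1 i) //= (bigD1 i) //= !big1 ?addr0.
  - by rewrite mxE !eqxx !mulr1.
  - by move=> j ji; rewrite big1 // => k0 _; rewrite mxE (negPf ji) mul0r mulr0.
  - by move=> j ji; rewrite !mxE (negPf ji) !mulr0.
split=> //.
  move=> i j; have [<-|ij] := eqVneq i j; first by rewrite ent pA'.2.
  have [_ /(_ i j ij) + _] := lM.
  by rewrite mxE mxE (negPf ij) mulr0n mxE sub0r oppr_le0.
apply: lemx_trans h1 => x; rewrite !quadZ -mulrA ler_wpM2l ?subr_ge0 ?(ltW e1) //.
by have := h3 x; rewrite quadZ.
Qed.

(* With D fixed, M = D - A satisfies
   M^-1 = (D^-1 + (1 + D^-1 A) (D - A D^-1 A)^-1 (1 + A D^-1)) / 2. *)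
Lemma inverse_reduction A : D - A \in unitmx -> reduced A \in unitmx ->
  invmx (D - A) = 2^-1 *: (invmx D +
    (1%:M + invmx D *m A) *m invmx (reduced A) *m (1%:M + A *m invmx D)).
Proof.
move=> uM uN; have uD := posdef_unit diag_posdef.
(* With this factorisation the outer factors are D^-1 (D + A) and (D + A) D^-1, and the product
   collapses to (D - A)^-1 (D + A) D^-1. *)
have NE : reduced A = (D - A) *m invmx D *m (D + A).
  rewrite mulmxBl mulmxV // mulmxDr !mulmxBl !mul1mx.
  by rewrite -mulmxA mulVmx // mulmx1 addrA subrK.
have uP : D + A \in unitmx.
  by move: uN; rewrite NE !unitmx_mul => /andP[].
have e1 : 1%:M + invmx D *m A = invmx D *m (D + A).
  by rewrite mulmxDr mulVmx.
have e2 : 1%:M + A *m invmx D = (D + A) *m invmx D.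
  by rewrite mulmxDl mulmxV.
have e3 : invmx (reduced A) = invmx (D + A) *m D *m invmx (D - A).
  apply: invmx_eq; rewrite NE -!mulmxA (mulmxA (D + A)) mulmxV // mul1mx.
  by rewrite (mulmxA (invmx D)) mulVmx // mul1mx mulmxV.
rewrite e1 e2 e3.
have -> : invmx D *m (D + A) *m (invmx (D + A) *m D *m invmx (D - A)) *m
    ((D + A) *m invmx D) = invmx (D - A) *m ((D + A) *m invmx D).
  rewrite -!mulmxA (mulmxA (D + A)) mulmxV // mul1mx.
  by rewrite (mulmxA (invmx D) D) mulVmx // mul1mx.
have -> : D + A = D + D - (D - A) by rewrite opprB -addrA [D + (A - D)]addrCA subrr addr0.
rewrite mulmxA mulmxBr mulVmx // mulmxDr mulmxBl mulmxDl mul1mx.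
rewrite -!mulmxA mulmxV // mulmx1 [X in _ *: X]addrC subrK.
by apply/matrixP => i j; rewrite !mxE; field.
Qed.

End Levels.

(** * The first level *)

Section Initial.
Variables (R : realType) (n : nat) (M : 'M[R]_n).
Hypothesis M_sddm : sddm M.

Definition diag2 : 'rV[R]_n := \row_i (2 * M i i).

Lemma sddm_diag_gt0 i : 0 < M i i.
Proof.
have [[sM pM] _ _] := M_sddm.
have : 0 < quad M (delta_mx i 0).
  apply: pM; apply/eqP => /matrixP /(_ i 0); rewrite !mxE !eqxx => /eqP.
  by rewrite oner_eq0.
rewrite quad_sum (bigD1 i) //= (bigD1 i) //= !big1 ?addr0.
- by rewrite mxE !eqxx !mulr1.
- by move=> j ji; rewrite big1 // => k0 _; rewrite mxE (negPf ji) mul0r mulr0.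
- by move=> j ji; rewrite !mxE (negPf ji) !mulr0.
Qed.

Lemma diag2_gt0 i : 0 < diag2 0 i.
Proof. by rewrite mxE mulr_gt0 // sddm_diag_gt0. Qed.

Lemma sddm_lap : lap M.
Proof.
have [[sM pM] [_ dM] oM] := M_sddm; split=> // i.
rewrite (bigD1 i) //= -[X in _ + X]opprK subr_ge0 -sumrN.
apply: le_trans (dM i); apply: ler_sum => j ji.
by rewrite ler_normr lexx orbT.
Qed.

(** For semidefiniteness compare D - M at x with M at y = |x|: the diagonals agree because D doubles
    that of M, and -M_ij x_i x_j >= M_ij |x_i| |x_j| as M_ij <= 0. *)
Lemma initial_level lam : lemx (lam *: diag_mx diag2) M ->
  level diag2 lam (diag_mx diag2 - M).
Proof.
move=> h; have [[sM pM] [_ dM] oM] := M_sddm.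
have ME : diag_mx diag2 - (diag_mx diag2 - M) = M by rewrite opprB addrC subrK.
have sA : (diag_mx diag2 - M)^T = diag_mx diag2 - M.
  by rewrite linearB /= tr_diag_mx sM.
split; rewrite ?ME //; last exact: sddm_lap.
  move=> i j; rewrite !mxE; have [<-|ij] := eqVneq i j.
    by rewrite mulr1n; have := sddm_diag_gt0 i; lra.
  by rewrite mulr0n sub0r oppr_ge0 oM.
split=> // x; pose y : 'cV[R]_n := \col_i `|x i 0|.
apply: le_trans ((posdefW (conj sM pM)).2 y) _; rewrite !quad_sum.
apply: ler_sum => i _; apply: ler_sum => j _; rewrite !mxE.
have [<-|ij] := eqVneq i j.
  rewrite mulr1n -normrM ger0_norm -?expr2 ?sqr_ge0 // ler_wpM2r ?sqr_ge0 //.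
  by have := sddm_diag_gt0 i; lra.
rewrite mulr0n sub0r mulNr -normrM.
have := oM i j ij; have := ler_norm (- (x i 0 * x j 0)); rewrite normrN.
by nra.
Qed.

End Initial.

(** * Chains built from such levels *)

Section GoodChain.
Variables (R : realType) (n : nat) (M : 'M[R]_n).
Hypothesis M_sddm : sddm M.
Local Notation dv := (diag2 M).
Local Notation D := (diag_mx dv).

(** Stated for the first [i] steps so that it can serve as invariant of the construction. The
    exponent d - 3 is the number found by the search; d >= 3 keeps the error of a level at most
    1/18. *)
Definition chain_prefix (d i : nat) (A : nat -> 'M[R]_n) : Prop :=
  [/\ (3 <= d)%N, A 0%N = D - M,
      posdef ((5 / 4) ^+ (d - 3) *: M - D)
    & forall j, (j < i)%N ->
        level_step dv (5 / (30 * d%:R)) (4 * n * (30 * d) ^ 2) (A j) (A j.+1)].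

Definition good_chain d := chain_prefix d d.

Variables (d : nat) (A : nat -> 'M[R]_n).

Local Notation eta := (5 / (30 * d%:R) : R).

(** The value of [lam] guaranteed on level [i]. The cap 1/2 keeps the growth factor 2 - lam at least
    3/2. *)
Definition level_bound i : R := Num.min 2^-1 ((5 / 4) ^+ i * (4 / 5) ^+ (d - 3)).

Lemma level_bound_gt0 i : 0 < level_bound i.
Proof.
rewrite /level_bound lt_min invr_gt0 ltr0n /= mulr_gt0 //;
  by apply: exprn_gt0; rewrite divr_gt0 ?ltr0n.
Qed.

Lemma level_bound_le i : level_bound i <= 2^-1.
Proof. by rewrite /level_bound ge_min lexx. Qed.

Lemma level_bound_lt1 i : level_bound i < 1.
Proof. by have := level_bound_le i; lra. Qed.

Lemma eta_small : (3 <= d)%N -> 0 < eta <= 18^-1.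
Proof.
move=> d3N; have d3 : (3 : R) <= d%:R by rewrite (ler_nat _ 3).
have d0 : (d%:R : R) != 0 by rewrite gt_eqF //; lra.
have e : eta = 6^-1 / d%:R by field.
rewrite e divr_gt0 //=; last by lra.
by rewrite ler_pdivrMr; lra.
Qed.

Lemma chain_prefix_level i : chain_prefix d i A -> level dv (level_bound i) (A i).
Proof.
case=> d3 A0 pK.
elim: i => [_|i IH st].
  rewrite A0; apply: initial_level => // x; rewrite quadZ.
  have Dx : 0 <= quad D x.
    by apply: (posdefW _).2; apply: diag_posdef; exact: diag2_gt0.
  have : 0 <= quad ((5 / 4) ^+ (d - 3) *: M - D) x by apply: (posdefW _).2.
  rewrite quadB quadZ subr_ge0 => h.
  apply: (@le_trans _ _ ((4 / 5) ^+ (d - 3) * quad D x)).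
    by rewrite ler_wpM2r // /level_bound ge_min expr0 mul1r lexx orbT.
  apply: le_trans (ler_wpM2l _ h) _; first by rewrite exprn_ge0 // divr_ge0 ?ler0n.
  rewrite mulrA -exprMn (_ : 4 / 5 * (5 / 4) = 1) ?expr1n ?mul1r //.
  by field.
have /andP[e0 e1] := eta_small d3.
have {}IH := IH (fun j ji => st j (ltnW ji)).
have := level_next (diag2_gt0 M_sddm) (level_bound_gt0 i) (level_bound_lt1 i) _ IH (st i (ltnSn i)).
move=> /(_ _) h; apply: level_weaken (h _) => //; try exact: diag2_gt0; last by lra.
have l0 := level_bound_gt0 i; have l1 := level_bound_le i.
apply: (@le_trans _ _ (5 / 4 * level_bound i)).
  rewrite /level_bound minr_pMr ?divr_ge0 ?ler0n // le_min !ge_min.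
  rewrite exprS mulrA lexx orbT andbT; apply/orP; left; lra.
have -> : 2 * level_bound i - level_bound i ^+ 2 =
    (2 - level_bound i) * level_bound i by ring.
rewrite mulrA ler_wpM2r ?ltW //.
(* The growth (1 - eta) (2 - lam) is at least 17/18 times 3/2, which exceeds 5/4. *)
have := @ler_pM _ (17 / 18) (1 - eta) (3 / 2) (2 - level_bound i).
lra.
Qed.

Hypothesis A_good : good_chain d A.

Let d3 : (3 : R) <= d%:R.
Proof. by case: A_good => d3 _ _ _; rewrite (ler_nat _ 3). Qed.

Lemma good_chain_level i : (i <= d)%N -> level dv (level_bound i) (A i).
Proof.
move=> id; case: A_good => d3' A0 pK st.
by apply: chain_prefix_level; split=> // j ji; apply: st; exact: leq_trans ji id.
Qed.

Lemma good_chain_pos i : (i <= d)%N -> posdef (D - A i).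
Proof.
move=> id; have [_ _ _ [sM _ _] h] := good_chain_level id.
apply: posdef_le h sM; apply: posdefZ; first exact: level_bound_gt0.
by apply: diag_posdef; exact: diag2_gt0.
Qed.

(** On level d the second term of the minimum is (5/4)^3, so the cap 1/2 is attained. *)
Lemma good_chain_last : lemx (2^-1 *: D) (D - A d).
Proof.
have [_ _ _ _ h] := good_chain_level (leqnn d).
apply: lemx_trans h => x; rewrite !quadZ ler_wpM2r //.
  by apply: (posdefW _).2; apply: diag_posdef; exact: diag2_gt0.
rewrite /level_bound le_min lexx /= -{1}(subnK (_ : 3 <= d)%N); last by case: A_good.
rewrite exprD mulrAC -exprMn (_ : 5 / 4 * (4 / 5) = 1 :> R); last by field.
by rewrite expr1n mul1r; lra.
Qed.

Lemma good_chain_approx_inverse :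
  approx_inverse_chain M d (fun=> D) A.
Proof.
have [d3' A0 _ st] := A_good.
have pD : posdef D by apply: diag_posdef; exact: diag2_gt0.
split.
- by rewrite A0 opprB addrC subrK.
- move=> i id; have [sA nA _ _ _] := good_chain_level id; split=> //.
  + move=> a b; rewrite mxE; case: eqP => _; rewrite ?mulr0n // mulr1n.
    by rewrite ltW ?diag2_gt0.
  + exact: good_chain_pos.
have d3r := d3; have d0 : (0 : R) < d%:R by lra.
(* The errors sum to d (1/d) + 1 = 2. A level needs only (1 + 1/d) (1 - 1/(6d)) >= 1; at the end D /
   2 <= D - A_d <= D and e >= 2. *)
exists (fun i => if (i < d)%N then d%:R^-1 else 1); split.
- rewrite big_nat_recr //= ltnn (eq_big_nat _ _ (F2 := fun=> d%:R^-1)) => [|i /andP[_ ->]//].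
  rewrite sumr_const_nat subn0 -[X in X + 1]mulr_natl mulfV ?gt_eqF //; lra.
- move=> i id; rewrite id; have [[sM _ _] _ h1 h2] := st i id.
  have sN : (reduced dv (A i))^T = reduced dv (A i).
    by apply: reduced_sym; have [] := good_chain_level (ltnW id).
  have pN := (good_chain_level (ltnW id)).
  have NN x : 0 <= quad (reduced dv (A i)) x.
    apply: (posdefW _).2; apply: reduced_posdef pN; first exact: diag2_gt0.
      exact: level_bound_gt0.
    exact: level_bound_lt1.
  have MM x : 0 <= quad (D - A i.+1) x by apply: (posdefW (good_chain_pos id)).2.
  split; split=> [|x].
  + by rewrite linearB linearZ /= sM sN.
  + rewrite quadB quadZ subr_ge0 -/(reduced dv (A i)).
    have e1 : 1 + d%:R^-1 <= expR (d%:R^-1 : R) by exact: expR_ge1Dx.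
    apply: (@le_trans _ _ ((1 + d%:R^-1) * quad (D - A i.+1) x)); last first.
      by rewrite ler_wpM2r.
    have i0 : (0 : R) <= d%:R^-1 by rewrite invr_ge0 ltW.
    apply: (@le_trans _ _ ((1 + d%:R^-1) * ((1 - eta) * quad (reduced dv (A i)) x))).
      rewrite mulrA -[leLHS]mul1r ler_wpM2r //.
      have -> : eta = 6^-1 / d%:R by field; rewrite gt_eqF.
      have i1 : (d%:R^-1 : R) <= 1 by rewrite invf_le1 //; lra.
      by nra.
    by apply: ler_wpM2l; [lra | have := h1 x; rewrite quadZ].
  + by rewrite linearB linearZ /= sM sN.
  + rewrite quadB quadZ subr_ge0 -/(reduced dv (A i)).
    apply: le_trans (h2 x); rewrite -[leRHS]mul1r ler_wpM2r //.
- move=> i id; rewrite id; have i0 : (0 : R) <= d%:R^-1 by rewrite invr_ge0 ltW.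
  have Dx x : 0 <= quad D x by apply: (posdefW pD).2.
  have sE c : (c *: D - D)^T = c *: D - D /\ (D - c *: D)^T = D - c *: D.
    by rewrite !linearB !linearZ /= tr_diag_mx.
  split; split=> [|x]; try by case: (sE (expR d%:R^-1)).
  - rewrite quadB quadZ subr_ge0.
    by rewrite -[leLHS]mul1r ler_wpM2r // -[leLHS]expR0 ler_expR.
  - by case: (sE (expR (- d%:R^-1))).
  - rewrite quadB quadZ subr_ge0.
    by rewrite -[leRHS]mul1r ler_wpM2r // -[leRHS]expR0 ler_expR oppr_le0.
- rewrite ltnn; have [sA nA pA [sM _ _] _] := good_chain_level (leqnn d).
  have Dx x : 0 <= quad D x by apply: (posdefW pD).2.
  have e2 : 2 <= expR (1 : R) by have := expR_ge1Dx (1 : R); lra.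
  have sE : (expR 1 *: D - (D - A d))^T = expR 1 *: D - (D - A d) /\
      (D - A d - expR (- 1) *: D)^T = D - A d - expR (- 1) *: D.
    by rewrite !linearB !linearZ /= tr_diag_mx sA.
  case: sE => s1 s2; split; split=> // x; rewrite quadB quadZ subr_ge0.
    by rewrite quadB; have := pA.2 x; have := Dx x; nra.
  have := good_chain_last x; rewrite quadZ; apply: le_trans.
  by rewrite ler_wpM2r // expRN lef_pV2 ?posrE ?expR_gt0.
Qed.

End GoodChain.

(** * Preconditioned Richardson iteration *)

Section Preconditioner.
Variables (R : realType) (n : nat) (M : 'M[R]_n).
Hypothesis M_sddm : sddm M.
Variables (d : nat) (A : nat -> 'M[R]_n).
Hypothesis A_good : good_chain M d A.
Local Notation D := (diag_mx (diag2 M)).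
Local Notation eta := (5 / (30 * d%:R) : R).

(* The approximate inverse of D - A_i that uses the k levels below i. *)
Fixpoint precond (k i : nat) : 'M[R]_n :=
  if k is k'.+1 then
    2^-1 *: (invmx D +
      (1%:M + invmx D *m A i) *m precond k' i.+1 *m (1%:M + A i *m invmx D))
  else invmx D.

Let pD : posdef D.
Proof. by apply: diag_posdef; exact: diag2_gt0. Qed.

Let tr1 i : (i <= d)%N ->
  (1%:M + A i *m invmx D)^T = 1%:M + invmx D *m A i.
Proof.
move=> id; have [sA _ _ _ _] := good_chain_level M_sddm A_good id.
by rewrite linearD /= trmx1 trmx_mul sA trmx_invmx_sym // tr_diag_mx.
Qed.

Lemma precond_posdef k i : (i + k = d)%N -> posdef (precond k i).
Proof.
elim: k i => [|k IH] i ik /=; first exact: posdef_inv.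
apply: posdefZ; first by rewrite invr_gt0 ltr0n.
apply: posdefD; first exact: posdef_inv.
rewrite -tr1; last by rewrite -ik leq_addr.
by apply/possemidef_conj/posdefW/IH; rewrite addSnnS.
Qed.

(** Induction from the last level, where D^-1 <= (D - A_d)^-1 <= 2 D^-1. One level up, N >= D -
    A_{i+1} keeps the factor 2, while (1 - eta) N <= D - A_{i+1} costs a factor 1 - eta, absorbed by
    (1 - eta) (1 - k eta) >= 1 - (k + 1) eta. Congruence and the average with D^-1 preserve both
    bounds. *)
Lemma precond_bounds k i : (i + k = d)%N ->
  lemx ((1 - k%:R * eta) *: precond k i) (invmx (D - A i)) /\
  lemx (invmx (D - A i)) (2 *: precond k i).
Proof.
have [d3 _ _ st] := A_good.
elim: k i => [|k IH] i ik /=.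
  rewrite addn0 in ik; rewrite ik mul0r subr0 scale1r.
  have pM := good_chain_pos M_sddm A_good (leqnn d).
  have [sA nA pA _ _] := good_chain_level M_sddm A_good (leqnn d).
  split.
    by apply: lemx_inv => // x; rewrite quadB gerBl pA.2.
  have h : lemx (invmx (D - A d)) (invmx (2^-1 *: D)).
    apply: lemx_inv => //; last exact: good_chain_last.
    by apply: posdefZ => //; rewrite invr_gt0 ltr0n.
  rewrite invmxZ ?invrK in h => //; apply: posdef_unit.
  by apply: posdefZ => //; rewrite invr_gt0 ltr0n.
have id : (i < d)%N by rewrite -ik -addSnnS leq_addr.
have lA := good_chain_level M_sddm A_good (ltnW id).
have pN := reduced_posdef (diag2_gt0 M_sddm) (level_bound_gt0 _ d i) (level_bound_lt1 _ d i) lA.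
have pM := good_chain_pos M_sddm A_good (ltnW id).
have pM' := good_chain_pos M_sddm A_good id.
have [_ _ h1 h2] := st i id.
have /andP[e0 e1] := eta_small R d3.
have [l1 l2] := IH i.+1 (etrans (addSnnS _ _) ik).
have pP := precond_posdef (etrans (addSnnS i k) ik).
set P := precond k i.+1 in l1 l2 pP *.
have N2 : lemx (invmx (reduced (diag2 M) (A i))) (2 *: P).
  by apply: lemx_trans l2; apply: lemx_inv.
have N1 : lemx ((1 - k.+1%:R * eta) *: P) (invmx (reduced (diag2 M) (A i))).
  have pc : posdef ((1 - eta) *: reduced (diag2 M) (A i)).
    by apply: posdefZ => //; lra.
  have := lemx_inv pc pM' h1; rewrite invmxZ; last exact: posdef_unit.
  move=> h3 x; have := h3 x; have := l1 x; rewrite !quadZ.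
  have P0 := (posdefW pP).2 x; have k0 : (0 : R) <= k%:R by rewrite ler0n.
  rewrite -[k.+1%:R]natr1; move=> h4 h5.
  have h6 : (1 - eta) * quad (invmx (D - A i.+1)) x <=
      quad (invmx (reduced (diag2 M) (A i))) x.
    have c0 : 0 < 1 - eta by lra.
    by rewrite mulrC -ler_pdivlMr // mulrC.
  apply: le_trans h6; apply: le_trans (ler_wpM2l _ h4); last by lra.
  rewrite [leRHS]mulrA ler_wpM2r //.
  have : 0 <= k%:R * eta * eta by rewrite !mulr_ge0 // ltW.
  by move: (k%:R : R) (eta) => a b; lra.
rewrite inverse_reduction ?posdef_unit //; last exact: diag2_gt0.
have cj X x : quad ((1%:M + invmx D *m A i) *m X *m (1%:M + A i *m invmx D)) x =
    quad X ((1%:M + A i *m invmx D) *m x).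
  by rewrite -tr1 ?(ltnW id) // quad_conj.
have D0 x := (posdefW (posdef_inv pD)).2 x.
have ke0 : 0 <= k.+1%:R * eta by rewrite mulr_ge0 ?ler0n // ltW.
split=> x; rewrite !quadZ !quadD !cj.
  rewrite mulrCA ler_wpM2l ?invr_ge0 ?ler0n // mulrDr lerD //.
    by rewrite -[leRHS]mul1r ler_wpM2r //; lra.
  by have := N1 ((1%:M + A i *m invmx D) *m x); rewrite quadZ.
rewrite mulrCA ler_wpM2l ?invr_ge0 ?ler0n // mulrDr lerD //.
  by rewrite -[leLHS]mul1r ler_wpM2r // ler1n.
by have := N2 ((1%:M + A i *m invmx D) *m x); rewrite quadZ.
Qed.

Lemma precond_inverse :
  [/\ posdef (precond d 0), lemx (2^-1 *: precond d 0) (invmx M)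
    & lemx (invmx M) (2 *: precond d 0)].
Proof.
have [d3 A0 _ _] := A_good.
have ME : D - A 0%N = M by rewrite A0 opprB addrC subrK.
have pP := precond_posdef (add0n d).
have [h1 h2] := precond_bounds (add0n d).
rewrite ME in h1 h2; split=> //; apply: lemx_trans h1 => x.
rewrite !quadZ ler_wpM2r ?(posdefW pP).2 //.
have d0 : (d%:R : R) != 0 by rewrite pnatr_eq0; case: d d3.
(* The total loss is 1/6, within the 1/2 that is claimed. *)
have -> : d%:R * eta = 6^-1 by field.
lra.
Qed.

(** Let z = P M y and p = P(M y), the form of P. From P/2 <= M^-1, [psd_sandwich] gives M(z/2) <=
    p/2, so the new square is at most M(y) - p + p/2; the other bound gives M(y) <= 2 p. *)
Lemma richardson_contraction y (P := precond d 0) :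
  quad M (y - 2^-1 *: (P *m (M *m y))) <= 3 / 4 * quad M y.
Proof.
have [pM _ _] := M_sddm; have [pP l1 l2] := precond_inverse.
rewrite -/P in pP l1 l2.
have pQ : posdef (2^-1 *: P) by apply: posdefZ => //; rewrite invr_gt0 ltr0n.
have l1' : lemx (2^-1 *: P) (1 *: invmx M) by rewrite scale1r.
have := psd_sandwich ltr01 (posdefW pQ) (posdef_inv pM) l1' (M *m y).
rewrite invmxK quadZ mul1r.
rewrite -{1}(proj1 pQ) quad_conj -scalemxAl => h.
have l3 : quad M y <= 2 * quad P (M *m y).
  have := l2 (M *m y); rewrite quad_inv // mulKmx ?posdef_unit //.
  by rewrite quadZ.
set z := P *m (M *m y) in h *.
have -> : y - 2^-1 *: z = y + (- 2^-1) *: z by rewrite scaleNr.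
rewrite quad_addv; last by case: pM.
have zz : dot z (M *m y) = quad P (M *m y) by rewrite quadE dotC.
rewrite zz sqrrN; rewrite quad_scale !quadZ in h; lra.
Qed.

Variable b : 'cV[R]_n.

Fixpoint richardson (k : nat) : 'cV[R]_n :=
  if k is k'.+1 then
    let x := richardson k' in x + 2^-1 *: (precond d 0 *m (b - M *m x))
  else 0.

Lemma richardson_error k :
  quad M (invmx M *m b - richardson k) <= (3 / 4) ^+ k * quad M (invmx M *m b).
Proof.
elim: k => [|k IH] /=; first by rewrite subr0 expr0 mul1r.
have pM : posdef M by case: M_sddm.
set x := richardson k in IH *; set xs := invmx M *m b in IH *.
have -> : xs - (x + 2^-1 *: (precond d 0 *m (b - M *m x))) =
    (xs - x) - 2^-1 *: (precond d 0 *m (M *m (xs - x))).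
  have Mxs : M *m xs = b by rewrite mulmxVK_unit ?posdef_unit.
  by rewrite (mulmxBr M) Mxs opprD addrA.
apply: le_trans (richardson_contraction _) _.
by rewrite exprS -[leRHS]mulrA; apply: ler_wpM2l.
Qed.

Lemma richardson_approx k eps : 0 < eps -> (3 / 4) ^+ k <= eps ^+ 2 ->
  approx_solution M b eps (richardson k).
Proof.
move=> e0 h; have pM : posdef M by case: M_sddm.
rewrite /approx_solution /mxnorm -(@ger0_norm _ eps) ?(ltW e0) // -sqrtr_sqr.
rewrite -sqrtrM ?sqr_ge0 // ler_wsqrtr //.
apply: le_trans (richardson_error k) _.
by rewrite ler_wpM2r // (posdefW pM).2.
Qed.

End Preconditioner.

(** * Condition number *)

Section ConditionNumber.
Variables (R : realType) (n : nat) (M : 'M[R]_n).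
Hypothesis n_gt0 : (0 < n)%N.
Hypothesis M_sym : M^T = M.

(** A zero of the form lies in the kernel: Cauchy-Schwarz bounds |X x|^4 by X(X x) X(x) = 0. *)
Lemma psd_null_vector (X : 'M[R]_n) : possemidef X -> ~ posdef X ->
  exists2 x : 'cV[R]_n, x != 0 & X *m x = 0.
Proof.
move=> pX npX.
have [x x0 qx] : exists2 x : 'cV[R]_n, x != 0 & quad X x = 0.
  apply: contrapT => h; apply: npX; split=> [|x x0]; first by case: pX.
  rewrite lt_def pX.2 andbT; apply/eqP => q0; apply: h; by exists x.
exists x => //; apply/eqP; rewrite -dotvv_eq0.
have := psd_CauchySchwarz (X *m x) x pX; rewrite qx mulr0 => h.
by rewrite -sqrf_eq0 eq_le h sqr_ge0.
Qed.

(** In place of compactness of the sphere: the identity is the sum of the e_i e_i^T, so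
    [gram_le_mxtrace] gives 1 <= tr(X^-1) X. Adding 1 to the trace makes the inequality strict. *)
Lemma posdef_gap (X : 'M[R]_n) : posdef X ->
  exists2 a : R, 0 < a & posdef (X - a *: 1%:M).
Proof.
move=> pX; set t := \tr (invmx X).
have gE : gram (fun=> 1) (fun i : 'I_n => delta_mx i 0 : 'cV[R]_n) = 1%:M.
  apply/matrixP => i j; rewrite /gram summxE (bigD1 i) //= big1 ?addr0.
    rewrite scale1r mxE big_ord_recl big_ord0 addr0 !mxE !eqxx mul1r.
    by rewrite andbT eq_sym.
  move=> k ki; rewrite scale1r mxE big_ord_recl big_ord0 addr0 !mxE.
  by rewrite eq_sym (negPf ki) mul0r.
have w0 : forall i : 'I_n, (0 : R) <= 1 by [].
have h := gram_le_mxtrace (fun i : 'I_n => delta_mx i 0 : 'cV[R]_n) w0 pX.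
rewrite gE mul1mx -/t in h.
have t0 : 0 <= t.
  have := mxtrace_gram_ge0 (fun i : 'I_n => delta_mx i 0 : 'cV[R]_n) w0 (posdefW (posdef_inv pX)).
  by rewrite gE mul1mx.
clear w0; exists (t + 1)^-1; first by rewrite invr_gt0; lra.
split=> [|x x0]; first by rewrite linearB linearZ /= trmx1 pX.1.
rewrite quadB quadZ subr_gt0 mulrC ltr_pdivrMr; last by lra.
apply: le_lt_trans (h x) _; rewrite quadZ.
by have := pX.2 x x0; nra.
Qed.

Lemma eigenvalueP_sym (a : R) : eigenvalue M a <->
  exists2 x : 'cV[R]_n, x != 0 & M *m x = a *: x.
Proof.
split=> [/eigenvalueP[v vM v0]|[x x0 Mx]].
  exists v^T; first by rewrite trmx_eq0.
  by rewrite -{1}M_sym -trmx_mul vM linearZ.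
apply/eigenvalueP; exists x^T; last by rewrite trmx_eq0.
by rewrite -{1}M_sym -trmx_mul Mx linearZ.
Qed.

Let v1 : 'cV[R]_n := const_mx 1.
Let v1_gt0 : 0 < dot v1 v1.
Proof.
rewrite lt_def dotvv_ge0 andbT dotvv_eq0; apply/eqP => /matrixP.
by move=> /(_ (Ordinal n_gt0) 0); rewrite !mxE => /eqP; rewrite oner_eq0.
Qed.

(* The least eigenvalue is the largest a such that M - a is positive
   semidefinite: there M - a is singular. *)
Lemma least_eigenvalue : (exists c, possemidef (M - c *: 1%:M)) ->
  exists2 a : R, eigenvalue M a & possemidef (M - a *: 1%:M).
Proof.
move=> [c0 hc0].
pose S : set R := fun c => possemidef (M - c *: 1%:M).
have symS c : (M - c *: 1%:M)^T = M - c *: 1%:M.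
  by rewrite linearB linearZ /= trmx1 M_sym.
have ubS : has_sup S.
  split; first by exists c0.
  exists (quad M v1 / dot v1 v1) => c [_ /(_ v1)].
  by rewrite quadB quadZ quad1 subr_ge0 ler_pdivlMr.
have pS : possemidef (M - sup S *: 1%:M).
  split=> // x; rewrite quadB quadZ quad1 subr_ge0.
  have [->|x0] := eqVneq x 0; first by rewrite quad0 dot0r mulr0.
  have xx : 0 < dot x x by rewrite lt_def dotvv_ge0 dotvv_eq0 x0.
  rewrite -ler_pdivlMr //; apply: ge_sup; first by exists c0.
  move=> c [_ /(_ x)]; rewrite quadB quadZ quad1 subr_ge0.
  by rewrite ler_pdivlMr.
exists (sup S) => //; apply/eigenvalueP_sym.
have [x x0 hx] : exists2 x : 'cV[R]_n, x != 0 & (M - sup S *: 1%:M) *m x = 0.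
  apply: psd_null_vector => // /posdef_gap[a a0].
  rewrite -addrA -opprD -scalerDl => /posdefW h.
  have : sup S + a <= sup S by apply: ub_le_sup => //; case: ubS.
  by rewrite gerDl leNgt a0.
exists x => //; apply/eqP; rewrite -subr_eq0; apply/eqP.
by move: hx; rewrite mulmxBl -scalemxAl mul1mx.
Qed.

End ConditionNumber.

(** Let a and b be the extreme eigenvalues. The diagonal entries of M are at most b, so D <= 2 b <=
    2 kappa a <= 2 kappa M. The largest eigenvalue is found as the least one of -M. *)
Lemma sddm_cond_number (R : realType) n (M : 'M[R]_n) (kappa : R) :
  (0 < n)%N -> sddm M -> cond_number M <= kappa ->
  1 <= kappa /\ lemx ((2 * kappa)^-1 *: diag_mx (diag2 M)) M.
Proof.
move=> n0 M_sddm hk; have [pM _ _] := M_sddm; have sM := pM.1.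
have [a Ea pa] : exists2 a : R, eigenvalue M a & possemidef (M - a *: 1%:M).
  apply: least_eigenvalue => //; exists 0; rewrite scale0r subr0; exact: posdefW.
have EN c : eigenvalue (- M) c -> eigenvalue M (- c).
  move/eigenvalueP => [v vM v0]; apply/eigenvalueP; exists v => //.
  by rewrite scaleNr -vM mulmxN opprK.
have [b0 Eb0 pb0] : exists2 a : R, eigenvalue (- M) a & possemidef (- M - a *: 1%:M).
  apply: least_eigenvalue => //; first by rewrite linearN /= sM.
  (* The absolute sum of the entries bounds the form of M on unit vectors, so -M + t is positive
     semidefinite. *)
  pose t := \sum_i \sum_j `|M i j|.
  exists (- t); split=> [|x]; first by rewrite linearB linearN linearZ /= trmx1 sM.
  rewrite quadB quadN quadZ quad1 mulNr opprK addrC subr_ge0 quad_sum mulr_suml.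
  apply: ler_sum => i _; rewrite mulr_suml; apply: ler_sum => j _.
  apply: le_trans (ler_norm _) _; rewrite normrM ler_wpM2l //.
  have xl k : x k 0 ^+ 2 <= dot x x.
    rewrite /dot mxE (bigD1 k) //= !mxE expr2 lerDl sumr_ge0 // => l _.
    by rewrite mxE -expr2 sqr_ge0.
  have := xl i; have := xl j; rewrite normrM.
  rewrite -[x j 0 ^+ 2]real_normK ?num_real // -[x i 0 ^+ 2]real_normK ?num_real //.
  have := sqr_ge0 (`|x i 0| - `|x j 0|); nra.
set b := - b0; have Eb : eigenvalue M b by exact: EN.
have Mb x : quad M x <= b * dot x x.
  by have := pb0.2 x; rewrite quadB quadN quadZ quad1 /b; lra.
have Ma x : a * dot x x <= quad M x.
  by have := pa.2 x; rewrite quadB quadZ quad1; lra.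
have eg c : eigenvalue M c -> exists2 x : 'cV[R]_n, 0 < dot x x & quad M x = c * dot x x.
  move/(eigenvalueP_sym sM) => [x x0 Mx]; exists x.
    by rewrite lt_def dotvv_ge0 dotvv_eq0 x0.
  by rewrite quadE Mx dotZr.
have lba c : eigenvalue M c -> a <= c.
  by move/eg => [x xx qx]; have := Ma x; rewrite qx ler_pM2r.
have ubb c : eigenvalue M c -> c <= b.
  by move/eg => [x xx qx]; have := Mb x; rewrite qx ler_pM2r.
have a0 : 0 < a.
  have [x xx qx] := eg a Ea; have x0 : x != 0 by rewrite -dotvv_eq0 gt_eqF.
  by have := pM.2 x x0; rewrite qx pmulr_lgt0.
have supE : sup [set a : R | eigenvalue M a]%classic = b.
  apply/eqP; rewrite eq_le; apply/andP; split.
    by apply: ge_sup; [exists b | move=> c /ubb].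
  by apply: ub_le_sup => //; exists b => c /ubb.
have infE : inf [set a : R | eigenvalue M a]%classic = a.
  apply/eqP; rewrite eq_le; apply/andP; split.
    by apply: ge_inf => //; exists a => c /lba.
  by apply: lb_le_inf; [exists a | move=> c /lba].
move: hk; rewrite /cond_number supE infE => hk.
have k1 : 1 <= kappa by apply: le_trans hk; rewrite ler_pdivlMr // mul1r lba.
split=> // x; rewrite quadZ.
have k0 : 0 < kappa by lra.
rewrite mulrC ler_pdivrMr; last by lra.
have Db : quad (diag_mx (diag2 M)) x <= 2 * b * dot x x.
  rewrite quad_diag /dot mxE mulr_sumr; apply: ler_sum => i _; rewrite !mxE -expr2.
  rewrite ler_wpM2r ?sqr_ge0 // ler_pM2l //.
  have := Mb (delta_mx i 0); rewrite quad_sum (bigD1 i) //= (bigD1 i) //= !big1 ?addr0.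
  - rewrite mxE !eqxx !mulr1 /dot mxE (bigD1 i) //= big1 ?addr0.
      by rewrite !mxE !eqxx !mulr1.
    by move=> j ji; rewrite !mxE (negPf ji) mul0r.
  - by move=> j ji; rewrite big1 // => k _; rewrite mxE (negPf ji) mul0r mulr0.
  - by move=> j ji; rewrite !mxE (negPf ji) !mulr0.
apply: le_trans Db _.
have bk : b <= kappa * a by rewrite -ler_pdivrMr.
have := Ma x; have := dotvv_ge0 x; nra.
Qed.

(** * Gauss-Jordan elimination and sparsification *)

Section GaussJordan.
Variables (R : realType) (n : nat) (X : 'M[R]_n).

(** Replacing row i of the identity by row i of X is a rank one change; [gj_pivot] and [gj_step] are
    the denominator and the result of the Sherman-Morrison formula for it. *)
Definition gj_row (i : 'I_n) (W : 'M[R]_n) : 'rV[R]_n :=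
  (row i X - row i 1%:M) *m W.

Definition gj_pivot i W : R := 1 + gj_row i W 0 i.

Definition gj_step i W : 'M[R]_n :=
  W - (gj_pivot i W)^-1 *: (col i W *m gj_row i W).

(* gj k is the inverse of the matrix that consists of the first k rows of X and
   the last n - k rows of the identity. *)
Fixpoint gj (k : nat) : 'M[R]_n :=
  if k is k'.+1 then
    if insub k' is Some i then gj_step i (gj k') else gj k'
  else 1%:M.

Lemma gjS (i : 'I_n) : gj i.+1 = gj_step i (gj i).
Proof. by rewrite /= insubT //= => h; congr (gj_step _ _); apply: val_inj. Qed.

Let head_rows k : 'M[R]_n := \matrix_(i, j) if (i < k)%N then X i j else (i == j)%:R.

Let head_rowsS (k : 'I_n) :
  head_rows k.+1 = head_rows k + delta_mx k 0 *m (row k X - row k 1%:M).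
Proof.
apply/matrixP => i j; rewrite !mxE big_ord_recl big_ord0 addr0 !mxE eqxx andbT ltnS.
have [->|ik] := eqVneq i k; first by rewrite leqnn ltnn mul1r addrC subrK.
by rewrite mul0r addr0 leq_eqVlt (_ : (i == k :> nat) = false) //; apply/eqP=> /val_inj/eqP; exact/negP.
Qed.

Lemma gj_inverse k : (k <= n)%N ->
  (forall j : 'I_n, (j < k)%N -> 0 < gj_pivot j (gj j)) ->
  head_rows k *m gj k = 1%:M.
Proof.
elim: k => [_ _|k IH kn piv].
  by rewrite mulmx1; apply/matrixP => i j; rewrite !mxE.
pose i := Ordinal kn; have -> : k.+1 = i.+1 by [].
have {}IH : head_rows i *m gj i = 1%:M.
  by apply: IH => [|j jk]; [exact: ltnW | apply: piv; exact: ltnW].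
have p0 : gj_pivot i (gj i) != 0 by rewrite gt_eqF // piv.
rewrite gjS head_rowsS /gj_step; set W := gj i in IH p0 *; set r := gj_row i W.
have h1 : (head_rows i + delta_mx i 0 *m (row i X - row i 1%:M)) *m W =
    1%:M + delta_mx i 0 *m r.
  by rewrite mulmxDl IH -mulmxA.
rewrite mulmxBr -scalemxAr mulmxA.
have -> : (head_rows i + delta_mx i 0 *m (row i X - row i 1%:M)) *m col i W =
    gj_pivot i W *: delta_mx i 0.
  rewrite colE mulmxA h1 mulmxDl mul1mx -mulmxA.
  have -> : r *m delta_mx i (0 : 'I_1) = (r 0 i)%:M.
    by rewrite -colE; apply/matrixP => a b; rewrite !ord1 !mxE mulr1n.
  by rewrite mul_mx_scalar -[X in X + _]scale1r -scalerDl.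
by rewrite h1 -scalemxAl scalerA mulVf // scale1r addrK.
Qed.

Hypothesis X_sym : X^T = X.

(** While the earlier pivots are positive, these columns are unit upper triangular and orthogonal
    for X, as in an LDL^T factorisation, and the pivots are the values of the form at them. *)
Let z (i : 'I_n) := gj i *m delta_mx i (0 : 'I_1).

Let zP (i : 'I_n) : head_rows i *m gj i = 1%:M ->
  [/\ z i i 0 = 1, forall j : 'I_n, (i < j)%N -> z i j 0 = 0,
      forall j : 'I_n, (j < i)%N -> (X *m z i) j 0 = 0
    & (X *m z i) i 0 = gj_pivot i (gj i)].
Proof.
move=> hi; have hz : head_rows i *m z i = delta_mx i 0 by rewrite mulmxA hi mul1mx.
have zge (j : 'I_n) : (i <= j)%N -> z i j 0 = (j == i)%:R.
  move=> ij; have := congr1 (fun A : 'cV[R]_n => A j 0) hz.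
  rewrite mxE (bigD1 j) //= big1 ?addr0 => [|a aj].
    by rewrite !mxE ltnNge ij eqxx mul1r eqxx andbT.
  by rewrite mxE ltnNge ij /= eq_sym (negPf aj) mul0r.
split.
- by rewrite zge // eqxx.
- by move=> j ij; rewrite zge ?(ltnW ij) // gt_eqF.
- move=> j ji; have h : (head_rows i *m z i) j 0 = 0.
    by rewrite hz mxE (_ : (j == i) = false) // lt_eqF.
  rewrite -[RHS]h [LHS]mxE [RHS]mxE; apply: eq_bigr => a _.
  by rewrite [head_rows i j a]mxE ji.
- rewrite /gj_pivot /gj_row.
  have -> : ((row i X - row i 1%:M) *m gj i) 0 i = ((row i X - row i 1%:M) *m z i) 0 0.
    by rewrite /z mulmxA -colE [RHS]mxE.
  have -> : ((row i X - row i 1%:M) *m z i) 0 0 = (X *m z i) i 0 - z i i 0.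
    by rewrite mulmxBl -!row_mul mul1mx !mxE.
  by rewrite zge // eqxx addrC subrK.
Qed.

Let pd_head k := forall y : 'cV[R]_n, y != 0 ->
  (forall i : 'I_n, (k <= i)%N -> y i 0 = 0) -> 0 < quad X y.

Let quad_z (i : 'I_n) : head_rows i *m gj i = 1%:M ->
  quad X (z i) = gj_pivot i (gj i).
Proof.
move=> /zP[z1 z0 Xz0 Xz1]; rewrite quadE /dot mxE (bigD1 i) //= big1 ?addr0.
  by rewrite mxE z1 mul1r Xz1.
move=> j ji; rewrite mxE; have [jlt|ilt|] := ltngtP j i.
- by rewrite Xz0 // mulr0.
- by rewrite z0 // mul0r.
- by move/val_inj/eqP; rewrite (negPf ji).
Qed.

(** Clearing coordinate k of y with a multiple of z_k leaves a y' that is orthogonal to z_k for X,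
    so X(y) = X(y') + y_k^2 times the pivot. *)
Lemma gj_pivot_gt0_head k : (k <= n)%N ->
  (forall j : 'I_n, (j < k)%N -> 0 < gj_pivot j (gj j)) -> pd_head k.
Proof.
elim: k => [_ _ y y0 hy|k IH kn piv y y0 hy].
  by case/eqP: y0; apply/matrixP => i j; rewrite ord1 mxE hy.
pose i := Ordinal kn.
have piv' (j : 'I_n) : (j < k)%N -> 0 < gj_pivot j (gj j).
  by move=> jk; apply: piv; exact: ltnW.
have hi : head_rows i *m gj i = 1%:M by apply: gj_inverse => //; exact: ltnW.
have [z1 z0 Xz0 Xz1] := zP hi.
pose y' := y - y i 0 *: z i.
have y'0 (j : 'I_n) : (k <= j)%N -> y' j 0 = 0.
  have -> : y' j 0 = y j 0 - y i 0 * z i j 0 by rewrite /y' !mxE.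
  move=> kj.
  have [ij|ji|/val_inj <-] := ltngtP i j.
  - by rewrite hy // z0 // mulr0 subr0.
  - by move: ji; rewrite ltnNge kj.
  - by rewrite z1 mulr1 subrr.
have yE : y = y' + y i 0 *: z i by rewrite subrK.
have orth : dot (z i) (X *m y') = 0.
  rewrite dot_symmx // /dot mxE big1 // => j _; rewrite mxE.
  have [jk|kj] := ltnP j k; first by rewrite Xz0 // mulr0.
  by rewrite y'0 // mul0r.
rewrite yE quad_addv // orth mulr0 addr0 quad_z //.
have pi0 : 0 < gj_pivot i (gj i) by exact: piv.
have q0 : 0 <= quad X y'.
  have [->|y'n0] := eqVneq y' 0; first by rewrite quad0.
  by rewrite ltW // IH // ltnW.
have [yi0|yi0] := eqVneq (y i 0) 0.
  rewrite yi0 expr0n mul0r addr0 IH //; first exact: ltnW.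
  by apply: contra y0 => /eqP e; rewrite yE e yi0 scale0r addr0.
by rewrite ltr_wpDl // mulr_gt0 // exprn_even_gt0.
Qed.

(** From definiteness to pivots by strong induction: positive earlier pivots make [gj j] a true
    inverse, and then the pivot is the form at the nonzero vector [z j]. *)
Lemma gj_pivotP :
  posdef X <-> forall j : 'I_n, 0 < gj_pivot j (gj j).
Proof.
split=> [pX j|piv]; last first.
  split=> // y y0; apply: (gj_pivot_gt0_head (leqnn n)) => // i.
  by rewrite leqNgt ltn_ord.
have [k] := ubnP (val j); elim: k j => // k IH j jk.
have hj : head_rows j *m gj j = 1%:M.
  apply: gj_inverse => [|i ij]; first exact: ltnW.
  by apply: IH; apply: leq_trans ij _.
rewrite -quad_z //; apply: pX.2; apply/eqP => z0.
by have [+ _ _ _] := zP hj; rewrite z0 mxE => /esym/eqP; rewrite oner_eq0.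
Qed.

Lemma gj_invmx : posdef X -> gj n = invmx X.
Proof.
move=> /gj_pivotP piv; have := gj_inverse (leqnn n) (fun j _ => piv j).
rewrite (_ : head_rows n = X) => [/invmx_eq-> //|].
by apply/matrixP => i j; rewrite mxE ltn_ord.
Qed.

End GaussJordan.

Section Sparsifier.
Variables (R : realType) (n : nat) (N : 'M[R]_n).
Hypothesis n_gt0 : (0 < n)%N.
Hypothesis N_lap : lap N.
Hypothesis N_pd : posdef N.
Variable q : R.
Hypothesis q_gt3 : 3 < q.
Local Notation delta := (q / (q - 3)).

Definition bss_state (k : nat) (A : 'M[R]_n) : Prop :=
  [/\ barrier (edge_weight N) (@edge R n) q (n%:R * q + k%:R * delta)
        (- (n%:R * q) + k%:R) A,
      lap A & (nnz A <= 4 * k)%N].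

Let w0 p : 0 <= edge_weight N p. Proof. exact: edge_weight_ge0. Qed.
Let gE : gram (edge_weight N) (@edge R n) = N.
Proof. by apply: gram_edge; case: N_lap. Qed.
Let gpd : posdef (gram (edge_weight N) (@edge R n)). Proof. by rewrite gE. Qed.

Lemma bss_state0 : bss_state 0 0.
Proof.
split; rewrite ?nnz0 //; last exact: lap0.
rewrite mul0r !addr0; have q0 : 0 < q by move: q_gt3; lra.
exact: (barrier_init n_gt0 gpd q0).
Qed.

Lemma bss_state_step k A : bss_state k A ->
  let WU := invmx ((n%:R * q + k.+1%:R * delta) *: N - A) in
  let WL := invmx (A - (- (n%:R * q) + k.+1%:R) *: N) in
  [/\ posdef ((n%:R * q + k.+1%:R * delta) *: N - A),
      posdef (A - (- (n%:R * q) + k.+1%:R) *: N),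
      exists p, upper_cost (edge_weight N) (@edge R n) delta WU p <
        lower_cost (edge_weight N) (@edge R n) WL p
    & forall p, upper_cost (edge_weight N) (@edge R n) delta WU p <
        lower_cost (edge_weight N) (@edge R n) WL p ->
        bss_state k.+1
          (A + (edge_weight N p / lower_cost (edge_weight N) (@edge R n) WL p)
                 *: (edge R p *m (edge R p)^T))].
Proof.
move=> [bA lA nA] WU WL.
have [] := barrier_step w0 n_gt0 gpd q_gt3 bA.
rewrite gE.
have -> : n%:R * q + k%:R * delta + delta = n%:R * q + k.+1%:R * delta.
  by rewrite -[k.+1%:R]natr1 mulrDl mul1r addrA.
have -> : - (n%:R * q) + k%:R + 1 = - (n%:R * q) + k.+1%:R.
  by rewrite -addrA natr1.
move=> pU pL ex st; split=> // p /st[c0 b]; split=> //.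
  by apply: lapD => //; apply: lapZ => //; exact: lap_edge.
apply: leq_trans (nnzD _ _) _; rewrite mulnS addnC leq_add //.
by apply: leq_trans (nnzZ _ _) _; exact: nnz_edge.
Qed.

End Sparsifier.

Lemma bss_level_step (R : realType) n (d : 'rV[R]_n) (A B : 'M[R]_n) (q : nat)
    (u := n%:R * q%:R + (n * q ^ 2)%:R * (q%:R / (q%:R - 3)) : R) :
  (0 < n)%N -> (3 < q)%N -> (reduced d A)^T = reduced d A -> posdef (reduced d A) ->
  lap (reduced d A) -> bss_state (reduced d A) q%:R (n * q ^ 2) B ->
  level_step d (5 / q%:R) (4 * n * q ^ 2) A (diag_mx d - u^-1 *: B).
Proof.
move=> n0 q3 sN pN lN [[sB pU pL _ _] lB nB].
rewrite gram_edge // in pU pL.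
have q3' : (3 : R) < q%:R by rewrite (ltr_nat _ 3).
have nn : (0 : R) < n%:R by rewrite ltr0n.
have u0 : 0 < u.
  have q0 : (0 : R) < q%:R by lra.
  have nq : (0 < n * q ^ 2)%N by rewrite muln_gt0 n0 expn_gt0 (ltn_trans _ q3).
  apply: addr_gt0; first exact: mulr_gt0.
  by rewrite mulr_gt0 ?ltr0n // divr_gt0 // subr_gt0.
rewrite /level_step opprB addrC subrK.
have NE x : 0 <= quad (reduced d A) x by apply: (posdefW pN).2.
split.
- by apply: lapZ => //; rewrite invr_ge0 ltW.
- by apply: leq_trans (nnzZ _ _) _; rewrite -mulnA.
- move=> x; have := (posdefW pL).2 x; rewrite quadB quadZ subr_ge0 => h.
  rewrite !quadZ [leRHS]mulrC ler_pdivlMr // mulrAC.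
  apply: le_trans h; rewrite ler_wpM2r // /u natrM natrX.
  (* The barriers end at l = n q^2 - n q and u, and l - (1 - 5/q) u equals this fraction, positive
     for q > 3. *)
  rewrite -subr_ge0 (_ : _ - _ = n%:R * (11 * q%:R - 15) / (q%:R - 3)); last first.
    have a1 : q%:R != 0 :> R by rewrite pnatr_eq0; case: (q) q3.
    have a2 : q%:R - 3 != 0 :> R by rewrite gt_eqF // subr_gt0.
    by field; rewrite a1 a2.
  by clear sN sB; rewrite divr_ge0 ?mulr_ge0 //; lra.
- move=> x; have := (posdefW pU).2 x; rewrite quadB quadZ subr_ge0 => h.
  by rewrite quadZ mulrC ler_pdivrMr // mulrC.
Qed.

(** * Program logic *)

Section ProgramLogic.
Variable R : realType.
Implicit Types (s : memory R) (c : cmd) (Q : memory R -> Prop).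

Definition setN s a (f : nat -> nat) : memory R :=
  Defs.Mem (fun a' x => if a' == a then f x else nmem s a' x) (rmem s).
Definition setR s a (f : nat -> R) : memory R :=
  Defs.Mem (nmem s) (fun a' x => if a' == a then f x else rmem s a' x).

Definition vecR L g a e := ParR L g a NProc e.
Definition setn a i e := ParN (NConst 1) BTrue a i e.
Definition setr a i e := ParR (NConst 1) BTrue a i e.

Definition setn_mem s a i v := setN s a (fun x => if x == i then v else nmem s a x).
Definition setr_mem s a i v := setR s a (fun x => if x == i then v else rmem s a x).
Definition vecR_mem s L g a e := setR s a (fun x =>
  if (x < neval s 0 L)%N && beval s x g then reval s x e else rmem s a x).

Lemma writeR_vec s L g a e : writeR s L g a NProc e = vecR_mem s L g a e.
Proof.
rewrite /writeR /vecR_mem /setR; congr Defs.Mem; apply/funext => a'; apply/funext => x.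
case: eqP => // ->; rewrite /writer; case: pickP => [p /andP[gp /eqP /= <-]|h].
  by rewrite ltn_ord gp.
case: ifP => // /andP[xL gx]; have := h (Ordinal xL).
by rewrite /= gx eqxx.
Qed.

Lemma writeN_one s a i e :
  writeN s (NConst 1) BTrue a i e = setn_mem s a (neval s 0 i) (neval s 0 e).
Proof.
rewrite /writeN /setn_mem /setN; congr Defs.Mem; apply/funext => a'; apply/funext => x.
case: eqP => // ->; rewrite /writer; case: pickP => [p /= /eqP <-|h].
  by rewrite (ord1 p) eqxx.
by have := h ord0; rewrite /= eq_sym => ->.
Qed.

Lemma writeR_one s a i e :
  writeR s (NConst 1) BTrue a i e = setr_mem s a (neval s 0 i) (reval s 0 e).
Proof.
rewrite /writeR /setr_mem /setR; congr Defs.Mem; apply/funext => a'; apply/funext => x.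
case: eqP => // ->; rewrite /writer; case: pickP => [p /= /eqP <-|h].
  by rewrite (ord1 p) eqxx.
by have := h ord0; rewrite /= eq_sym => ->.
Qed.

Lemma exclusive_vec s L g : exclusive_write s L g NProc.
Proof. by []. Qed.

Lemma exclusive_one s i : exclusive_write s (NConst 1) BTrue i.
Proof. by case=> [|p] [|q]. Qed.

Fixpoint nmods c : seq nat :=
  match c with
  | ParN _ _ a _ _ => [:: a]
  | Seq c1 c2 | If _ c1 c2 => nmods c1 ++ nmods c2
  | While _ c1 => nmods c1
  | _ => [::]
  end.

Fixpoint rmods c : seq nat :=
  match c with
  | ParR _ _ a _ _ => [:: a]
  | Seq c1 c2 | If _ c1 c2 => rmods c1 ++ rmods c2
  | While _ c1 => rmods c1
  | _ => [::]
  end.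

Definition frame c s s' : Prop :=
  (forall a, a \notin nmods c -> nmem s' a = nmem s a) /\
  (forall a, a \notin rmods c -> rmem s' a = rmem s a).

Lemma exec_frame c s s' w t : exec c s s' w t -> frame c s s'.
Proof.
elim=> {c s s' w t} //=.
- move=> s L g a i e _; split=> b //=; rewrite inE => /negPf ba.
  by apply/funext => x; rewrite ba.
- move=> s L g a i e _; split=> b //=; rewrite inE => /negPf ba.
  by apply/funext => x; rewrite ba.
- move=> c1 c2 s s1 s2 w1 w2 t1 t2 _ [n1 r1] _ [n2 r2].
  by split=> b; rewrite mem_cat negb_or => /andP[h1 h2]; rewrite ?n2 ?r2 ?n1 ?r1.
- move=> b c1 c2 s s' w t _ [h1 h2].
  by split=> a; rewrite mem_cat negb_or => /andP[h3 h4]; [apply: h1|apply: h2];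
    case: ifP.
- move=> b c s s1 s2 w1 w2 t1 t2 _ _ [n1 r1] _ [n2 r2].
  by split=> a h; rewrite ?n2 ?r2 ?n1 ?r1.
Qed.

Lemma frame_refl c s : frame c s s. Proof. by []. Qed.

Lemma frame_trans c s1 s2 s3 : frame c s1 s2 -> frame c s2 s3 -> frame c s1 s3.
Proof. by move=> [n1 r1] [n2 r2]; split=> a h; rewrite ?n2 ?r2 ?n1 ?r1. Qed.

(** Total correctness with upper bounds on work and depth. The postcondition acts as a continuation,
    so a sequence is verified by nesting, and the frame is part of the conclusion. *)
Definition run s c (w t : nat) Q : Prop := exists s' w' t',
  [/\ exec c s s' w' t', (w' <= w)%N, (t' <= t)%N & Q s' /\ frame c s s'].

(** The variant for the construction, where no depth is claimed. *)
Definition runw s c (w : nat) Q : Prop := exists t, run s c w t Q.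

Lemma run_weaken s c w t w' t' Q Q' : run s c w t Q ->
  (w <= w')%N -> (t <= t')%N -> (forall s', Q s' -> frame c s s' -> Q' s') ->
  run s c w' t' Q'.
Proof.
move=> [s' [w1 [t1 [e hw ht [q f]]]]] hw' ht' qq; exists s', w1, t1; split=> //.
- exact: leq_trans hw hw'.
- exact: leq_trans ht ht'.
- by split=> //; exact: qq.
Qed.

Lemma run_seq s c1 c2 w1 w2 t1 t2 Q :
  run s c1 w1 t1 (fun s1 => run s1 c2 w2 t2 Q) ->
  run s (Seq c1 c2) (w1 + w2) (t1 + t2) Q.
Proof.
move=> [s1 [a1 [b1 [e1 h1 h2 [[s2 [a2 [b2 [e2 h3 h4 [q _]]]]] _]]]]].
have e := ExecSeq e1 e2; exists s2, (a1 + a2)%N, (b1 + b2)%N.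
by split; rewrite ?leq_add //; split=> //; exact: exec_frame e.
Qed.

Lemma run_skip s Q : Q s -> run s Skip 100 100 Q.
Proof. by move=> q; exists s, 1%N, 1%N; split=> //; exact: ExecSkip. Qed.

(** A flat charge of 100 for instructions with small expressions turns cost analysis into counting
    instructions. *)
Lemma run_setn s a i e Q : (ncost i + ncost e <= 90)%N ->
  Q (setn_mem s a (neval s 0 i) (neval s 0 e)) -> run s (setn a i e) 100 100 Q.
Proof.
move=> hc q; have e0 := ExecParN a e (@exclusive_one s i).
rewrite writeN_one in e0; do 3!eexists; split; first exact: e0.
- rewrite [neval _ _ _]/= [bcost _]/= [ncost (NConst _)]/= mul1n; lia.
- rewrite [bcost _]/= [ncost (NConst _)]/=; lia.
- by split=> //; exact: exec_frame e0.
Qed.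

Lemma run_setr s a i e Q : (ncost i + rcost e <= 90)%N ->
  Q (setr_mem s a (neval s 0 i) (reval s 0 e)) -> run s (setr a i e) 100 100 Q.
Proof.
move=> hc q; have e0 := ExecParR a e (@exclusive_one s i).
rewrite writeR_one in e0; do 3!eexists; split; first exact: e0.
- rewrite [neval _ _ _]/= [bcost _]/= [ncost (NConst _)]/= mul1n; lia.
- rewrite [bcost _]/= [ncost (NConst _)]/=; lia.
- by split=> //; exact: exec_frame e0.
Qed.

Lemma run_vecR s L g a e Q : (ncost L + bcost g + rcost e <= 90)%N ->
  Q (vecR_mem s L g a e) ->
  run s (vecR L g a e) (100 * (neval s 0 L).+1) 100 Q.
Proof.
move=> hc q; have e0 := ExecParR a e (@exclusive_vec s L g).
rewrite writeR_vec in e0; do 3!eexists; split; first exact: e0.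
- rewrite [ncost NProc]/= [leqRHS]mulnS -addSn; apply: leq_add; first lia.
  by rewrite mulnC; apply: leq_mul => //; lia.
- rewrite [ncost NProc]/=; lia.
- by split=> //; exact: exec_frame e0.
Qed.

Lemma run_if s b c1 c2 w t Q : (bcost b <= 99)%N ->
  run s (if beval s 0 b then c1 else c2) w t Q ->
  run s (If b c1 c2) (100 + w) (100 + t) Q.
Proof.
move=> hb [s' [w' [t' [e hw ht [q f]]]]].
have e0 := ExecIf e; do 3!eexists; split; first exact: e0.
- by lia.
- by lia.
- by split=> //; exact: exec_frame e0.
Qed.

(** [T] is the exact number of iterations. The bounds may vary with the iteration, as the geometric
    work of a sweep through a tree requires. The body may assume the frame since the loop began, so
    invariants mention only what changes. *)
Lemma run_while (I : nat -> memory R -> Prop) (T : nat) (w t : nat -> nat) b c s Q :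
  (bcost b <= 99)%N -> I 0%N s ->
  (forall k s', (k < T)%N -> frame c s s' -> I k s' ->
     beval s' 0 b /\ run s' c (w k) (t k) (I k.+1)) ->
  (forall s', frame c s s' -> I T s' -> beval s' 0 b = false /\ Q s') ->
  run s (While b c) (\sum_(k < T) (w k + 100) + 100) (\sum_(k < T) (t k + 100) + 100) Q.
Proof.
move=> hb I0 IS IT.
suff gen m k s' : (k + m = T)%N -> frame c s s' -> I k s' ->
    run s' (While b c) (\sum_(k <= i < T) (w i + 100) + 100)
      (\sum_(k <= i < T) (t i + 100) + 100) Q.
  by have := gen T 0%N s (add0n T) (frame_refl c s) I0; rewrite !big_mkord.
elim: m k s' => [|m IH] k s' km f Ik.
  rewrite addn0 in km; subst k; have [bF q] := IT _ f Ik.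
  have e0 := ExecWhileFalse c bF; do 3!eexists; split; first exact: e0.
  - by rewrite big_geq //; lia.
  - by rewrite big_geq //; lia.
  - by split=> //; exact: exec_frame e0.
have kT : (k < T)%N by lia.
have [bT [s1 [w1 [t1 [e1 hw1 ht1 [I1 f1]]]]]] := IS k s' kT f Ik.
have [|s2 [w2 [t2 [e2 hw2 ht2 [q f2]]]]] := IH k.+1 s1 _ (frame_trans f f1) I1.
  by lia.
have e0 := ExecWhileTrue bT e1 e2; do 3!eexists; split; first exact: e0.
- by rewrite big_ltn //; lia.
- by rewrite big_ltn //; lia.
- by split=> //; exact: exec_frame e0.
Qed.

Lemma runw_run s c w t Q : run s c w t Q -> runw s c w Q.
Proof. by exists t. Qed.

Lemma runw_weaken s c w w' Q Q' : runw s c w Q -> (w <= w')%N ->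
  (forall s', Q s' -> frame c s s' -> Q' s') -> runw s c w' Q'.
Proof. by move=> [t h] hw qq; exists t; apply: run_weaken h _ _ _. Qed.

Lemma runw_seq s c1 c2 w1 w2 Q :
  runw s c1 w1 (fun s1 => runw s1 c2 w2 Q) -> runw s (Seq c1 c2) (w1 + w2) Q.
Proof.
move=> [t1 [s1 [a1 [b1 [e1 h1 h2 [[t2 [s2 [a2 [b2 [e2 h3 h4 [q _]]]]]] _]]]]]].
have e := ExecSeq e1 e2; exists (t1 + t2)%N, s2, (a1 + a2)%N, (b1 + b2)%N.
by split; rewrite ?leq_add //; split=> //; exact: exec_frame e.
Qed.

Lemma runw_if s b c1 c2 w Q : (bcost b <= 99)%N ->
  runw s (if beval s 0 b then c1 else c2) w Q -> runw s (If b c1 c2) (100 + w) Q.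
Proof. by move=> hb [t h]; exists (100 + t)%N; exact: run_if. Qed.

Lemma runw_while (I : nat -> memory R -> Prop) (T w : nat) b c s Q :
  (bcost b <= 99)%N -> I 0%N s ->
  (forall k s', (k < T)%N -> frame c s s' -> I k s' ->
     beval s' 0 b /\ runw s' c w (I k.+1)) ->
  (forall s', frame c s s' -> I T s' -> beval s' 0 b = false /\ Q s') ->
  runw s (While b c) (T * (w + 100) + 100) Q.
Proof.
move=> hb I0 IS IT.
suff gen m k s' : (k + m = T)%N -> frame c s s' -> I k s' ->
    runw s' (While b c) (m * (w + 100) + 100) Q.
  exact: gen T 0%N s (add0n T) (frame_refl c s) I0.
elim: m k s' => [|m IH] k s' km f Ik.
  rewrite addn0 in km; subst k; have [bF q] := IT _ f Ik.
  have e0 := ExecWhileFalse c bF; do 4!eexists; split; [exact: e0|lia|exact: leqnn|].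
  by split=> //; exact: exec_frame e0.
have kT : (k < T)%N by lia.
have [bT [t1' [s1 [w1 [t1 [e1 hw1 ht1 [I1 f1]]]]]]] := IS k s' kT f Ik.
have [|t2' [s2 [w2 [t2 [e2 hw2 ht2 [q f2]]]]]] := IH k.+1 s1 _ (frame_trans f f1) I1.
  by lia.
have e0 := ExecWhileTrue bT e1 e2; do 4!eexists; split; [exact: e0| |exact: leqnn|].
- by rewrite mulSn; lia.
- by split=> //; exact: exec_frame e0.
Qed.

Definition n0 a := NGet a (NConst 0).
Definition r0 a := RGet a (NConst 0).

Definition For a L c :=
  Seq (setn a (NConst 0) (NConst 0))
      (While (BNLt (n0 a) L) (Seq c (setn a (NConst 0) (NAdd (n0 a) (NConst 1))))).

Lemma runw_for (I : nat -> memory R -> Prop) (T w : nat) a L c s Q :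
  a \notin nmods c -> (ncost L <= 90)%N ->
  I 0%N (setn_mem s a 0 0) ->
  (forall k s', frame (Seq c (setn a (NConst 0) (NConst 0))) s s' -> I k s' ->
     neval s' 0 L = T) ->
  (forall k s', (k < T)%N -> frame (Seq c (setn a (NConst 0) (NConst 0))) s s' ->
     I k s' -> nmem s' a 0 = k ->
     runw s' c w (fun s1 => I k.+1 (setn_mem s1 a 0 k.+1))) ->
  (forall s', frame (Seq c (setn a (NConst 0) (NConst 0))) s s' -> I T s' -> Q s') ->
  runw s (For a L c) (T * (w + 200) + 200) Q.
Proof.
move=> ac hL I0 hT IS IT.
(* Frames depend only on which arrays are written, and the two sequences write the same ones. *)
have fr0 s1 s2 : frame (Seq c (setn a (NConst 0) (NAdd (n0 a) (NConst 1)))) s1 s2 ->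
  frame (Seq c (setn a (NConst 0) (NConst 0))) s1 s2 by [].
have fr1 s' : frame (Seq c (setn a (NConst 0) (NConst 0))) (setn_mem s a 0 0) s' ->
    frame (Seq c (setn a (NConst 0) (NConst 0))) s s'.
  apply: frame_trans; split=> b //=; rewrite mem_cat negb_or inE => /andP[_ /negPf ba].
  by apply/funext => x; rewrite ba.
have -> : (T * (w + 200) + 200 = 100 + (T * ((w + 100) + 100) + 100))%N by lia.
apply: runw_seq; apply/runw_run/run_setn => //=.
apply: (runw_while (I := fun k s' => I k s' /\ nmem s' a 0 = k)).
- by rewrite /=; lia.
- by rewrite /= eqxx.
- move=> k s' kT /fr0/fr1 f [Ik nk]; split; first by rewrite /= nk (hT k).
  apply: runw_seq; apply: (runw_weaken (IS k s' kT f Ik nk)) => // s1 h [f1 _].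
  apply/runw_run/run_setn => //=; rewrite f1 // nk addn1; split=> //.
  by rewrite /= eqxx.
- by move=> s' /fr0/fr1 f [IT' nT]; split; [rewrite /= nT (hT T) // ltnn | exact: IT].
Qed.

End ProgramLogic.

(** * Sparse matrix-vector products and the solver *)

Section Scan.
Variable R : realType.
Implicit Types (s : memory R) (c : cmd) (Q : memory R -> Prop).

Lemma run_le s c w t w' t' Q : run s c w t Q ->
  (w <= w')%N -> (t <= t')%N -> run s c w' t' Q.
Proof. by move=> h hw ht; apply: run_weaken h hw ht _. Qed.

Lemma run_vecR_len l s L g a e Q : (ncost L + bcost g + rcost e <= 90)%N ->
  neval s 0 L = l -> Q (vecR_mem s L g a e) ->
  run s (vecR L g a e) (100 * l.+1) 100 Q.
Proof. by move=> hc <-; exact: run_vecR. Qed.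

Lemma halfD (n : nat) : (n + n)./2 = n.
Proof. by rewrite addnn doubleK. Qed.

Lemma uphalfD (n : nat) : uphalf (n + n) = n.
Proof. by rewrite addnn uphalf_double. Qed.

Definition ge_guard r := BNot (BNLt NProc (n0 r)).

(* Heap layout: node i has the children 2i and 2i+1, and the 2^H leaves are the
   nodes 2^H, 2^H+1, .... *)
Lemma heap_scan (H : nat) (T P : nat -> R) :
  (forall i, (0 < i < 2 ^ H)%N -> T i = T (i + i)%N + T (i + i).+1) ->
  P 1%N = 0 ->
  (forall i, (0 < i < 2 ^ H)%N ->
     P (i + i)%N = P i /\ P (i + i).+1 = P i + T (i + i)%N) ->
  forall p, (p < 2 ^ H)%N -> P (2 ^ H + p)%N = \sum_(i < p) T (2 ^ H + i)%N.
Proof.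
(* Strengthened for induction: on every layer h the values of P are the prefix sums of T along that
   layer. *)
move=> hT P1 hP; suff gen h : (h <= H)%N -> forall p, (p < 2 ^ h)%N ->
    P (2 ^ h + p)%N = \sum_(i < p) T (2 ^ h + i)%N by exact: gen.
elim: h => [_ [|p] //|h IH hH p pl]; first by rewrite big_ord0.
have h2 : (2 ^ h < 2 ^ H)%N by rewrite ltn_exp2l.
have le2 : (2 ^ h.+1 <= 2 ^ H)%N by rewrite leq_exp2l.
have e2 : (2 ^ h.+1 = 2 ^ h + 2 ^ h)%N by rewrite expnS mul2n addnn.
have p0 : (0 < 2 ^ h)%N by rewrite expn_gt0.
have ev r : (r + r <= 2 ^ h.+1)%N ->
    \sum_(i < r + r) T (2 ^ h.+1 + i)%N = \sum_(i < r) T (2 ^ h + i)%N.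
  elim: r => [|r IHr] hr; first by rewrite !big_ord0.
  rewrite addSn addnS !big_ord_recr /= IHr; last by lia.
  rewrite (hT (2 ^ h + r)%N); last by apply/andP; split; lia.
  by rewrite -addrA; congr (_ + (T _ + T _)); lia.
have [q [b pE]] : exists q (b : bool), p = (q + q + b)%N.
  by exists p./2, (odd p); rewrite addnn addnC odd_double_half.
subst p.
have q2 : (q < 2 ^ h)%N by case: b pl => /=; lia.
have q0 : (0 < 2 ^ h + q < 2 ^ H)%N by apply/andP; split; lia.
have [P0 P2] := hP _ q0.
rewrite -(_ : 2 ^ h + q + (2 ^ h + q) + b = 2 ^ h.+1 + (q + q + b))%N; last by lia.
case: b pl => pl /=; last by rewrite !addn0 P0 IH ?ev //; lia.
rewrite !addn1 P2 big_ord_recr /= ev ?IH //; try lia.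
by congr (_ + T _); lia.
Qed.

(** Array 22 holds the tree of sums. The round for the layer of width J starts 2 J processors and
    silences the first J, so the total work is linear in the number of leaves. *)
Definition upsweep :=
  Seq (setn 24 (NConst 0) (NHalf (n0 23)))
      (While (BNLt (NConst 0) (n0 24))
         (Seq (vecR (NAdd (n0 24) (n0 24)) (ge_guard 24) 22
                 (RAdd (RGet 22 (NAdd NProc NProc))
                       (RGet 22 (NAdd (NAdd NProc NProc) (NConst 1)))))
              (setn 24 (NConst 0) (NHalf (n0 24))))).

(** Real array 23 receives at each node the sum of what lies to its left in the same layer. All
    children copy their parent; then the right ones, recognised by p/2 + p/2 < p with rounding down,
    also take in their left sibling. *)
Definition downsweep :=
  Seq (setr 23 (NConst 1) (RConst 0))
 (Seq (setn 24 (NConst 0) (NConst 1))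
      (While (BNLt (n0 24) (n0 23))
         (Seq (setn 24 (NConst 0) (NAdd (n0 24) (n0 24)))
         (Seq (vecR (NAdd (n0 24) (n0 24)) (ge_guard 24) 23
                 (RGet 23 (NHalf NProc)))
              (vecR (NAdd (n0 24) (n0 24))
                 (BAnd (ge_guard 24) (BNLt (NAdd (NHalf NProc) (NHalf NProc)) NProc))
                 23 (RAdd (RGet 23 (NHalf NProc))
                          (RGet 22 (NSub NProc (NConst 1))))))))).

Definition scan := Seq upsweep downsweep.

Lemma sum_pow2 H : (\sum_(k < H) 2 ^ k < 2 ^ H)%N.
Proof.
elim: H => [|H IH]; first by rewrite big_ord0.
by rewrite big_ord_recr /= expnS mul2n -addnn -addSn leq_add2r.
Qed.

Lemma run_upsweep H s Q : nmem s 23 0 = (2 ^ H)%N ->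
  (forall s', frame upsweep s s' ->
    (forall i, (0 < i < 2 ^ H)%N ->
      rmem s' 22 i = rmem s' 22 (i + i)%N + rmem s' 22 (i + i).+1) ->
    (forall i, (2 ^ H <= i)%N -> rmem s' 22 i = rmem s 22 i) -> Q s') ->
  run s upsweep (1000 * 2 ^ H) (300 * H.+1) Q.
Proof.
move=> hK hQ.
have hrun : run s upsweep (100 + (\sum_(k < H) (100 * (2 ^ (H - k)).+1 + 100 + 100) + 100))
    (100 + (\sum_(k < H) (100 + 100 + 100) + 100)) (fun s' =>
    (forall i, (0 < i < 2 ^ H)%N ->
      rmem s' 22 i = rmem s' 22 (i + i)%N + rmem s' 22 (i + i).+1) /\
    (forall i, (2 ^ H <= i)%N -> rmem s' 22 i = rmem s 22 i)).
  apply: run_seq; apply: run_setn => //.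
  (* Cell 24 is the width of the next layer; after the root it is 1./2 = 0, which ends the loop. *)
  apply: (run_while (I := fun k s' => [/\ (k <= H)%N, nmem s' 24 0 = (2 ^ (H - k))./2,
    (forall i, (0 < i)%N -> (2 ^ (H - k) <= i < 2 ^ H)%N ->
      rmem s' 22 i = rmem s' 22 (i + i)%N + rmem s' 22 (i + i).+1) &
    (forall i, (2 ^ H <= i)%N -> rmem s' 22 i = rmem s 22 i)])
    (w := fun k => (100 * (2 ^ (H - k)).+1 + 100)%N) (t := fun=> (100 + 100)%N)) => //.
  - by split=> //= [|i _]; rewrite ?subn0 ?hK //; lia.
  - move=> k s' kH f [_ J h1 h2].
    have e2 : (2 ^ (H - k) = 2 ^ (H - k.+1) + 2 ^ (H - k.+1))%N.
      by rewrite -(_ : (H - k.+1).+1 = H - k)%N ?expnS ?mul2n ?addnn //; lia.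
    rewrite e2 halfD in J; have J0 : (0 < 2 ^ (H - k.+1))%N by rewrite expn_gt0.
    have le2 : (2 ^ (H - k) <= 2 ^ H)%N by rewrite leq_exp2l // leq_subr.
    split; first by rewrite /= J.
    apply: run_seq; apply: run_vecR_len => //; first by rewrite /= J -e2.
    apply: run_setn => //; rewrite /= J -e2; split=> //.
    + move=> i i0 /andP[iJ iH].
      have b1 : (i + i < 2 ^ (H - k))%N = false by lia.
      have b2 : ((i + i).+1 < 2 ^ (H - k))%N = false by lia.
      rewrite b1 b2 /= addn1; have [i2|i2] := ltnP i (2 ^ (H - k)).
        by rewrite -leqNgt iJ.
      by rewrite /= h1 // i2.
    + by move=> i iH; rewrite ltnNge (leq_trans le2 iH) /= h2.
  - move=> s' f [_ J h1 h2]; rewrite /= J subnn; split=> //; split=> // i /andP[i0 iH].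
    by apply: h1 => //; rewrite subnn expn0 i0.
apply: (run_weaken hrun) => [||s' [h1 h2] f]; last exact: hQ.
  rewrite (eq_bigr (fun k : 'I_H => 100 * 2 ^ (H - k) + 300)%N) => [|k _]; last by lia.
  rewrite big_split /= -big_distrr /= sum_nat_const card_ord.
  rewrite (_ : \sum_(i < H) 2 ^ (H - i) = \sum_(k < H) 2 * 2 ^ k)%N; last first.
    rewrite (reindex_inj rev_ord_inj) /=; apply: eq_bigr => k _.
    by rewrite -expnS; congr (_ ^ _)%N; have := ltn_ord k; lia.
  rewrite -big_distrr /=.
  have hx : (H < 2 ^ H)%N by exact: ltn_expl.
  by have := sum_pow2 H; move: (\sum_(k < H) 2 ^ k)%N => S; lia.
by rewrite sum_nat_const card_ord; lia.
Qed.

Lemma run_downsweep H s Q : nmem s 23 0 = (2 ^ H)%N ->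
  (forall s', frame downsweep s s' -> rmem s' 23 1 = 0 ->
    (forall i, (0 < i < 2 ^ H)%N -> rmem s' 23 (i + i)%N = rmem s' 23 i /\
      rmem s' 23 (i + i).+1 = rmem s' 23 i + rmem s 22 (i + i)%N) -> Q s') ->
  run s downsweep (2000 * 2 ^ H) (500 * H.+1) Q.
Proof.
move=> hK hQ.
have hrun : run s downsweep (100 + (100 + (\sum_(k < H)
      (100 + (100 * (2 ^ k.+2).+1 + 100 * (2 ^ k.+2).+1) + 100) + 100)))
    (100 + (100 + (\sum_(k < H) (100 + (100 + 100) + 100) + 100))) (fun s' =>
    rmem s' 23 1 = 0 /\
    (forall i, (0 < i < 2 ^ H)%N -> rmem s' 23 (i + i)%N = rmem s' 23 i /\
      rmem s' 23 (i + i).+1 = rmem s' 23 i + rmem s 22 (i + i)%N)).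
  apply: run_seq; apply: run_setr => //.
  apply: run_seq; apply: run_setn => //.
  apply: (run_while (I := fun k s' => [/\ (k <= H)%N, nmem s' 24 0 = (2 ^ k)%N,
    rmem s' 23 1 = 0 &
    (forall i, (0 < i < 2 ^ k)%N -> rmem s' 23 (i + i)%N = rmem s' 23 i /\
      rmem s' 23 (i + i).+1 = rmem s' 23 i + rmem s 22 (i + i)%N)])
    (w := fun k => (100 + (100 * (2 ^ k.+2).+1 + 100 * (2 ^ k.+2).+1))%N)
    (t := fun=> (100 + (100 + 100))%N)) => //.
  - by split=> //= i; lia.
  - move=> k s' kH [fn fr] [_ J P1 h].
    have K' : nmem s' 23 0 = (2 ^ H)%N by rewrite fn //= hK.
    have T' : rmem s' 22 = rmem s 22 by rewrite fr.
    split; first by rewrite /= J K' ltn_exp2l.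
    have e1 : (2 ^ k.+1 = 2 ^ k + 2 ^ k)%N by rewrite expnS mul2n addnn.
    have e2 : (2 ^ k.+2 = 2 ^ k.+1 + 2 ^ k.+1)%N by rewrite expnS mul2n addnn.
    have k0 : (0 < 2 ^ k)%N by rewrite expn_gt0.
    apply: run_seq; apply: run_setn => //.
    apply: run_seq; apply: run_vecR_len => //; first by rewrite /= J -e1 -e2.
    apply: run_vecR_len => //; first by rewrite /= J -e1 -e2.
    have lt0 : (1 < 2 ^ k.+1)%N by lia.
    split=> //=; rewrite J -e1 -?e2 //; first by rewrite lt0 /= !andbF.
    + move=> i /andP[i0 iJ]; rewrite T'.
      have [ik|ik] := ltnP i (2 ^ k).
        have ik' : (0 < i < 2 ^ k)%N by rewrite i0.
        have [h1 h2] := h i ik'.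
        have lt1 : (i < 2 ^ k.+1)%N by lia.
        have lt2 : (i + i < 2 ^ k.+1)%N by lia.
        have lt3 : ((i + i).+1 < 2 ^ k.+1)%N by lia.
        by rewrite lt1 lt2 lt3 /= !andbF.
      have nle1 : (i < 2 ^ k.+1)%N by [].
      have ge2 : (i + i < 2 ^ k.+1)%N = false by lia.
      have ge3 : ((i + i).+1 < 2 ^ k.+1)%N = false by lia.
      have ge4 : (i + i < 2 ^ k.+2)%N by lia.
      have ge5 : ((i + i).+1 < 2 ^ k.+2)%N by lia.
      rewrite nle1 ge2 ge3 ge4 ge5 /= !halfD uphalfD ltnn ltnSn /= !andbF nle1 /=.
      by rewrite subn1 /= andbF.
  - move=> s' [fn fr] [_ J P1 h]; rewrite /= J fn //= hK ltnn; split=> //.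
apply: (run_weaken hrun) => [||s' [h1 h2] f]; last exact: hQ.
  rewrite (eq_bigr (fun k : 'I_H => 800 * 2 ^ k + 400)%N) => [|k _]; last first.
    by rewrite !expnS; lia.
  rewrite big_split /= -big_distrr /= sum_nat_const card_ord.
  have hx : (H < 2 ^ H)%N by exact: ltn_expl.
  by have := sum_pow2 H; move: (\sum_(k < H) 2 ^ k)%N => S; lia.
by rewrite sum_nat_const card_ord; lia.
Qed.

Lemma run_scan H s Q : nmem s 23 0 = (2 ^ H)%N ->
  (forall s', frame scan s s' ->
    (forall p, (p < 2 ^ H)%N ->
      rmem s' 23 (2 ^ H + p)%N = \sum_(i < p) rmem s 22 (2 ^ H + i)%N) -> Q s') ->
  run s scan (3000 * 2 ^ H) (800 * H.+1) Q.
Proof.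
move=> hK hQ.
have hrun : run s scan (1000 * 2 ^ H + 2000 * 2 ^ H) (300 * H.+1 + 500 * H.+1)
   (fun s' => forall p, (p < 2 ^ H)%N ->
      rmem s' 23 (2 ^ H + p)%N = \sum_(i < p) rmem s 22 (2 ^ H + i)%N).
  apply: run_seq; apply: run_upsweep => // s1 [fn1 fr1] h1 h2.
  apply: run_downsweep => [|s2 [fn2 fr2] P1 h3]; first by rewrite fn1.
  move=> p pH.
  rewrite (heap_scan (T := rmem s1 22) (P := rmem s2 23) h1 P1 h3 pH).
  by apply: eq_bigr => i _; rewrite h2 // leq_addr.
apply: (run_weaken hrun) => [||s' h f]; [lia|lia|exact: hQ].
Qed.

End Scan.

Section SparseRows.
Variables (R : realType) (n : nat).
Implicit Types (r : 'rV[R]_n) (rs : seq 'rV[R]_n) (s : memory R).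

Definition row_entries r : seq (nat * R) :=
  [seq (nat_of_ord j, r 0 j) | j <- enum 'I_n & r 0 j != 0].

Lemma entriesE rs : entries rs = flatten [seq row_entries r | r <- rs].
Proof. by []. Qed.

Lemma entries_cat rs1 rs2 : entries (rs1 ++ rs2) = entries rs1 ++ entries rs2.
Proof. by rewrite !entriesE map_cat flatten_cat. Qed.

Lemma entries_rcons rs r : entries (rcons rs r) = entries rs ++ row_entries r.
Proof. by rewrite -cats1 entries_cat [entries [:: r]]entriesE /= cats0. Qed.

Lemma sum_row_entries r (f : nat -> R) :
  \sum_(e <- row_entries r) e.2 * f e.1 = \sum_j r 0 j * f j.
Proof.
rewrite /row_entries big_map big_filter /= big_enum_cond /=.
rewrite [RHS](bigID (fun j => r 0 j != 0)) /= [X in _ = _ + X]big1 ?addr0 //.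
by move=> j; rewrite negbK => /eqP ->; rewrite mul0r.
Qed.

Lemma size_row_entries r : size (row_entries r) = #|[pred j | r 0 j != 0]|.
Proof.
rewrite size_map size_filter -sum1_count big_enum_cond -sum1_card.
by apply: eq_bigl => j; rewrite inE.
Qed.

Lemma sum_shift (a m : nat) (F : nat -> R) :
  \sum_(a <= k < a + m) F k = \sum_(j < m) F (a + j)%N.
Proof.
rewrite -{1}(add0n a) big_addn addKn big_mkord.
by apply: eq_bigr => j _; rewrite addnC.
Qed.

Lemma size_entries_rows (M : 'M[R]_n) : size (entries (rows M)) = nnz M.
Proof.
rewrite entriesE size_flatten /shape -map_comp sumnE big_map /rows big_map big_enum /=.
under eq_bigr => i _ do rewrite size_row_entries -sum1_card.
rewrite pair_big_dep /= /nnz -sum1_card; apply: eq_bigl => -[i j] /=.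
by rewrite !inE mxE.
Qed.

Lemma size_rows (M : 'M[R]_n) : size (rows M) = n.
Proof. by rewrite size_map size_enum_ord. Qed.

Lemma nth_rows (M : 'M[R]_n) (i : 'I_n) : nth 0 (rows M) i = row i M.
Proof. by rewrite (nth_map i) ?size_enum_ord // nth_ord_enum. Qed.

Lemma stored_row_sum s ptr col val rs i (f : nat -> R) :
  stores_rows s ptr col val rs -> (i < size rs)%N ->
  (nmem s ptr i <= nmem s ptr i.+1)%N /\
  \sum_(nmem s ptr i <= k < nmem s ptr i.+1) rmem s val k * f (nmem s col k) =
  \sum_j (nth 0 rs i) 0 j * f j.
Proof.
move=> [hp he] ir; rewrite !hp //; last exact: ltnW.
rewrite (take_nth 0 ir) entries_rcons size_cat leq_addr; split=> //.
set a := size _; set r := nth _ _ _; rewrite -sum_row_entries.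
rewrite sum_shift (big_nth (0%N, 0)) big_mkord; apply: eq_bigr => k _.
have eE : entries rs = entries (take i rs) ++ row_entries r ++ entries (drop i.+1 rs).
  by rewrite catA -entries_rcons -take_nth // -entries_cat cat_take_drop.
have kl : (a + k < size (entries rs))%N.
  by rewrite eE !size_cat -/a ltn_add2l ltn_addr // ltn_ord.
have := he _ kl; rewrite eE nth_cat -/a ltnNge leq_addr /= addKn nth_cat ltn_ord.
by move=> <-.
Qed.

End SparseRows.

(** * Sparse matrix-vector products *)

Section MatVec.
Variable R : realType.
Implicit Types (s : memory R) (Q : memory R -> Prop).

Definition read_cv n s a : 'cV[R]_n := \col_i rmem s a i.

(* The rows r, ..., r + n - 1 of the stored matrix, with r in array 20, are
   multiplied with array 20; the result is in array 21. *)
Definition gather_size ptr :=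
  Seq (setn 21 (NConst 0) (NGet ptr (n0 20)))
 (Seq (setn 22 (NConst 0) (NSub (NGet ptr (NAdd (n0 20) (n0 0))) (n0 21)))
 (Seq (setn 23 (NConst 0) (NConst 1))
      (While (BNot (BNLt (n0 22) (n0 23)))
         (setn 23 (NConst 0) (NAdd (n0 23) (n0 23)))))).

(** The leaves are cleared first because the tree may have more of them than there are products. *)
Definition gather_products col val :=
  let k := NAdd (n0 21) (NSub NProc (n0 23)) in
  Seq (vecR (NAdd (n0 23) (n0 23)) BTrue 22 (RConst 0))
      (vecR (NAdd (n0 23) (n0 22)) (ge_guard 23) 22
         (RMul (RGet val k) (RGet 20 (NGet col k)))).

(** A row sum is a difference of two prefix sums, so rows of any length take the same constant
    depth. *)
Definition row_sums ptr :=
  let q i := RGet 23 (NAdd (n0 23) (NSub (NGet ptr (NAdd (n0 20) i)) (n0 21))) in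
  vecR (n0 0) BTrue 21 (RSub (q (NAdd NProc (NConst 1))) (q NProc)).

Definition matvec ptr col val :=
  Seq (gather_size ptr) (Seq (gather_products col val) (Seq scan (row_sums ptr))).

Lemma run_gather_size ptr s Q N H : (ptr < 20)%N ->
  (nmem s ptr (nmem s 20 0 + nmem s 0 0) - nmem s ptr (nmem s 20 0))%N = N ->
  H = up_log 2 N.+1 ->
  (forall s', frame (gather_size ptr) s s' ->
     nmem s' 21 0 = nmem s ptr (nmem s 20 0) -> nmem s' 22 0 = N ->
     nmem s' 23 0 = (2 ^ H)%N -> Q s') ->
  run s (gather_size ptr) (400 + H * 200) (400 + H * 200) Q.
Proof.
move=> hp hN hH hQ.
have p20 : (ptr == 21) = false by lia.
have hrun : run s (gather_size ptr)
    (100 + (100 + (100 + (\sum_(k < H) (100 + 100) + 100))))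
    (100 + (100 + (100 + (\sum_(k < H) (100 + 100) + 100)))) (fun s' =>
     [/\ nmem s' 21 0 = nmem s ptr (nmem s 20 0), nmem s' 22 0 = N &
     nmem s' 23 0 = (2 ^ H)%N]).
  apply: run_seq; apply: run_setn => //; apply: run_seq; apply: run_setn => //.
  apply: run_seq; apply: run_setn => //.
  apply: (run_while (I := fun k s' => (k <= H)%N /\ nmem s' 23 0 = (2 ^ k)%N)
    (w := fun=> 100%N) (t := fun=> 100%N)) => //.
  - move=> k s' kH [fn fr] [_ K]; split.
      rewrite /= K fn //= p20 hN -leqNgt leqNgt; apply/negP => h.
      by have := up_log_min (isT : (1 < 2)%N) h; rewrite -hH leqNgt kH.
    apply: run_setn => //=; split=> //.
    by rewrite K expnS mul2n addnn.
  - move=> s' [fn fr] [_ K]; rewrite /= K !fn //= p20 hN; split=> //.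
    by rewrite hH; apply/negbF; exact: up_logP.
apply: (run_weaken hrun) => [||s' [h1 h2 h3] f]; last exact: hQ.
  by rewrite sum_nat_const card_ord; lia.
by rewrite sum_nat_const card_ord; lia.
Qed.

Lemma run_gather_products col val s Q N H : (col < 20)%N -> (val < 20)%N ->
  nmem s 22 0 = N -> nmem s 23 0 = (2 ^ H)%N -> (N < 2 ^ H)%N ->
  (forall s', frame (gather_products col val) s s' ->
     (forall p, (p < 2 ^ H)%N -> rmem s' 22 (2 ^ H + p)%N =
        if (p < N)%N then rmem s val (nmem s 21 0 + p)%N *
          rmem s 20 (nmem s col (nmem s 21 0 + p)) else 0) -> Q s') ->
  run s (gather_products col val) (600 * 2 ^ H) 200 Q.
Proof.
move=> hc hv hN hK NK hQ.
have v22 : (val == 22) = false by lia.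
have hrun : run s (gather_products col val)
    (100 * (2 ^ H + 2 ^ H).+1 + 100 * (2 ^ H + N).+1) (100 + 100) (fun s' =>
   forall p, (p < 2 ^ H)%N -> rmem s' 22 (2 ^ H + p)%N =
        if (p < N)%N then rmem s val (nmem s 21 0 + p)%N *
          rmem s 20 (nmem s col (nmem s 21 0 + p)) else 0).
  apply: run_seq; apply: run_vecR_len => //; first by rewrite /= hK.
  apply: run_vecR_len => //; first by rewrite /= hK hN.
  move=> p pH; rewrite /= hK hN v22 !ltn_add2l -leqNgt leq_addr andbT pH /=.
  by rewrite addKn.
apply: (run_weaken hrun) => [||s' h f]; [lia|lia|exact: hQ].
Qed.

Lemma run_matvec ptr col val n (rs : seq 'rV[R]_n) s Q N H :
  (ptr < 20)%N -> (col < 20)%N -> (val < 20)%N ->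
  stores_rows s ptr col val rs -> nmem s 0 0 = n ->
  (nmem s 20 0 + n <= size rs)%N ->
  (nmem s ptr (nmem s 20 0 + n) - nmem s ptr (nmem s 20 0))%N = N ->
  H = up_log 2 N.+1 ->
  (forall s', frame (matvec ptr col val) s s' ->
     (forall i : 'I_n, rmem s' 21 i =
        (nth 0 rs (nmem s 20 0 + i) *m read_cv n s 20) 0 0) -> Q s') ->
  run s (matvec ptr col val) (4000 * 2 ^ H + 100 * n.+1 + 400)
    (1000 * H + 1600) Q.
Proof.
move=> hp hc hv st hn hr hN hH hQ; set r := nmem s 20 0 in hr hN hQ.
(* The scan is exclusive and the end of the last row reads position N, so N + 1 leaves are needed;
   hence [up_log 2 N.+1]. *)
have NK : (N < 2 ^ H)%N by rewrite hH; exact: up_logP.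
have hrun : run s (matvec ptr col val)
  (400 + H * 200 + (600 * 2 ^ H + (3000 * 2 ^ H + 100 * n.+1)))
  (400 + H * 200 + (200 + (800 * H.+1 + 100)))
  (fun s' => forall i : 'I_n, rmem s' 21 i =
        (nth 0 rs (r + i) *m read_cv n s 20) 0 0).
  apply: run_seq; apply: (run_gather_size (N := N)) => //; first by rewrite hn.
  move=> s1 [fn1 fr1] B1 N1 K1.
  apply: run_seq; apply: (run_gather_products (N := N)) => // s2 [fn2 fr2] h2.
  apply: run_seq; apply: run_scan; first by rewrite fn2.
  move=> s3 [fn3 fr3] h3.
  apply: run_vecR_len => //; first by rewrite /= fn3 // fn2 // fn1.
  have a3 x : (x \in [:: 0; 20; 21; 23])%N -> nmem s3 x = nmem s1 x.
    rewrite !inE => /or4P[] /eqP ->; by rewrite fn3 // fn2.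
  have ptr_notin l : all (leq 20) l -> ptr \notin l.
    by move=> /allP h; apply/negP => /h; rewrite leqNgt hp.
  have p3 : nmem s3 ptr = nmem s ptr.
    by rewrite fn3 ?fn2 ?fn1 //; apply: ptr_notin.
  have c1 : nmem s1 col = nmem s col.
    by rewrite fn1 // !inE; lia.
  have v1 : rmem s1 = rmem s by apply/funext => a; rewrite fr1.
  have N3 : nmem s3 0 0 = n by rewrite a3 // fn1.
  move=> i; rewrite /= N3 ltn_ord /= p3 (a3 20%N) // (a3 21%N) // (a3 23%N) //.
  rewrite K1 B1 (fn1 20%N) // addn1 addnS -/r.
  have rir : (r + i < size rs)%N by apply: leq_trans hr; rewrite ltn_add2l.
  have mono j : (j <= n)%N -> (nmem s ptr r <= nmem s ptr (r + j))%N /\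
      (nmem s ptr (r + j) - nmem s ptr r <= N)%N.
    move=> jn; have mono2 a b : (a <= b)%N -> (b <= size rs)%N ->
        (nmem s ptr a <= nmem s ptr b)%N.
      move=> ab br; case: st => [sp _]; rewrite !sp ?(leq_trans ab) //.
      by rewrite -(subnK ab) addnC takeD entries_cat size_cat leq_addr.
    have l1 : (r + j <= size rs)%N by lia.
    have l2 : (r + j <= r + n)%N by lia.
    by split; [exact: mono2 (leq_addr _ _) l1 | rewrite -hN leq_sub2r // mono2].
  have [m1 m2] := mono i (ltnW (ltn_ord i)).
  have [m3 m4] := mono i.+1 (ltn_ord i); rewrite addnS in m3 m4.
  have [le sm] := stored_row_sum (rmem s 20) st rir.
  rewrite !h3; try by apply: leq_ltn_trans NK.
  pose F k := rmem s val k * rmem s 20 (nmem s col k).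
  have hF m : (m <= N)%N -> \sum_(j < m) rmem s2 22 (2 ^ H + j)%N =
      \sum_(nmem s ptr r <= k < nmem s ptr r + m) F k.
    move=> mN; rewrite sum_shift; apply: eq_bigr => j _.
    have jm := ltn_ord j; rewrite h2; last by lia.
    by rewrite ifT; [rewrite /F B1 v1 c1 | lia].
  rewrite !hF // !subnKC //.
  rewrite (big_cat_nat (n := nmem s ptr (r + i))) //= addrAC subrr add0r.
  by rewrite sm mxE; apply: eq_bigr => j _; rewrite mxE.
apply: (run_weaken hrun) => [||s' h f]; last exact: hQ.
  have hx : (H < 2 ^ H)%N by exact: ltn_expl.
  by lia.
by lia.
Qed.

End MatVec.

(** * The iterative solver *)

Section Solve.
Variable R : realType.
Implicit Types (s : memory R) (Q : memory R -> Prop).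

(* Array 30 holds the right-hand side on the current level, array 31 the
   right-hand sides of all levels, array 32 the result; the natural number
   arrays 30 and 31 hold the level and the position of its first row. *)
Definition apply_precond :=
  Seq (setn 30 (NConst 0) (NConst 0))
 (Seq (setn 31 (NConst 0) (NConst 0))
 (Seq (vecR (n0 0) BTrue 31 (RGet 30 NProc))
 (Seq (While (BNLt (n0 30) (n0 3))
        (Seq (vecR (n0 0) BTrue 20 (RDiv (RGet 30 NProc) (RGet 2 NProc)))
        (Seq (setn 20 (NConst 0) (n0 31))
        (Seq (matvec 4 5 1)
        (Seq (vecR (n0 0) BTrue 30 (RAdd (RGet 30 NProc) (RGet 21 NProc)))
        (Seq (setn 31 (NConst 0) (NAdd (n0 31) (n0 0)))
        (Seq (setn 30 (NConst 0) (NAdd (n0 30) (NConst 1)))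
             (vecR (NAdd (n0 31) (n0 0)) (ge_guard 31) 31
                (RGet 30 (NSub NProc (n0 31)))))))))))
 (Seq (vecR (n0 0) BTrue 32 (RDiv (RGet 30 NProc) (RGet 2 NProc)))
      (While (BNLt (NConst 0) (n0 30))
        (Seq (setn 30 (NConst 0) (NSub (n0 30) (NConst 1)))
        (Seq (setn 31 (NConst 0) (NSub (n0 31) (n0 0)))
        (Seq (vecR (n0 0) BTrue 20 (RGet 32 NProc))
        (Seq (setn 20 (NConst 0) (n0 31))
        (Seq (matvec 4 5 1)
             (vecR (n0 0) BTrue 32
                (RDiv (RAdd (RDiv (RGet 31 (NAdd (n0 31) NProc)) (RGet 2 NProc))
                         (RAdd (RGet 32 NProc) (RDiv (RGet 21 NProc) (RGet 2 NProc))))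
                      (RConst 2))))))))))))).

Definition solve_step :=
  Seq (vecR (n0 0) BTrue 20 (RGet 5 NProc))
 (Seq (setn 20 (NConst 0) (NConst 0))
 (Seq (matvec 1 2 0)
 (Seq (vecR (n0 0) BTrue 30 (RSub (RGet 3 NProc) (RGet 21 NProc)))
 (Seq apply_precond
 (Seq (vecR (n0 0) BTrue 5 (RAdd (RGet 5 NProc) (RDiv (RGet 32 NProc) (RConst 2))))
      (setr 33 (NConst 0) (RDiv (RMul (r0 33) (RConst 4)) (RConst 3)))))))).

Definition solve :=
  Seq (vecR (n0 0) BTrue 5 (RConst 0))
 (Seq (setr 33 (NConst 0) (RMul (r0 4) (r0 4)))
      (While (BRLt (r0 33) (RConst 1)) solve_step)).

(** A bound common to M and all levels, since none has more than n^2 nonzero entries. *)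
Definition matvec_depth (n : nat) := (1000 * up_log 2 (n * n).+1 + 1600)%N.

Lemma up_log_le N : (2 ^ up_log 2 N.+1 <= 2 * N + 1)%N.
Proof.
case: N => [|N]; first by rewrite up_log1.
have := up_log_gtn (isT : (1 < 2)%N) (isT : (1 < N.+2)%N).
case: (up_log 2 N.+2) => [|h] /=; first by [].
by rewrite expnS; lia.
Qed.

Lemma matvec_work_le n N : (4000 * 2 ^ up_log 2 N.+1 + 100 * n.+1 + 400 <=
  2 * 4000 * N + 100 * n + 4500)%N.
Proof. by have := up_log_le N; lia. Qed.

Lemma matvec_depth_le n N : (N <= n * n)%N ->
  (1000 * up_log 2 N.+1 + 1600 <= matvec_depth n)%N.
Proof.
by move=> h; rewrite /matvec_depth leq_add2r leq_mul2l leq_up_log.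
Qed.

Lemma run_matvec_matrix n (M : 'M[R]_n) s Q :
  stores_matrix s M -> nmem s 20 0 = 0%N ->
  (forall s', frame (matvec 1 2 0) s s' ->
     read_cv n s' 21 = M *m read_cv n s 20 -> Q s') ->
  run s (matvec 1 2 0) (2 * 4000 * nnz M + 100 * n + 4500) (matvec_depth n) Q.
Proof.
move=> [hn st] h20 hQ.
apply: run_le (matvec_work_le n _) (matvec_depth_le (nnz_le_sqr M)).
apply: (run_matvec (N := nnz M) _ _ _ st hn) => //.
- by rewrite h20 size_rows.
- case: st => [sp _]; rewrite h20 add0n !sp ?size_rows //.
  by rewrite -[X in take X](size_rows M) take_size take0 size_entries_rows subn0.
- move=> s' f h; apply: hQ => //; apply/matrixP => i j; rewrite ord1 mxE h h20.
  by rewrite add0n nth_rows -row_mul mxE.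
Qed.

Section Chain.
Variables (n d : nat) (D A : nat -> 'M[R]_n).

Lemma chain_rows_split i : (i <= d)%N -> exists L T,
  flatten [seq rows (A i) | i <- iota 0 d.+1] = L ++ rows (A i) ++ T /\
  size L = (i * n)%N.
Proof.
move=> id; exists (flatten [seq rows (A j) | j <- iota 0 i]).
exists (flatten [seq rows (A j) | j <- iota i.+1 (d - i)]); split.
  have -> : d.+1 = (i + (d - i).+1)%N by lia.
  by rewrite iotaD map_cat flatten_cat.
rewrite size_flatten /shape -map_comp sumnE big_map.
under eq_bigr do rewrite /= size_rows.
by rewrite big_const_seq count_predT size_iota iter_addn_0 mulnC.
Qed.

Lemma size_chain_rows :
  size (flatten [seq rows (A i) | i <- iota 0 d.+1]) = (d.+1 * n)%N.
Proof.
rewrite size_flatten /shape -map_comp sumnE big_map.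
under eq_bigr do rewrite /= size_rows.
by rewrite big_const_seq count_predT size_iota iter_addn_0 mulnC.
Qed.

Lemma run_matvec_chain i s Q : (i <= d)%N ->
  nmem s 0 0 = n -> stores_chain s d D A -> nmem s 20 0 = (i * n)%N ->
  (forall s', frame (matvec 4 5 1) s s' ->
     read_cv n s' 21 = A i *m read_cv n s 20 -> Q s') ->
  run s (matvec 4 5 1) (2 * 4000 * nnz (A i) + 100 * n + 4500) (matvec_depth n) Q.
Proof.
move=> id hn [_ st _] h20 hQ.
have [L [T [LT sL]]] := chain_rows_split id.
apply: run_le (matvec_work_le n _) (matvec_depth_le (nnz_le_sqr (A i))).
apply: (run_matvec (N := nnz (A i)) _ _ _ st hn) => //.
- by rewrite h20 size_chain_rows -mulSnr leq_mul2r ltnS id orbT.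
- case: st => [sp _]; rewrite h20 !sp ?size_chain_rows //; last 2 first.
  + by rewrite leq_mul2r (leq_trans id) ?leqnSn ?orbT.
  + by rewrite -mulSnr leq_mul2r ltnS id orbT.
  rewrite LT -sL take_cat ltnNge leq_addr /= addKn take_size_cat ?size_rows //.
  by rewrite take_size_cat // entries_cat size_cat size_entries_rows addKn.
- move=> s' f h; apply: hQ => //; apply/matrixP => a j; rewrite ord1 mxE h h20.
  rewrite LT -sL nth_cat ltnNge leq_addr /= addKn nth_cat size_rows ltn_ord.
  by rewrite nth_rows -row_mul mxE.
Qed.

Lemma stored_diag s : stores_chain s d D A ->
  forall i : 'I_n, rmem s 2 i = D 0%N i i.
Proof.
move=> [_ _ st] i; have -> : rmem s 2 i = nth 0 (flatten
    [seq [seq D i0 j j | j <- enum 'I_n] | i0 <- iota 0 d.+1]) i.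
  apply: st; rewrite /= size_cat size_map size_enum_ord.
  exact: leq_trans (ltn_ord i) (leq_addr _ _).
rewrite /= nth_cat size_map size_enum_ord ltn_ord.
by rewrite (nth_map i) ?size_enum_ord // nth_ord_enum.
Qed.

End Chain.

Section Frames.
Variables (n : nat) (M : 'M[R]_n) (d : nat) (D A : nat -> 'M[R]_n).
Variables (b : 'cV[R]_n) (eps : R).

Definition ready s := [/\ stores_matrix s M, stores_chain s d D A & stores_rhs s b eps].

(** Real array 5 is missing from the protected arrays because it receives the iterates. *)
Lemma ready_frame c s s' :
  all (fun a => a \notin nmods c) (iota 0 6) ->
  all (fun a => a \notin rmods c) (iota 0 5) ->
  frame c s s' -> ready s -> ready s'.
Proof.
move=> /allP an /allP ar [fn fr].
have en a : (a < 6)%N -> nmem s' a = nmem s a.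
  by move=> h; apply/fn/an; rewrite mem_iota.
have er a : (a < 5)%N -> rmem s' a = rmem s a.
  by move=> h; apply/fr/ar; rewrite mem_iota.
rewrite /ready /stores_matrix /stores_chain /stores_rhs /stores_rows /stores_vec.
by rewrite !(en 0%N, en 1%N, en 2%N, en 3%N, en 4%N, en 5%N, er 0%N, er 1%N, er 2%N, er 3%N, er 4%N).
Qed.

End Frames.

Section SolveSpec.
Variables (n : nat) (M : 'M[R]_n).
Hypothesis M_sddm : sddm M.
Variables (d : nat) (A : nat -> 'M[R]_n).
Hypothesis A_good : good_chain M d A.
Local Notation D := (diag_mx (diag2 M)).
Variables (b : 'cV[R]_n) (eps : R).
Local Notation ready := (ready M d (fun=> D) A b eps).

(** The right-hand side that reaches level i: each level applies the factor 1 + A D^-1 from the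
    recursion of [precond]. *)
Fixpoint forward (v : 'cV[R]_n) (i : nat) : 'cV[R]_n :=
  if i is i'.+1 then forward v i' + A i' *m (invmx D *m forward v i') else v.

Lemma ready_n s : ready s -> nmem s 0 0 = n.
Proof. by case=> [[]]. Qed.

Lemma ready_d s : ready s -> nmem s 3 0 = d.
Proof. by case=> _ []. Qed.

Lemma ready_D s (i : 'I_n) : ready s -> rmem s 2 i = diag2 M 0 i.
Proof. by case=> _ /stored_diag -> _; rewrite mxE eqxx mulr1n. Qed.

Lemma ready_M s : ready s -> stores_matrix s M. Proof. by case. Qed.
Lemma ready_chain s : ready s -> stores_chain s d (fun=> D) A. Proof. by case. Qed.

(** The product n d comes from saving the right-hand side of a level: processors are numbered from
    0, so (k + 2) n of them start although only n write. Over the chain this is n d^2, within n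
    log^3 kappa. *)
Definition level_work k := (2 * 4000 * nnz (A k) + 100 * n * (d + 10) + 2 * 3000)%N.
Definition level_depth := (matvec_depth n + 700)%N.

Lemma run_apply_precond s Q : ready s ->
  (forall s', frame apply_precond s s' ->
     read_cv n s' 32 = precond M A d 0 *m read_cv n s 30 -> Q s') ->
  run s apply_precond
    (2 * \sum_(k < d) (level_work k + 100) + 200 * n + 600)
    (2 * (d * (level_depth + 100)) + 600) Q.
Proof.
move=> rs hQ; set v := read_cv n s 30.
have DV (x : 'cV[R]_n) (i : 'I_n) : (invmx D *m x) i 0 = x i 0 / diag2 M 0 i.
  by rewrite mul_invmx_diagl //; exact: diag2_gt0.
have [w1 w1E] : {f | f = level_work} by eexists.
rewrite -w1E.
have hrun : run s apply_precond
  (100 + (100 + (100 * n.+1 + ((\sum_(k < d) (w1 k + 100) + 100) +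
    (100 * n.+1 + (\sum_(k < d) (w1 (d - k.+1)%N + 100) + 100))))))
  (100 + (100 + (100 + ((\sum_(k < d) (level_depth + 100) + 100) +
    (100 + (\sum_(k < d) (level_depth + 100) + 100))))))
  (fun s' => read_cv n s' 32 = precond M A d 0 *m v).
  apply: run_seq; apply: run_setn => //; apply: run_seq; apply: run_setn => //.
  apply: run_seq; apply: run_vecR_len => //; first exact: (ready_n rs).
  apply: run_seq.
  apply: (run_while (I := fun k s' => [/\ (k <= d)%N, nmem s' 30 0 = k,
     nmem s' 31 0 = (k * n)%N, read_cv n s' 30 = forward v k &
     forall j, (j <= k)%N -> forall i : 'I_n, rmem s' 31 (j * n + i)%N = forward v j i 0])
     (w := w1) (t := fun=> level_depth)) => //.
  - split=> // j; rewrite leqn0 => /eqP -> i.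
    by rewrite mul0n add0n /= (ready_n rs) ltn_ord /= /v mxE.
  - move=> k s1 kd f1 [_ h30 h31 hv hs].
    have r1 : ready s1 by apply: ready_frame f1 _.
    split; first by rewrite /= h30 (ready_d r1).
    rewrite w1E; apply: (@run_le _ _ _ (100 * n.+1 + (100 + ((2 * 4000 * nnz (A k) + 100 * n + 4500) +
       (100 * n.+1 + (100 + (100 + 100 * (k.+1 * n + n).+1))))))
       (100 + (100 + (matvec_depth n + (100 + (100 + (100 + 100))))))); last 2 first.
    + rewrite /level_work; have : (k.+1 * n <= d * n)%N by rewrite leq_mul2r kd orbT.
      lia.
    + by rewrite /level_depth; lia.
    apply: run_seq; apply: run_vecR_len => //; first exact: (ready_n r1).
    apply: run_seq; apply: run_setn => //.
    set s2 := setn_mem _ _ _ _.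
    have r2 : ready s2 by [].
    have v2 : read_cv n s2 20 = invmx D *m forward v k.
      apply/matrixP => i j; rewrite ord1 mxE DV /= (ready_n r1) ltn_ord /= (ready_D _ r1) -hv.
      by rewrite [read_cv n s1 30 i 0]mxE.
    apply: run_seq; apply: (run_matvec_chain (ltnW kd) (ready_n r2) (ready_chain r2)).
      by rewrite /= h31.
    move=> s3 f3 h3; have r3 : ready s3 by apply: ready_frame f3 r2.
    have [fn3 fr3] := f3.
    apply: run_seq; apply: run_vecR_len => //; first exact: (ready_n r3).
    apply: run_seq; apply: run_setn => //.
    apply: run_seq; apply: run_setn => //.
    have n31 : nmem s3 31 0 = (k * n)%N by rewrite fn3.
    have n30 : nmem s3 30 0 = k by rewrite fn3.
    have R30 : rmem s3 30 = rmem s1 30 by rewrite fr3.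
    have R31 : rmem s3 31 = rmem s1 31 by rewrite fr3.
    have hv' (i : 'I_n) : rmem s1 30 i + rmem s3 21 i = forward v k.+1 i 0.
      rewrite /= mxE -v2 -h3 -hv; congr (_ + _); by rewrite mxE.
    apply: run_vecR_len => //; first by rewrite /= n31 (ready_n r3) mulSnr.
    split=> //.
    + by rewrite /= n30 addn1.
    + by rewrite /= n31 (ready_n r3) mulSnr.
    + by apply/matrixP => i j; rewrite ord1 mxE /= (ready_n r3) ltn_ord /= R30 hv'.
    + move=> j jk i; rewrite /= n31 (ready_n r3) -mulSnr R30 R31.
      have [jk'|kj] := leqP j k.
        rewrite [X in _ && X](_ : _ = false) ?andbF; last first.
          apply/negbF; apply: leq_trans (_ : (j.+1 * n <= _)%N); last by rewrite leq_mul2r ltnS jk' orbT.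
          by rewrite mulSnr ltn_add2l.
        exact: hs.
      have -> : j = k.+1 by lia.
      rewrite ltn_add2l ltn_ord /= -leqNgt leq_addr addKn ltn_ord /=.
      exact: hv'.
  move=> s1 f1 [_ h30 h31 hv hs].
  have r1 : ready s1 by apply: ready_frame f1 _.
  split; first by rewrite /= h30 (ready_d r1) ltnn.
  apply: run_seq; apply: run_vecR_len => //; first exact: (ready_n r1).
  set s1' := vecR_mem _ _ _ _ _.
  have r1' : ready s1' by [].
  (* After k rounds of the backward pass array 32 holds the approximate solution on level d - k,
     whose right-hand side the forward pass saved in array 31. *)
  apply: (run_while (I := fun k s' => [/\ (k <= d)%N, nmem s' 30 0 = (d - k)%N,
     nmem s' 31 0 = ((d - k) * n)%N &
     read_cv n s' 32 = precond M A k (d - k) *m forward v (d - k)])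
     (w := fun k => w1 (d - k.+1)%N) (t := fun=> level_depth)) => //.
  - rewrite subn0; split=> //; apply/matrixP => i j; rewrite ord1 mxE DV /= (ready_n r1) ltn_ord /=.
    by rewrite (ready_D _ r1) -hv [read_cv n s1 30 i 0]mxE.
  - move=> k s2 kd f2 [_ g30 g31 gz].
    have r2 : ready s2 by apply: ready_frame f2 _.
    set i := (d - k.+1)%N; have iE : (d - k = i.+1)%N by rewrite /i; lia.
    have id : (i < d)%N by rewrite /i; lia.
    rewrite iE in g30 g31 gz; split; first by rewrite /= g30.
    rewrite w1E; apply: (@run_le _ _ _ (100 + (100 + (100 * n.+1 + (100 +
       ((2 * 4000 * nnz (A i) + 100 * n + 4500) + 100 * n.+1)))))
       (100 + (100 + (100 + (100 + (matvec_depth n + 100)))))); last 2 first.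
    + by rewrite /level_work; lia.
    + by rewrite /level_depth; lia.
    apply: run_seq; apply: run_setn => //; apply: run_seq; apply: run_setn => //.
    apply: run_seq; apply: run_vecR_len => //; first exact: (ready_n r2).
    apply: run_seq; apply: run_setn => //.
    set s3 := setn_mem _ _ _ _.
    have r3 : ready s3 by [].
    have m31 : nmem s3 31 0 = (i * n)%N.
      by rewrite /= g31 (ready_n r2) mulSn addKn.
    have v3 : read_cv n s3 20 = precond M A k i.+1 *m forward v i.+1.
      by rewrite -gz; apply/matrixP => a j; rewrite !mxE /= (ready_n r2) ltn_ord.
    apply: run_seq; apply: (run_matvec_chain (ltnW id) (ready_n r3) (ready_chain r3)).
      by rewrite /= g31 (ready_n r2) mulSn addKn.
    move=> s4 f4 h4; have r4 : ready s4 by apply: ready_frame f4 r3.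
    have [fn4 fr4] := f4.
    apply: run_vecR_len => //; first exact: (ready_n r4).
    have n31 : nmem s4 31 0 = (i * n)%N by rewrite fn4.
    have R31 a : rmem s4 31 a = rmem s1 31 a by rewrite fr4 //= f2.2.
    split=> //.
    + by rewrite /= fn4 //= g30 subn1.
    + apply/matrixP => a j; rewrite ord1 mxE /= (ready_n r4) ltn_ord /= n31.
      rewrite R31 hs; last exact: ltnW.
      rewrite (ready_D _ r4) fr4 //=.
      have -> : rmem s2 32 a = (precond M A k i.+1 *m forward v i.+1) a 0.
        by rewrite -gz mxE.
      have -> : rmem s4 21 a = (A i *m (precond M A k i.+1 *m forward v i.+1)) a 0.
        by rewrite -v3 -h4 mxE.
      rewrite -!DV mulrC.
      have fE : forward v i.+1 = (1%:M + A i *m invmx D) *m forward v i.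
        by rewrite /= mulmxDl mul1mx mulmxA.
      rewrite -scalemxAl [(invmx D + _) *m _]mulmxDl -[_ *m (1%:M + A i *m _) *m _]mulmxA -fE.
      rewrite -[_ *m precond _ _ _ _ *m _]mulmxA.
      rewrite [(1%:M + _) *m _]mulmxDl mul1mx -[invmx D *m A i *m _]mulmxA.
      by rewrite [RHS]mxE; congr (_ * _); rewrite [RHS]mxE; congr (_ + _); rewrite [RHS]mxE.
  - move=> s2 f2 [_ g30 g31 gz]; rewrite /= g30 subnn; split=> //.
    by rewrite subnn in gz.
apply: (run_weaken hrun) => [||s' h f]; last exact: hQ.
  have aux S1 S2 : S2 = S1 -> (100 + (100 + (100 * n.+1 + (S1 + 100 +
    (100 * n.+1 + (S2 + 100))))) <= 2 * S1 + 200 * n + 600)%N by move=> ->; lia.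
  apply: aux; rewrite (reindex_inj rev_ord_inj); apply: eq_bigr => k _ /=.
  by congr (w1 _ + _)%N; have := ltn_ord k; lia.
by rewrite sum_nat_const card_ord; lia.
Qed.


Lemma run_solve_step s Q x : ready s -> read_cv n s 5 = x ->
  (forall s', frame solve_step s s' ->
     read_cv n s' 5 = x + 2^-1 *: (precond M A d 0 *m (b - M *m x)) ->
     rmem s' 33 0 = rmem s 33 0 * 4 / 3 -> Q s') ->
  run s solve_step
    (2 * 4000 * nnz M + 2 * \sum_(k < d) (level_work k + 100) + 600 * n + 2 * 3000)
    (matvec_depth n + 2 * (d * (level_depth + 100)) + 1100) Q.
Proof.
move=> rs hx hQ.
have hrun : run s solve_step
  (100 * n.+1 + (100 + ((2 * 4000 * nnz M + 100 * n + 4500) + (100 * n.+1 +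
    ((2 * \sum_(k < d) (level_work k + 100) + 200 * n + 600) + (100 * n.+1 + 100))))))
  (100 + (100 + (matvec_depth n + (100 + ((2 * (d * (level_depth + 100)) + 600) +
     (100 + 100)))))) (fun s' =>
     read_cv n s' 5 = x + 2^-1 *: (precond M A d 0 *m (b - M *m x)) /\
     rmem s' 33 0 = rmem s 33 0 * 4 / 3).
  apply: run_seq; apply: run_vecR_len => //; first exact: (ready_n rs).
  apply: run_seq; apply: run_setn => //.
  set s1 := setn_mem _ _ _ _; have r1 : ready s1 by [].
  have v1 : read_cv n s1 20 = x.
    by rewrite -hx; apply/matrixP => i j; rewrite !mxE /= (ready_n rs) ltn_ord.
  apply: run_seq; apply: (run_matvec_matrix (ready_M r1)) => // s2 f2 h2.
  have r2 : ready s2 by apply: ready_frame f2 r1.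
  apply: run_seq; apply: run_vecR_len => //; first exact: (ready_n r2).
  set s3 := vecR_mem _ _ _ _ _; have r3 : ready s3 by [].
  have v3 : read_cv n s3 30 = b - M *m x.
    rewrite -v1 -h2; apply/matrixP => i j; rewrite ord1 !mxE /= (ready_n r2) ltn_ord /=.
    congr (_ - _); case: r2 => _ _ [hb _]; rewrite hb.
      by rewrite (nth_map i) ?size_enum_ord // nth_ord_enum.
    by rewrite size_map size_enum_ord.
  apply: run_seq; apply: run_apply_precond => // s4 f4; rewrite v3 => h4.
  have r4 : ready s4 by apply: ready_frame f4 r3.
  have [_ fr2] := f2; have [_ fr4] := f4.
  apply: run_seq; apply: run_vecR_len => //; first exact: (ready_n r4).
  apply: run_setr => //; split; last first.
    by rewrite /= fr4 //= fr2.
  rewrite -h4 -hx; apply/matrixP => i j; rewrite ord1 !mxE /= (ready_n r4) ltn_ord /=.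
  by rewrite fr4 //= fr2 // [RHS]addrC mulrC addrC.
apply: (run_weaken hrun) => [||s' [h1 h2] f]; [lia|lia|exact: hQ].
Qed.

(* The loop multiplies eps^2 by 4/3 until it reaches 1; T is the number of
   iterations. *)
Lemma run_solve (T : nat) s : 0 < eps -> ready s ->
  (3 / 4) ^+ T <= eps ^+ 2 ->
  (forall k, (k < T)%N -> eps ^+ 2 < (3 / 4) ^+ k) ->
  run s solve
    (T * (2 * 4000 * nnz M + 2 * \sum_(k < d) (level_work k + 100) + 600 * n + 2 * 3000 + 100)
      + 100 * n + 300)
    (T * (matvec_depth n + 2 * (d * (level_depth + 100)) + 1100 + 100) + 300)
    (fun s' => approx_solution M b eps (read_solution s' n)).
Proof.
move=> e0 rs hT hk.
have [W WE] : {W | W = (2 * 4000 * nnz M + 2 * \sum_(k < d) (level_work k + 100) + 600 * n + 2 * 3000)%N} by eexists.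
have [Dp DE] : {W | W = (matvec_depth n + 2 * (d * (level_depth + 100)) + 1100)%N} by eexists.
rewrite -WE -DE.
have hrun : run s solve (100 * n.+1 + (100 + (\sum_(k < T) (W + 100) + 100)))
   (100 + (100 + (\sum_(k < T) (Dp + 100) + 100)))
   (fun s' => approx_solution M b eps (read_solution s' n)).
  apply: run_seq; apply: run_vecR_len => //; first exact: (ready_n rs).
  apply: run_seq; apply: run_setr => //.
  set s1 := setr_mem _ _ _ _; have r1 : ready s1 by [].
  have q43 k : (3 / 4 : R) ^+ k * (4 / 3) ^+ k = 1.
    by rewrite -exprMn (_ : 3 / 4 * (4 / 3) = 1) ?expr1n //; field.
  have p43 k : 0 < (4 / 3 : R) ^+ k by rewrite exprn_gt0 // divr_gt0.
  apply: (run_while (I := fun k s' => [/\ (k <= T)%N,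
    read_cv n s' 5 = richardson M d A b k & rmem s' 33 0 = eps ^+ 2 * (4 / 3) ^+ k])
    (w := fun=> W) (t := fun=> Dp)) => //.
  - split=> //; first by apply/matrixP => i j; rewrite ord1 !mxE /= (ready_n rs) ltn_ord.
    rewrite /= mulr1 expr2; by case: rs => _ _ [_ ->].
  - move=> k s2 kT f2 [_ hx he]; have r2 : ready s2 by apply: ready_frame f2 r1.
    split.
      rewrite /= he; have := hk k kT.
      by rewrite -(ltr_pM2r (p43 k)) q43.
    rewrite WE DE; apply: run_solve_step => // s3 f3 hx3 he3; split=> //; first by rewrite hx3 hx.
    by rewrite he3 he (exprSr _ k) !mulrA.
  - move=> s2 f2 [_ hx he]; split.
      by rewrite /= he; apply/negbTE; rewrite -leNgt -[leLHS](q43 T) (ler_pM2r (p43 T)).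
    have -> : read_solution s2 n = richardson M d A b T by rewrite -hx.
    exact: (richardson_approx M_sddm A_good).
by apply: run_le hrun _ _; rewrite sum_nat_const card_ord; lia.
Qed.

End SolveSpec.

End Solve.

(** * Dense linear algebra programs *)

Section DenseMatrices.
Variable R : realType.
Implicit Types (s : memory R) (c : cmd) (Q : memory R -> Prop).
Variable n : nat.

Definition read_mx s a : 'M[R]_n := \matrix_(i, j) rmem s a (i * n + j)%N.

Lemma read_mxE s a (i j : 'I_n) : rmem s a (i * n + j)%N = read_mx s a i j.
Proof. by rewrite mxE. Qed.

Lemma read_cvE s a (i : 'I_n) : rmem s a i = read_cv n s a i 0.
Proof. by rewrite mxE. Qed.

(* Natural number array 40 holds n^2, arrays 41 and 42 hold the row and column
   of each position of a dense n x n matrix, array 43 the positions of the row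
   starts; real array 40 holds the identity matrix and array 41 the number n. *)
Definition tables s : Prop :=
  [/\ nmem s 0 0 = n, nmem s 40 0 = (n * n)%N,
      forall i j : 'I_n, nmem s 41 (i * n + j)%N = i /\ nmem s 42 (i * n + j)%N = j,
      forall i, (i < n)%N -> nmem s 43 i = (i * n)%N
    & read_mx s 40 = 1%:M /\ rmem s 41 0 = n%:R].

Definition keeps_tables c :=
  all (fun a => a \notin nmods c) [:: 0; 40; 41; 42; 43]%N &&
  all (fun a => a \notin rmods c) [:: 40; 41]%N.

Lemma tables_frame c s s' : keeps_tables c -> frame c s s' -> tables s -> tables s'.
Proof.
move=> /andP[/allP an /allP ar] [fn fr]; rewrite /tables /read_mx.
have en a : a \in [:: 0; 40; 41; 42; 43]%N -> nmem s' a = nmem s a.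
  by move=> /an /fn.
have er a : a \in [:: 40; 41]%N -> rmem s' a = rmem s a by move=> /ar /fr.
by rewrite !(en 0%N, en 40%N, en 41%N, en 42%N, en 43%N, er 40%N, er 41%N).
Qed.

Lemma read_mx_frame c s s' a : a \notin rmods c -> frame c s s' -> read_mx s' a = read_mx s a.
Proof. by move=> ha [_ fr]; rewrite /read_mx fr. Qed.

Lemma read_cv_frame c s s' a : a \notin rmods c -> frame c s s' -> read_cv n s' a = read_cv n s a.
Proof. by move=> ha [_ fr]; rewrite /read_cv fr. Qed.

Definition matset a e := vecR (n0 40) BTrue a e.
Definition vecset a e := vecR (n0 0) BTrue a e.
Definition rowx := NGet 41 NProc.
Definition colx := NGet 42 NProc.
(** The machine does not multiply natural numbers, so the offset i n is looked up in array 43. *)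
Definition at_ a i j := RGet a (NAdd (NGet 43 i) j).

Definition w_mat := (100 * (n * n).+1)%N.
Definition w_vec := (100 * n.+1)%N.

Lemma index_lt (i j : 'I_n) : (i * n + j < n * n)%N.
Proof.
apply: (@leq_trans (i.+1 * n)); first by rewrite mulSnr ltn_add2l.
by rewrite leq_mul2r ltn_ord orbT.
Qed.

Lemma runw_setn s a i e Q : (ncost i + ncost e <= 90)%N ->
  Q (setn_mem s a (neval s 0 i) (neval s 0 e)) -> runw s (setn a i e) 100 Q.
Proof. by move=> h q; apply: runw_run; exact: run_setn. Qed.

Lemma runw_setr s a i e Q : (ncost i + rcost e <= 90)%N ->
  Q (setr_mem s a (neval s 0 i) (reval s 0 e)) -> runw s (setr a i e) 100 Q.
Proof. by move=> h q; apply: runw_run; exact: run_setr. Qed.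

Lemma runw_frame s c w Q : runw s c w (fun s' => frame c s s' -> Q s') -> runw s c w Q.
Proof. by move=> h; apply: runw_weaken h _ _ => // s' h; exact: h. Qed.

Lemma runw_matset s a e Q : tables s -> (rcost e <= 80)%N ->
  (forall s', frame (matset a e) s s' -> nmem s' = nmem s ->
     read_mx s' a = \matrix_(i, j) reval s (i * n + j) e -> Q s') ->
  runw s (matset a e) w_mat Q.
Proof.
move=> [_ h40 _ _ _] he hQ; apply: runw_frame; apply: runw_run.
apply: run_vecR_len => //; first by rewrite /=; lia.
move=> f; apply: hQ => //; apply/matrixP => i j.
by rewrite !mxE /= eqxx h40 index_lt.
Qed.

Lemma runw_vecset s a e Q : tables s -> (rcost e <= 80)%N ->
  (forall s', frame (vecset a e) s s' -> nmem s' = nmem s ->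
     read_cv n s' a = \col_i reval s i e -> Q s') ->
  runw s (vecset a e) w_vec Q.
Proof.
move=> [h0 _ _ _ _] he hQ; apply: runw_frame; apply: runw_run.
apply: run_vecR_len => //; first by rewrite /=; lia.
move=> f; apply: hQ => //; apply/matrixP => i j.
by rewrite ord1 !mxE /= eqxx h0 ltn_ord.
Qed.

Lemma sum_ltS (F : 'I_n -> R) k (kn : (k < n)%N) :
  \sum_(l : 'I_n | (l < k.+1)%N) F l = \sum_(l : 'I_n | (l < k)%N) F l + F (Ordinal kn).
Proof.
rewrite (bigD1 (Ordinal kn)) //= addrC; congr (_ + _).
apply: eq_bigl => l; rewrite ltnS andbC.
have [->|ne] := eqVneq l (Ordinal kn); first by rewrite ltnn.
by rewrite ltn_neqAle -val_eqE /= in ne *; rewrite ne.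
Qed.

Lemma sum_lt0 (F : 'I_n -> R) : \sum_(l : 'I_n | (l < 0)%N) F l = 0.
Proof. by rewrite big_pred0. Qed.

Lemma sum_ltn (F : 'I_n -> R) : \sum_(l : 'I_n | (l < n)%N) F l = \sum_l F l.
Proof. by apply: eq_bigl => l; rewrite ltn_ord. Qed.

Definition matmul x a b :=
  Seq (matset x (RConst 0))
      (For 44 (n0 0) (matset x (RAdd (RGet x NProc)
         (RMul (at_ a rowx (n0 44)) (at_ b (n0 44) colx))))).

Definition w_matmul := (w_mat + (n * (w_mat + 200) + 200))%N.

Lemma runw_matmul s a b x Q : tables s -> (50 <= x)%N -> a != x -> b != x ->
  (forall s', frame (matmul x a b) s s' ->
     read_mx s' x = read_mx s a *m read_mx s b -> Q s') ->
  runw s (matmul x a b) w_matmul Q.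
Proof.
move=> ts x50 ax bx hQ; apply: runw_frame; apply: runw_seq.
have kt : keeps_tables (matmul x a b) by rewrite /keeps_tables /= !inE; lia.
have kt1 : keeps_tables (matset x (RConst 0)) by rewrite /keeps_tables /= !inE; lia.
apply: runw_matset => // s1 f1 _ h1.
have t1 : tables s1 by apply: tables_frame f1 ts.
have a1 : read_mx s1 a = read_mx s a by apply: read_mx_frame f1; rewrite inE.
have b1 : read_mx s1 b = read_mx s b by apply: read_mx_frame f1; rewrite inE.
apply: (runw_for (I := fun k s' => read_mx s' x =
   \matrix_(i, j) \sum_(l : 'I_n | (l < k)%N) read_mx s a i l * read_mx s b l j)) => //.
- have -> : read_mx (setn_mem s1 44 0 0) x = read_mx s1 x by [].
  by rewrite h1; apply/matrixP => i j; rewrite !mxE sum_lt0.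
- move=> k s2 f2 _; rewrite /=.
  have [//] : tables s2; apply: tables_frame f2 t1.
  by rewrite /keeps_tables /= !inE; lia.
- move=> k s2 kn f2 h2 hk.
  have t2 : tables s2.
    by apply: tables_frame f2 t1; rewrite /keeps_tables /= !inE; lia.
  have a2 : read_mx s2 a = read_mx s a by rewrite -a1; apply: read_mx_frame f2; rewrite inE.
  have b2 : read_mx s2 b = read_mx s b by rewrite -b1; apply: read_mx_frame f2; rewrite inE.
  have [_ _ hrc h43 _] := t2.
  apply: runw_matset => // s3 f3 _ h3.
  rewrite [read_mx _ x](_ : _ = read_mx s3 x) // h3; apply/matrixP => i j.
  have [hr hc] := hrc i j.
  rewrite [LHS]mxE [RHS]mxE (sum_ltS _ kn) /= hr hc hk !h43 // read_mxE h2 [X in X + _]mxE.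
  by rewrite -a2 -b2 [read_mx s2 a i (Ordinal kn)]mxE [read_mx s2 b (Ordinal kn) j]mxE.
- move=> s2 f2 h2 f; apply: hQ => //; rewrite h2; apply/matrixP => i j.
  by rewrite !mxE sum_ltn.
Qed.

Definition trprod x a b :=
  Seq (vecset 45 (RConst 0))
 (Seq (For 44 (n0 0) (vecset 45 (RAdd (RGet 45 NProc)
         (RMul (at_ a NProc (n0 44)) (at_ b (n0 44) NProc)))))
 (Seq (setr x (NConst 0) (RConst 0))
      (For 44 (n0 0) (setr x (NConst 0) (RAdd (r0 x) (RGet 45 (n0 44))))))).

Definition w_trprod :=
  (w_vec + ((n * (w_vec + 200) + 200) + (100 + (n * (100 + 200) + 200))))%N.

Lemma runw_trprod s a b x Q : tables s -> (50 <= x)%N ->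
  a != 45%N -> b != 45%N ->
  (forall s', frame (trprod x a b) s s' ->
     rmem s' x 0 = \tr (read_mx s a *m read_mx s b) -> Q s') ->
  runw s (trprod x a b) w_trprod Q.
Proof.
move=> ts x50 a45 b45 hQ; apply: runw_frame; apply: runw_seq.
apply: runw_vecset => // s1 f1 _ h1.
have t1 : tables s1 by apply: tables_frame f1 ts.
have a1 : read_mx s1 a = read_mx s a by apply: read_mx_frame f1; rewrite inE.
have b1 : read_mx s1 b = read_mx s b by apply: read_mx_frame f1; rewrite inE.
apply: runw_seq; apply: (runw_for (I := fun k s' => read_cv n s' 45 =
   \col_i \sum_(l : 'I_n | (l < k)%N) read_mx s a i l * read_mx s b l i)) => //.
- have -> : read_cv n (setn_mem s1 44 0 0) 45 = read_cv n s1 45 by [].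
  by rewrite h1; apply/matrixP => i j; rewrite !mxE sum_lt0.
- by move=> k s2 f2 _; have [//] : tables s2; apply: tables_frame f2 t1.
- move=> k s2 kn f2 h2 hk.
  have t2 : tables s2 by apply: tables_frame f2 t1.
  have a2 : read_mx s2 a = read_mx s a by rewrite -a1; apply: read_mx_frame f2; rewrite inE.
  have b2 : read_mx s2 b = read_mx s b by rewrite -b1; apply: read_mx_frame f2; rewrite inE.
  have [_ _ _ h43 _] := t2.
  apply: runw_vecset => // s3 f3 _ h3.
  rewrite [read_cv n _ 45](_ : _ = read_cv n s3 45) // h3; apply/matrixP => i j.
  rewrite [LHS]mxE [RHS]mxE (sum_ltS _ kn) /= hk !h43 // read_cvE h2 [X in X + _]mxE.
  by rewrite -a2 -b2 [read_mx s2 a i (Ordinal kn)]mxE [read_mx s2 b (Ordinal kn) i]mxE.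
move=> s2 f2 h2; have t2 : tables s2 by apply: tables_frame f2 t1.
apply: runw_seq; apply: runw_setr => //.
set s3 := setr_mem _ _ _ _.
have t3 : tables s3.
  have f3 : frame (setr x (NConst 0) (RConst 0)) s2 s3.
    split=> // y; rewrite inE => /negPf yx; apply/funext => z.
    by rewrite /s3 /setr_mem /= yx.
  by apply: tables_frame f3 t2; rewrite /keeps_tables /= !inE; lia.
have x45 : (45 == x)%N = false by lia.
apply: (runw_for (I := fun k s' => rmem s' x 0 =
   \sum_(i : 'I_n | (i < k)%N) read_cv n s2 45 i 0)) => //.
- by rewrite sum_lt0 /= !eqxx.
- move=> k s4 f4 _; have [//] : tables s4; apply: tables_frame f4 t3.
  by rewrite /keeps_tables /= !inE; lia.
- move=> k s4 kn f4 h4 hk.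
  have e45 : rmem s4 45 = rmem s2 45.
    have [_ ->] := f4; last by rewrite /= inE x45.
    by apply/funext => z; rewrite /s3 /setr_mem /= x45.
  apply: runw_setr => //; rewrite /= !eqxx /= hk h4 e45 (sum_ltS _ kn).
  by congr (_ + _); rewrite mxE.
- move=> s4 f4 h4 f; apply: hQ => //; rewrite h4 h2 sum_ltn /mxtrace.
  by apply: eq_bigr => i _; rewrite !mxE sum_ltn.
Qed.

Definition rowsums x a :=
  Seq (vecset x (RConst 0))
      (For 44 (n0 0) (vecset x (RAdd (RGet x NProc) (at_ a NProc (n0 44))))).

Definition w_rowsums := (w_vec + (n * (w_vec + 200) + 200))%N.

Lemma runw_rowsums s a x Q : tables s -> (50 <= x)%N -> a != x ->
  (forall s', frame (rowsums x a) s s' ->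
     read_cv n s' x = \col_i \sum_j read_mx s a i j -> Q s') ->
  runw s (rowsums x a) w_rowsums Q.
Proof.
move=> ts x50 ax hQ; apply: runw_frame; apply: runw_seq.
apply: runw_vecset => // s1 f1 _ h1.
have t1 : tables s1.
  by apply: tables_frame f1 ts; rewrite /keeps_tables /= !inE; lia.
have a1 : read_mx s1 a = read_mx s a by apply: read_mx_frame f1; rewrite inE.
apply: (runw_for (I := fun k s' => read_cv n s' x =
   \col_i \sum_(l : 'I_n | (l < k)%N) read_mx s a i l)) => //.
- have -> : read_cv n (setn_mem s1 44 0 0) x = read_cv n s1 x by [].
  by rewrite h1; apply/matrixP => i j; rewrite !mxE sum_lt0.
- move=> k s2 f2 _; have [//] : tables s2; apply: tables_frame f2 t1.
  by rewrite /keeps_tables /= !inE; lia.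
- move=> k s2 kn f2 h2 hk.
  have t2 : tables s2.
    by apply: tables_frame f2 t1; rewrite /keeps_tables /= !inE; lia.
  have a2 : read_mx s2 a = read_mx s a by rewrite -a1; apply: read_mx_frame f2; rewrite inE.
  have [_ _ _ h43 _] := t2.
  apply: runw_vecset => // s3 f3 _ h3.
  rewrite [read_cv n _ x](_ : _ = read_cv n s3 x) // h3; apply/matrixP => i j.
  rewrite [LHS]mxE [RHS]mxE (sum_ltS _ kn) /= hk !h43 // read_cvE h2 [X in X + _]mxE.
  by rewrite -a2 [read_mx s2 a i (Ordinal kn)]mxE.
- move=> s2 f2 h2 f; apply: hQ => //; rewrite h2; apply/matrixP => i j.
  by rewrite !mxE sum_ltn.
Qed.

(* Gauss-Jordan inversion of the matrix in array a; natural number array 45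
   tells whether all pivots were positive. *)
Definition invert_step w a :=
  Seq (vecset 42 (at_ w NProc (n0 46)))
 (Seq (vecset 43 (RConst 0))
 (Seq (For 44 (n0 0) (vecset 43 (RAdd (RGet 43 NProc)
         (RMul (RSub (at_ a (n0 46) (n0 44)) (at_ 40 (n0 46) (n0 44)))
               (at_ w (n0 44) NProc)))))
 (Seq (setr 44 (NConst 0) (RAdd (RConst 1) (RGet 43 (n0 46))))
 (Seq (If (BRLt (RConst 0) (r0 44)) Skip (setn 45 (NConst 0) (NConst 0)))
      (matset w (RSub (RGet w NProc)
         (RDiv (RMul (RGet 42 rowx) (RGet 43 colx)) (r0 44)))))))).

Definition invert w a :=
  Seq (matset w (RGet 40 NProc))
 (Seq (setn 45 (NConst 0) (NConst 1))
      (For 46 (n0 0) (invert_step w a))).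

Definition w_invert_step :=
  (w_vec + (w_vec + ((n * (w_vec + 200) + 200) + (100 + (200 + w_mat)))))%N.
Definition w_invert := (w_mat + (100 + (n * (w_invert_step + 200) + 200)))%N.

Definition pivots_pos (X : 'M[R]_n) k :=
  [forall j : 'I_n, (j < k)%N ==> (0 < gj_pivot X j (gj X j))].

(** The array follows [gj] whatever the signs of the pivots, since the machine and [gj_step] share
    the convention 1 / 0 = 0. A bad pivot needs no early exit; it only clears the flag in cell
    45. *)
Lemma runw_invert_step s a w k (kn : (k < n)%N) Q : tables s -> (50 <= w)%N ->
  (50 <= a)%N -> a != w -> nmem s 46 0 = k -> read_mx s w = gj (read_mx s a) k ->
  nmem s 45 0 = pivots_pos (read_mx s a) k ->
  (forall s', frame (invert_step w a) s s' ->
     read_mx s' w = gj (read_mx s a) k.+1 ->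
     nmem s' 45 0 = pivots_pos (read_mx s a) k.+1 -> Q s') ->
  runw s (invert_step w a) w_invert_step Q.
Proof.
move=> ts w50 a50 aw hk hw ho hQ; apply: runw_frame; apply: runw_seq.
set X := read_mx s a in hw ho hQ; set i0 := Ordinal kn; set W := gj X i0.
have hw' : read_mx s w = W by [].
apply: runw_vecset => // s1 f1 n1 h1.
have t1 : tables s1 by apply: tables_frame f1 ts.
have [_ _ _ g43 _] := ts.
have v1 : read_cv n s1 42 = col i0 W.
  rewrite h1; apply/matrixP => i j; rewrite !mxE /= hk g43 //.
  by rewrite -hw' mxE.
apply: runw_seq; apply: runw_vecset => // s2 f2 n2 h2.
have t2 : tables s2 by apply: tables_frame f2 t1.
have X2 : read_mx s2 a = X.
  by rewrite (read_mx_frame _ f2) ?(read_mx_frame _ f1) // inE; lia.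
have W2 : read_mx s2 w = W.
  by rewrite (read_mx_frame _ f2) ?(read_mx_frame _ f1) // inE; lia.
apply: runw_seq; apply: (runw_for (I := fun m s' => read_cv n s' 43 =
   \col_j \sum_(l : 'I_n | (l < m)%N) (X i0 l - 1%:M i0 l) * W l j)) => //.
- have -> : read_cv n (setn_mem s2 44 0 0) 43 = read_cv n s2 43 by [].
  by rewrite h2; apply/matrixP => i j; rewrite !mxE sum_lt0.
- by move=> m s3 f3 _; have [//] : tables s3; apply: tables_frame f3 t2.
- move=> m s3 mn f3 h3 hm.
  have t3 : tables s3 by apply: tables_frame f3 t2.
  have X3 : read_mx s3 a = X by rewrite -X2; apply: read_mx_frame f3; rewrite inE; lia.
  have W3 : read_mx s3 w = W by rewrite -W2; apply: read_mx_frame f3; rewrite inE; lia.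
  have [_ _ _ h43 [hI _]] := t3.
  have k3 : nmem s3 46 0 = k by rewrite f3.1 // n2 n1.
  apply: runw_vecset => // s4 f4 _ h4.
  rewrite [read_cv n _ 43](_ : _ = read_cv n s4 43) // h4; apply/matrixP => i j.
  rewrite [LHS]mxE [RHS]mxE (sum_ltS _ mn) /= hm k3 !h43 // read_cvE h3 [X in X + _]mxE.
  rewrite -X3 -W3 -hI [read_mx s3 a i0 _]mxE [read_mx s3 w _ _]mxE.
  by rewrite [read_mx s3 40 i0 _]mxE.
move=> s3 f3 h3; have t3 : tables s3 by apply: tables_frame f3 t2.
have r3 : read_cv n s3 43 = (gj_row X i0 W)^T.
  rewrite h3; apply/matrixP => j l; rewrite ord1 !mxE sum_ltn.
  by apply: eq_bigr => m _; rewrite !mxE.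
apply: runw_seq; apply: runw_setr => //.
set s4 := setr_mem _ _ _ _.
have t4 : tables s4 by [].
have k3 : nmem s3 46 0 = k by rewrite f3.1 // n2 n1.
have p4 : rmem s4 44 0 = gj_pivot X i0 W.
  by rewrite /= k3 (read_cvE _ _ i0) r3 mxE.
have o3 : nmem s3 45 0 = pivots_pos X k by rewrite f3.1 // n2 n1.
have pS : pivots_pos X k.+1 = pivots_pos X k && (0 < gj_pivot X i0 W).
  apply/idP/andP => [/forallP h|[/forallP h hp]].
    split; last by have := h i0; rewrite /= ltnSn.
    by apply/forallP => j; apply/implyP => jk; have := h j; rewrite ltnW.
  apply/forallP => j; apply/implyP; rewrite ltnS leq_eqVlt => /orP[/eqP jk|jk].
    by rewrite (_ : j = i0) //; apply: val_inj.
  by have := h j; rewrite jk.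
apply: runw_seq; apply: runw_frame.
apply: (runw_if (w := 100)) => //.
rewrite [beval _ _ _]/=.
have -> : (0%:R < rmem s4 44 0) = (0 < gj_pivot X i0 W) by rewrite p4.
have fin s5 : tables s5 -> rmem s5 = rmem s4 -> nmem s5 45 0 = pivots_pos X k.+1 ->
  runw s5 (matset w (RSub (RGet w NProc) (RDiv (RMul (RGet 42 rowx) (RGet 43 colx)) (r0 44))))
    w_mat (fun s' => frame (invert_step w a) s s' -> Q s').
  move=> t5 e5 o5; apply: runw_matset => // s6 f6 n6 h6 f; apply: hQ => //; last by rewrite n6.
  rewrite h6 [RHS](gjS X i0) -/W /gj_step; apply/matrixP => i j.
  have [_ _ hrc _ _] := t5; have [hr hc] := hrc i j.
  have w43 : (w == 44)%N = false by lia.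
  have W4 : read_mx s4 w = W.
    rewrite /s4 /read_mx /setr_mem /= w43 -/(read_mx s3 w) -W2; apply: read_mx_frame f3.
    by rewrite inE; lia.
  have v42 : read_cv n s4 42 = col i0 W.
    rewrite -v1 [LHS](_ : _ = read_cv n s3 42) // (read_cv_frame _ f3) //.
    exact: (read_cv_frame _ f2).
  rewrite mxE /= hr hc e5 p4 (read_cvE s4 42) (read_cvE s4 43) read_mxE W4 v42.
  rewrite [read_cv n s4 43](_ : _ = read_cv n s3 43) // r3 [RHS]mxE [X in _ = _ + X]mxE.
  rewrite [X in _ = _ - X]mxE mulrC; congr (_ - _ * _).
  by rewrite [RHS]mxE big_ord_recl big_ord0 addr0 [(gj_row X i0 W)^T _ _]mxE.
case: ifP => hp.
  apply: runw_run; apply: run_weaken (run_skip _) _ _ _; [|exact: leqnn|exact: leqnn|by move=> s' h _; exact: h].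
  by move=> _; apply: fin => //; rewrite pS hp andbT.
apply: runw_setn => // _; apply: fin => //.
by rewrite pS hp andbF.
Qed.

Lemma runw_invert s a w Q : tables s -> (50 <= w)%N -> (50 <= a)%N -> a != w ->
  (read_mx s a)^T = read_mx s a ->
  (forall s', frame (invert w a) s s' ->
     (posdef (read_mx s a) -> read_mx s' w = invmx (read_mx s a) /\ nmem s' 45 0 = 1%N) ->
     (~ posdef (read_mx s a) -> nmem s' 45 0 = 0%N) -> Q s') ->
  runw s (invert w a) w_invert Q.
Proof.
move=> ts w50 a50 aw sX hQ; apply: runw_frame; apply: runw_seq.
set X := read_mx s a in sX hQ.
apply: runw_matset => // s1 f1 n1 h1.
have t1 : tables s1.
  by apply: tables_frame f1 ts; rewrite /keeps_tables /= !inE; lia.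
have X1 : read_mx s1 a = X by apply: read_mx_frame f1; rewrite inE.
have W1 : read_mx s1 w = 1%:M.
  have [_ _ _ _ [<- _]] := ts; rewrite h1; apply/matrixP => i j.
  by rewrite !mxE.
apply: runw_seq; apply: runw_setn => //.
set s2 := setn_mem _ _ _ _; have t2 : tables s2 by [].
have tf s3 : frame (Seq (invert_step w a) (setn 46 (NConst 0) (NConst 0))) s2 s3 -> tables s3.
  by move=> f; apply: tables_frame f t2; rewrite /keeps_tables /= !inE; lia.
apply: (runw_for (I := fun k s' => read_mx s' w = gj X k /\
   nmem s' 45 0 = pivots_pos X k)) => //.
- split; first exact: W1.
  rewrite /=; have -> // : pivots_pos X 0 by apply/forallP.
- by move=> k s3 /tf [].
- move=> k s3 kn f3 [hw ho] hk; have t3 := tf _ f3.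
  have X3 : read_mx s3 a = X.
    by rewrite -X1; apply: read_mx_frame f3; rewrite /= !inE; lia.
  apply: (runw_invert_step kn t3 w50 a50 aw hk); rewrite ?X3 //.
- move=> s3 f3 [hw ho] f; apply: hQ => //; rewrite ?ho.
    move=> pX; rewrite hw gj_invmx //; split=> //.
    have -> // : pivots_pos X n.
    by apply/forallP => j; apply/implyP => _; exact: (gj_pivotP sX).1.
  move=> npX; have -> // : pivots_pos X n = false.
  apply/negP => /forallP h; apply: npX; apply: (gj_pivotP sX).2 => j.
  by have := h j; rewrite ltn_ord.
Qed.

End DenseMatrices.

Arguments read_mx_frame {R n c s s' a}.
Arguments read_cv_frame {R n c s s' a}.

(** * Construction of the chain *)

Section BSSProgram.
Variable R : realType.
Implicit Types (s : memory R) (Q : memory R -> Prop).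
Variable n : nat.
Local Notation tables := (@tables R n).
Local Notation read_mx := (@read_mx R n).

(** Three entries of X determine the value on an edge, so each of the n^2 pairs is handled by one
    processor in constant time. The indicator of a = b, which removes the second vertex of a loop,
    is available as the identity matrix in array 40. *)
Lemma quad_edge (X : 'M[R]_n) (a b : 'I_n) : X^T = X ->
  quad X (edge R (a, b)) =
    X a a + (1 - (a == b)%:R) * (X b b - 2 * X a b).
Proof.
move=> sX; have Xe (p : 'I_n) : dot (delta_mx p 0) (X *m delta_mx p 0) = X p p.
  rewrite -colE /dot trmx_delta mxE (bigD1 p) //= big1 ?addr0 => [|i ip].
    by rewrite !mxE !eqxx mul1r.
  by rewrite !mxE (negPf ip) andbF mul0r.
have Xab : dot (delta_mx b 0) (X *m delta_mx a 0) = X a b.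
  rewrite -colE /dot trmx_delta mxE (bigD1 b) //= big1 ?addr0 => [|i ip].
    by rewrite !mxE !eqxx mul1r -[in LHS]sX mxE.
  by rewrite !mxE (negPf ip) andbF mul0r.
have -> : edge R (a, b) = delta_mx a 0 + (- (a != b)%:R) *: delta_mx b 0.
  apply/matrixP => i j; rewrite ord1 !mxE eqxx !andbT /=.
  by case: (i == b); case: (a != b); rewrite ?mulr1 ?mulr0 ?mulN1r ?oppr0.
rewrite quad_addv // Xab !quadE !Xe.
by case: (a == b) => /=; ring.
Qed.

Lemma index_split k : (k < n * n)%N -> exists i j : 'I_n, k = (i * n + j)%N.
Proof.
move=> kn; have n_gt0 : (0 < n)%N by case: (n) kn => //; rewrite muln0.
have iP : (k %/ n < n)%N by rewrite ltn_divLR.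
exists (Ordinal iP), (Ordinal (ltn_pmod k n_gt0)); exact: divn_eq.
Qed.

Definition quadx a :=
  RAdd (at_ a rowx rowx)
    (RMul (RSub (RConst 1) (RGet 40 NProc))
       (RSub (at_ a colx colx) (RMul (RConst 2) (RGet a NProc)))).

Lemma reval_quadx s a (i j : 'I_n) : tables s -> (read_mx s a)^T = read_mx s a ->
  reval s (i * n + j) (quadx a) = quad (read_mx s a) (edge R (i, j)).
Proof.
move=> [_ _ hrc h43 [h40 _]] sX; have [hr hc] := hrc i j.
rewrite quad_edge //= hr hc !h43 // -(mulr1n (1 - _)) !read_mxE h40.
by rewrite mulr1n [(1%:M : 'M[R]_n) i j]mxE.
Qed.

(* Real arrays 50 and 51 hold N and its edge weights, 52 the sum of the selected
   edges, 63 and 64 the barriers u and l, 65 the increment of u; 61 and 62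
   receive the traces that normalise the costs. *)
Definition bss_inverses :=
  Seq (setr 63 (NConst 0) (RAdd (r0 63) (r0 65)))
 (Seq (setr 64 (NConst 0) (RAdd (r0 64) (RConst 1)))
 (Seq (matset 53 (RSub (RMul (r0 63) (RGet 50 NProc)) (RGet 52 NProc)))
 (Seq (invert 54 53)
 (Seq (matset 53 (RSub (RGet 52 NProc) (RMul (r0 64) (RGet 50 NProc))))
 (Seq (invert 55 53)
 (Seq (matmul 56 50 54)
 (Seq (matmul 57 54 56)
 (Seq (matmul 56 50 55)
 (Seq (matmul 58 55 56)
 (Seq (trprod 61 50 57)
      (trprod 62 50 58))))))))))).

(** A sequential pass over all pairs that keeps the last usable one; averaging guarantees that there
    is one. *)
Definition bss_select :=
  Seq (matset 59 (RMul (RGet 51 NProc)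
        (RAdd (RDiv (quadx 57) (RMul (r0 65) (r0 61))) (quadx 54))))
 (Seq (matset 60 (RMul (RGet 51 NProc)
        (RSub (RDiv (quadx 58) (r0 62)) (quadx 55))))
      (For 47 (n0 40) (If (BRLt (RGet 59 (n0 47)) (RGet 60 (n0 47)))
        (setn 48 (NConst 0) (n0 47)) Skip))).

(** Array 67 becomes the edge vector. The entry 1 is written last: for a loop it replaces the -1 and
    leaves e_i. *)
Definition bss_update :=
  Seq (setr 66 (NConst 0) (RDiv (RGet 51 (n0 48)) (RGet 60 (n0 48))))
 (Seq (vecset 67 (RConst 0))
 (Seq (setr 67 (NGet 42 (n0 48)) (RSub (RConst 0) (RConst 1)))
 (Seq (setr 67 (NGet 41 (n0 48)) (RConst 1))
      (matset 52 (RAdd (RGet 52 NProc)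
         (RMul (r0 66) (RMul (RGet 67 rowx) (RGet 67 colx)))))))).

Definition bss_step := Seq bss_inverses (Seq bss_select bss_update).

Definition w_bss_inverses :=
  (100 + (100 + (w_mat n + (w_invert n + (w_mat n + (w_invert n + (w_matmul n +
   (w_matmul n + (w_matmul n + (w_matmul n + (w_trprod n + w_trprod n)))))))))))%N.
Definition w_bss_select :=
  (w_mat n + (w_mat n + (n * n * (200 + 200) + 200)))%N.
Definition w_bss_update := (100 + (w_vec n + (100 + (100 + w_mat n))))%N.
Definition w_bss_step := (w_bss_inverses + (w_bss_select + w_bss_update))%N.

Lemma runw_bss_inverses s Q (N A : 'M[R]_n) (u l : R) :
  tables s -> read_mx s 50 = N -> read_mx s 52 = A ->
  rmem s 63 0 + rmem s 65 0 = u -> rmem s 64 0 + 1 = l ->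
  posdef (u *: N - A) -> posdef (A - l *: N) ->
  let WU := invmx (u *: N - A) in
  let WL := invmx (A - l *: N) in
  (forall s', frame bss_inverses s s' ->
     rmem s' 63 0 = u -> rmem s' 64 0 = l -> read_mx s' 54 = WU -> read_mx s' 55 = WL ->
     read_mx s' 57 = WU *m N *m WU -> read_mx s' 58 = WL *m N *m WL ->
     rmem s' 61 0 = \tr (N *m (WU *m N *m WU)) ->
     rmem s' 62 0 = \tr (N *m (WL *m N *m WL)) -> Q s') ->
  runw s bss_inverses w_bss_inverses Q.
Proof.
move=> ts hN hA hu hl pU pL WU WL hQ; apply: runw_frame.
apply: runw_seq; apply: runw_setr => //.
apply: runw_seq; apply: runw_setr => //.
set s2 := setr_mem _ 64 _ _; have t2 : tables s2 by [].
have N2 : read_mx s2 50 = N by []. have A2 : read_mx s2 52 = A by [].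
have u2 : rmem s2 63 0 = u by [].
have l2 : rmem s2 64 0 = l by [].
apply: runw_seq; apply: runw_matset => // s3 f3 _ h3.
have t3 : tables s3 by apply: tables_frame f3 t2.
have X3 : read_mx s3 53 = u *: N - A.
  rewrite h3; apply/matrixP => i j; rewrite -N2 -A2 mxE /=.
  by rewrite -hu !mxE.
apply: runw_seq; apply: runw_invert => //; rewrite X3 ?pU.1 // => s4 f4 h4 _.
have t4 : tables s4 by apply: tables_frame f4 t3.
have [W4 _] := h4 pU.
have N4 : read_mx s4 50 = N by rewrite (read_mx_frame _ f4) // (read_mx_frame _ f3).
have A4 : read_mx s4 52 = A by rewrite (read_mx_frame _ f4) // (read_mx_frame _ f3).
have l4 : rmem s4 64 0 = l by rewrite f4.2 // f3.2.
have u4 : rmem s4 63 0 = u by rewrite f4.2 // f3.2.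
apply: runw_seq; apply: runw_matset => // s5 f5 _ h5.
have t5 : tables s5 by apply: tables_frame f5 t4.
have X5 : read_mx s5 53 = A - l *: N.
  rewrite h5; apply/matrixP => i j; rewrite -N4 -A4 mxE /=.
  by rewrite !mxE -l4.
apply: runw_seq; apply: runw_invert => //; rewrite X5 ?pL.1 // => s6 f6 h6 _.
have t6 : tables s6 by apply: tables_frame f6 t5.
have [W6 _] := h6 pL.
have N6 : read_mx s6 50 = N by rewrite (read_mx_frame _ f6) // (read_mx_frame _ f5).
have U6 : read_mx s6 54 = WU by rewrite (read_mx_frame _ f6) // (read_mx_frame _ f5).
apply: runw_seq; apply: runw_matmul => // s7 f7 h7; rewrite N6 U6 in h7.
have t7 : tables s7 by apply: tables_frame f7 t6.
have U7 : read_mx s7 54 = WU by rewrite (read_mx_frame _ f7).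
apply: runw_seq; apply: runw_matmul => // s8 f8 h8; rewrite U7 h7 mulmxA in h8.
have t8 : tables s8 by apply: tables_frame f8 t7.
have N8 : read_mx s8 50 = N by rewrite (read_mx_frame _ f8) // (read_mx_frame _ f7).
have L8 : read_mx s8 55 = WL by rewrite (read_mx_frame _ f8) // (read_mx_frame _ f7).
apply: runw_seq; apply: runw_matmul => // s9 f9 h9; rewrite N8 L8 in h9.
have t9 : tables s9 by apply: tables_frame f9 t8.
have L9 : read_mx s9 55 = WL by rewrite (read_mx_frame _ f9).
apply: runw_seq; apply: runw_matmul => // s10 f10 h10; rewrite L9 h9 mulmxA in h10.
have t10 : tables s10 by apply: tables_frame f10 t9.
have N10 : read_mx s10 50 = N by rewrite (read_mx_frame _ f10) // (read_mx_frame _ f9).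
have K10 : read_mx s10 57 = WU *m N *m WU by rewrite (read_mx_frame _ f10) // (read_mx_frame _ f9).
apply: runw_seq; apply: runw_trprod => // s11 f11 h11; rewrite N10 K10 in h11.
have t11 : tables s11 by apply: tables_frame f11 t10.
have N11 : read_mx s11 50 = N by rewrite (read_mx_frame _ f11).
have K11 : read_mx s11 58 = WL *m N *m WL by rewrite (read_mx_frame _ f11).
apply: runw_trprod => // s12 f12 h12 f; rewrite N11 K11 in h12.
apply: hQ => //.
- by rewrite f12.2 // f11.2 // f10.2 // f9.2 // f8.2 // f7.2 // f6.2 // f5.2.
- by rewrite f12.2 // f11.2 // f10.2 // f9.2 // f8.2 // f7.2 // f6.2 // f5.2.
- by rewrite (read_mx_frame _ f12) // (read_mx_frame _ f11) // (read_mx_frame _ f10) //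
    (read_mx_frame _ f9) // (read_mx_frame _ f8).
- by rewrite (read_mx_frame _ f12) // (read_mx_frame _ f11) // (read_mx_frame _ f10).
- by rewrite (read_mx_frame _ f12) // (read_mx_frame _ f11).
- by rewrite (read_mx_frame _ f12).
- by rewrite f12.2.
Qed.

Lemma runw_bss_select s Q (N WU WL : 'M[R]_n) (delta : R)
    (U := upper_cost (edge_weight N) (@edge R n) delta WU)
    (L := lower_cost (edge_weight N) (@edge R n) WL) :
  tables s -> N^T = N -> WU^T = WU -> WL^T = WL ->
  read_mx s 51 = \matrix_(i, j) edge_weight N (i, j) ->
  read_mx s 54 = WU -> read_mx s 55 = WL ->
  read_mx s 57 = WU *m N *m WU -> read_mx s 58 = WL *m N *m WL ->
  rmem s 61 0 = \tr (N *m (WU *m N *m WU)) ->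
  rmem s 62 0 = \tr (N *m (WL *m N *m WL)) -> rmem s 65 0 = delta ->
  (exists p, U p < L p) ->
  (forall s' (i j : 'I_n), frame bss_select s s' -> U (i, j) < L (i, j) ->
     nmem s' 48 0 = (i * n + j)%N -> read_mx s' 60 i j = L (i, j) -> Q s') ->
  runw s bss_select w_bss_select Q.
Proof.
move=> ts sN sU sL h51 h54 h55 h57 h58 h61 h62 h65 [[i0 j0] ex] hQ.
apply: runw_frame; apply: runw_seq; apply: runw_matset => // s1 f1 _ h1.
have t1 : tables s1 by apply: tables_frame f1 ts.
have U1 i j : read_mx s1 59 i j = U (i, j).
  rewrite h1 mxE /U /upper_cost gram_edge //.
  rewrite [reval _ _ _](_ : _ = rmem s 51 (i * n + j)%N *
    (reval s (i * n + j) (quadx 57) / (rmem s 65 0 * rmem s 61 0) +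
     reval s (i * n + j) (quadx 54))) //.
  have s57 : (read_mx s 57)^T = read_mx s 57 by rewrite h57 !trmx_mul sN sU mulmxA.
  have s54 : (read_mx s 54)^T = read_mx s 54 by rewrite h54.
  rewrite (reval_quadx i j ts s57) (reval_quadx i j ts s54).
  by rewrite read_mxE h51 mxE h65 h61 h57 h54.
apply: runw_seq; apply: runw_matset => // s2 f2 _ h2.
have t2 : tables s2 by apply: tables_frame f2 t1.
have L2 i j : read_mx s2 60 i j = L (i, j).
  rewrite h2 mxE /L /lower_cost gram_edge //.
  have e51 : read_mx s1 51 = read_mx s 51 by rewrite (read_mx_frame _ f1).
  have e55 : read_mx s1 55 = WL by rewrite (read_mx_frame _ f1).
  have e58 : read_mx s1 58 = WL *m N *m WL by rewrite (read_mx_frame _ f1).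
  have e62 : rmem s1 62 0 = rmem s 62 0 by rewrite f1.2.
  rewrite [reval _ _ _](_ : _ = rmem s1 51 (i * n + j)%N *
    (reval s1 (i * n + j) (quadx 58) / rmem s1 62 0 -
     reval s1 (i * n + j) (quadx 55))) //.
  have s58 : (read_mx s1 58)^T = read_mx s1 58 by rewrite e58 !trmx_mul sN sL mulmxA.
  have s55 : (read_mx s1 55)^T = read_mx s1 55 by rewrite e55.
  rewrite (reval_quadx i j t1 s58) (reval_quadx i j t1 s55).
  by rewrite read_mxE e51 h51 mxE e62 h62 e58 e55.
have U2 i j : read_mx s2 59 i j = U (i, j) by rewrite (read_mx_frame _ f2).
(* Nothing is known about cell 48 until a usable pair has been met, so the invariant is an
   implication. *)
apply: (runw_for (I := fun k s' =>
  (exists i j : 'I_n, (i * n + j < k)%N /\ U (i, j) < L (i, j)) ->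
  exists i j : 'I_n, nmem s' 48 0 = (i * n + j)%N /\ U (i, j) < L (i, j))) => //.
- by move=> [i [j []]].
- by move=> k s3 f3 _; have [_ + _ _ _] : tables s3 by apply: tables_frame f3 t2.
- move=> k s3 kn f3 h3 hk; have [i [j kE]] := index_split kn.
  apply: (runw_if (w := 100)) => //.
  have e : beval s3 0 (BRLt (RGet 59 (n0 47)) (RGet 60 (n0 47))) = (U (i, j) < L (i, j)).
    by rewrite /= hk kE !f3.2 // !read_mxE U2 L2.
  have ltS (i1 j1 : 'I_n) : (i1 * n + j1 < k.+1)%N -> U (i1, j1) < L (i1, j1) ->
      ~~ (U (i, j) < L (i, j)) -> (i1 * n + j1 < k)%N.
    rewrite ltnS leq_eqVlt => /orP[/eqP ek h|//].
    have [ni nj] : i1 = i /\ j1 = j.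
      have [_ _ hrc _ _] := ts; have [r1 c1] := hrc i1 j1; have [r2 c2] := hrc i j.
      by rewrite ek kE in r1 c1; split; apply: val_inj; rewrite /= -?r1 -?c1 ?r2 ?c2.
    by rewrite -ni -nj h.
  rewrite e; case: ifP => lt.
    by apply: runw_setn => // _; exists i, j; rewrite /= hk kE.
  apply: runw_run; apply: run_skip => -[i1 [j1 [h lt1]]]; apply: h3; exists i1, j1.
  by split=> //; apply: ltS => //; rewrite lt.
- move=> s3 f3 h3 f.
  have [|i [j [h lt]]] := h3.
    by exists i0, j0; split=> //; exact: index_lt.
  by apply: (hQ s3 i j) => //; rewrite (read_mx_frame _ f3).
Qed.

Lemma runw_bss_update s Q (N A : 'M[R]_n) (i j : 'I_n) :
  tables s -> read_mx s 51 = \matrix_(i, j) edge_weight N (i, j) -> read_mx s 52 = A ->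
  nmem s 48 0 = (i * n + j)%N ->
  (forall s', frame bss_update s s' ->
     read_mx s' 52 = A + (edge_weight N (i, j) / read_mx s 60 i j) *:
        (edge R (i, j) *m (edge R (i, j))^T) -> Q s') ->
  runw s bss_update w_bss_update Q.
Proof.
move=> ts h51 h52 h48 hQ; apply: runw_frame.
apply: runw_seq; apply: runw_setr => //.
set s1 := setr_mem _ 66 _ _; have t1 : tables s1 by [].
have r1 : rmem s1 66 0 = edge_weight N (i, j) / read_mx s 60 i j.
  by rewrite /= h48 !read_mxE h51 mxE.
apply: runw_seq; apply: runw_vecset => // s2 f2 n2 h2.
have t2 : tables s2 by apply: tables_frame f2 t1.
apply: runw_seq; apply: runw_setr => //; apply: runw_seq; apply: runw_setr => //.
set s4 := setr_mem _ 67 _ _; have t4 : tables s4 by [].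
have [_ _ hrc _ _] := ts; have [hr hc] := hrc i j.
have G4 (a : 'I_n) : rmem s4 67 a = edge R (i, j) a 0.
  rewrite /= n2 /= h48 hr hc [rmem s2 67 a](read_cvE s2 67) h2 !mxE /=.
  rewrite -!(inj_eq val_inj) /=.
  have [ai|ai] := eqVneq (val a) (val i); have [aj|aj] := eqVneq (val a) (val j);
    rewrite /= ?subr0 //.
    by rewrite (_ : i = j) ?eqxx ?subr0 //; apply: val_inj; rewrite -ai -aj.
  by rewrite (_ : (i != j) = true) //; apply/eqP => ij; rewrite ij aj eqxx in ai.
have A4 : read_mx s4 52 = A by rewrite [LHS](_ : _ = read_mx s2 52) // (read_mx_frame _ f2).
have c4 : rmem s4 66 0 = edge_weight N (i, j) / read_mx s 60 i j.
  by rewrite -r1 [LHS](_ : _ = rmem s2 66 0) // f2.2.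
apply: runw_matset => // s5 f5 _ h5 f; apply: hQ => //.
rewrite h5; apply/matrixP => a b; have [_ _ hrc4 _ _] := t4; have [hr4 hc4] := hrc4 a b.
rewrite mxE [reval _ _ _](_ : _ = rmem s4 52 (a * n + b)%N + rmem s4 66 0 *
  (rmem s4 67 (nmem s4 41 (a * n + b)%N) * rmem s4 67 (nmem s4 42 (a * n + b)%N))) //.
rewrite read_mxE A4 c4 hr4 hc4 !G4 [RHS]mxE; congr (_ + _).
by rewrite [RHS]mxE edge_rank1E.
Qed.

Lemma runw_bss_step s Q (N : 'M[R]_n) (q : R) (k : nat) :
  (0 < n)%N -> tables s -> lap N -> posdef N -> 3 < q ->
  read_mx s 50 = N -> read_mx s 51 = \matrix_(i, j) edge_weight N (i, j) ->
  bss_state N q k (read_mx s 52) ->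
  rmem s 63 0 = n%:R * q + k%:R * (q / (q - 3)) ->
  rmem s 64 0 = - (n%:R * q) + k%:R -> rmem s 65 0 = q / (q - 3) ->
  (forall s', frame bss_step s s' -> bss_state N q k.+1 (read_mx s' 52) ->
     rmem s' 63 0 = n%:R * q + k.+1%:R * (q / (q - 3)) ->
     rmem s' 64 0 = - (n%:R * q) + k.+1%:R -> Q s') ->
  runw s bss_step w_bss_step Q.
Proof.
move=> n0 ts lN pN q3 h50 h51 st h63 h64 h65 hQ; apply: runw_frame.
have [pU pL ex stp] := bss_state_step n0 lN pN q3 st.
apply: runw_seq; apply: (runw_bss_inverses ts h50 (erefl _) _ _ pU pL).
- by rewrite h63 h65 -[k.+1%:R]natr1 mulrDl mul1r addrA.
- by rewrite h64 -[k.+1%:R]natr1 addrA.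
move=> s1 f1 u1 l1 U1 L1 KU1 KL1 tU1 tL1.
have t1 : tables s1 by apply: tables_frame f1 ts.
have e51 : read_mx s1 51 = read_mx s 51 by rewrite (read_mx_frame _ f1).
have e65 : rmem s1 65 0 = q / (q - 3) by rewrite f1.2.
have sU := (posdef_inv pU).1; have sL := (posdef_inv pL).1; have [sN _ _] := lN.
apply: runw_seq; apply: (runw_bss_select t1 sN sU sL _ U1 L1 KU1 KL1 tU1 tL1 e65 ex).
  by rewrite e51.
move=> s2 i j f2 lt h48 h60.
have t2 : tables s2 by apply: tables_frame f2 t1.
apply: (runw_bss_update (N := N) (A := read_mx s 52) t2 _ _ h48).
- by rewrite (read_mx_frame _ f2) // e51.
- by rewrite (read_mx_frame _ f2) // (read_mx_frame _ f1).
move=> s3 f3 h52 f; apply: hQ => //.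
- by rewrite h52 h60; apply: stp.
- by rewrite f3.2 // f2.2.
- by rewrite f3.2 // f2.2.
Qed.

End BSSProgram.

(** * Computing the next level *)

Section LevelProgram.
Variable R : realType.
Implicit Types (s : memory R) (Q : memory R -> Prop).
Variable n : nat.
Local Notation tables := (@tables R n).
Local Notation read_mx := (@read_mx R n).

(* Real arrays 70 and 71 hold the matrix A of the level and the diagonal of D,
   array 73 the number q. *)
Definition level_init :=
  Seq (matset 68 (RDiv (RGet 70 NProc) (RGet 71 colx)))
 (Seq (matmul 69 68 70)
 (Seq (matset 50 (RSub (RMul (RGet 40 NProc) (RGet 71 colx)) (RGet 69 NProc)))
 (Seq (rowsums 72 50)
 (Seq (matset 51
        (RAdd (RMul (RSub (RConst 1) (RGet 40 NProc))
                    (RDiv (RSub (RConst 0) (RGet 50 NProc)) (RConst 2)))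
              (RMul (RGet 40 NProc) (RGet 72 rowx))))
 (Seq (matset 52 (RConst 0))
 (Seq (setr 63 (NConst 0) (RMul (r0 41) (r0 73)))
 (Seq (setr 64 (NConst 0) (RSub (RConst 0) (r0 63)))
      (setr 65 (NConst 0) (RDiv (r0 73) (RSub (r0 73) (RConst 3))))))))))).

(** The lower barrier doubles as loop counter: it starts at -n q and grows by 1, so it stays below n
    (q^2 - q) for exactly n q^2 rounds. Counting in reals makes the products available. *)
Definition level_prog :=
  Seq level_init
 (Seq (While (BRLt (r0 64) (RMul (r0 41) (RSub (RMul (r0 73) (r0 73)) (r0 73)))) bss_step)
      (matset 70 (RSub (RMul (RGet 40 NProc) (RGet 71 colx))
                       (RDiv (RGet 52 NProc) (r0 63))))).

Definition w_level_init :=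
  (w_mat n + (w_matmul n + (w_mat n + (w_rowsums n + (w_mat n + (w_mat n +
   (100 + (100 + 100))))))))%N.
Definition w_level q :=
  (w_level_init + ((n * q ^ 2 * (w_bss_step n + 100) + 100) + w_mat n))%N.

Lemma runw_level_init s Q (dv : 'rV[R]_n) (A : 'M[R]_n) (q : nat) :
  tables s -> read_mx s 70 = A -> (forall i : 'I_n, rmem s 71 i = dv 0 i) ->
  (forall i, 0 < dv 0 i) -> rmem s 73 0 = q%:R ->
  (forall s', frame level_init s s' -> read_mx s' 50 = reduced dv A ->
     read_mx s' 51 = \matrix_(i, j) edge_weight (reduced dv A) (i, j) ->
     read_mx s' 52 = 0 -> rmem s' 63 0 = n%:R * q%:R ->
     rmem s' 64 0 = - (n%:R * q%:R) -> rmem s' 65 0 = q%:R / (q%:R - 3) ->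
     Q s') ->
  runw s level_init w_level_init Q.
Proof.
move=> ts hA hd d0 hq hQ; apply: runw_frame.
apply: runw_seq; apply: runw_matset => // s1 f1 _ h1.
have t1 : tables s1 by apply: tables_frame f1 ts.
have e1 : read_mx s1 68 = A *m invmx (diag_mx dv).
  rewrite h1; apply/matrixP => i j; have [_ _ hrc _ _] := ts; have [_ hc] := hrc i j.
  by rewrite mul_invmx_diag // mxE /= hc hd read_mxE hA.
have A1 : read_mx s1 70 = A by rewrite (read_mx_frame _ f1).
apply: runw_seq; apply: runw_matmul => // s2 f2 h2; rewrite e1 A1 in h2.
have t2 : tables s2 by apply: tables_frame f2 t1.
have d2 : forall i : 'I_n, rmem s2 71 i = dv 0 i by move=> i; rewrite f2.2 // f1.2.
apply: runw_seq; apply: runw_matset => // s3 f3 _ h3.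
have t3 : tables s3 by apply: tables_frame f3 t2.
have N3 : read_mx s3 50 = reduced dv A.
  rewrite h3; apply/matrixP => i j; have [_ _ hrc _ [h40 _]] := t2.
  have [_ hc] := hrc i j.
  rewrite mxE /= hc d2 !read_mxE h40 h2 mxE [RHS]mxE [X in _ = X + _]mxE [X in _ = _ + X]mxE.
  congr (_ - _).
  by have [->|_] := eqVneq i j; rewrite ?mulr1n ?mulr0n ?mul1r ?mul0r.
apply: runw_seq; apply: runw_rowsums => // s4 f4 h4; rewrite N3 in h4.
have t4 : tables s4 by apply: tables_frame f4 t3.
have N4 : read_mx s4 50 = reduced dv A by rewrite (read_mx_frame _ f4).
apply: runw_seq; apply: runw_matset => // s5 f5 _ h5.
have t5 : tables s5 by apply: tables_frame f5 t4.
have W5 : read_mx s5 51 = \matrix_(i, j) edge_weight (reduced dv A) (i, j).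
  rewrite h5; apply/matrixP => i j; have [_ _ hrc _ [h40 _]] := t4.
  have [hr _] := hrc i j.
  rewrite [LHS]mxE [RHS]mxE /= hr !read_mxE h40 N4 (read_cvE s4 72 i) h4 [(\col__ _) _ _]mxE.
  rewrite [(1%:M : 'M[R]_n) i j]mxE /edge_weight /=.
  have [->|_] := eqVneq i j; rewrite ?mulr1n ?mulr0n /=.
    by rewrite subrr mul0r add0r mul1r.
  by rewrite mul0r addr0 subr0 mul1r sub0r.
apply: runw_seq; apply: runw_matset => // s6 f6 _ h6.
apply: runw_seq; apply: runw_setr => //; apply: runw_seq; apply: runw_setr => //.
apply: runw_setr => // f; have t6 : tables s6 by apply: tables_frame f6 t5.
have q6 : rmem s6 73 0 = q%:R by rewrite f6.2 // f5.2 // f4.2 // f3.2 // f2.2 // f1.2.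
have [_ _ _ _ [_ n6]] := t6.
apply: hQ => //.
- rewrite [LHS](_ : _ = read_mx s6 50) //.
  by rewrite (read_mx_frame _ f6) // (read_mx_frame _ f5).
- rewrite [LHS](_ : _ = read_mx s6 51) //.
  by rewrite (read_mx_frame _ f6).
- rewrite [LHS](_ : _ = read_mx s6 52) //.
  by rewrite h6; apply/matrixP => i j; rewrite !mxE.
- by rewrite /= n6 q6.
- by rewrite /= n6 q6 sub0r.
- by rewrite /= q6.
Qed.

Lemma runw_level s Q (dv : 'rV[R]_n) (A : 'M[R]_n) (q : nat) :
  (0 < n)%N -> (3 < q)%N -> tables s -> read_mx s 70 = A ->
  (forall i : 'I_n, rmem s 71 i = dv 0 i) -> (forall i, 0 < dv 0 i) ->
  rmem s 73 0 = q%:R -> lap (reduced dv A) -> posdef (reduced dv A) ->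
  (forall s', frame level_prog s s' ->
     level_step dv (5 / q%:R) (4 * n * q ^ 2) A (read_mx s' 70) -> Q s') ->
  runw s level_prog (w_level q) Q.
Proof.
move=> n_gt0 q3 ts hA hd d0 hq lN pN hQ; apply: runw_frame.
have q3R : (3 : R) < q%:R by rewrite (ltr_nat _ 3).
have q0R : (0 : R) < q%:R by lra.
set N := reduced dv A in lN pN.
apply: runw_seq; apply: (runw_level_init ts hA hd d0 hq) => s1 f1 N1 W1 A1 u1 l1 e1.
have t1 : tables s1 by apply: tables_frame f1 ts.
apply: runw_seq; apply: (runw_while (I := fun k s' =>
   [/\ bss_state N q%:R k (read_mx s' 52),
       rmem s' 63 0 = n%:R * q%:R + k%:R * (q%:R / (q%:R - 3)) &
       rmem s' 64 0 = - (n%:R * q%:R) + k%:R])) => //.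
- by split; [rewrite A1; exact: bss_state0 | rewrite u1 mul0r addr0 | rewrite l1 addr0].
- move=> k s2 kT f2 [st u2 l2].
  have t2 : tables s2 by apply: tables_frame f2 t1.
  have [_ _ _ _ [_ n2]] := t2.
  have q2 : rmem s2 73 0 = q%:R by rewrite f2.2 // f1.2.
  split.
    rewrite /= l2 n2 q2; have : (k%:R : R) < (n * q ^ 2)%:R by rewrite ltr_nat.
    by rewrite natrM natrX; lra.
  apply: (runw_bss_step n_gt0 t2 lN pN q3R _ _ st u2 l2) => //.
  + by rewrite (read_mx_frame _ f2).
  + by rewrite (read_mx_frame _ f2).
  + by rewrite f2.2.
- move=> s2 f2 [st u2 l2].
  have t2 : tables s2 by apply: tables_frame f2 t1.
  have [_ _ _ _ [_ n2]] := t2.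
  have q2 : rmem s2 73 0 = q%:R by rewrite f2.2 // f1.2.
  split.
    by rewrite /= l2 n2 q2 natrM natrX; apply/negbTE; rewrite -leNgt; lra.
  apply: runw_matset => // s3 f3 _ h3 f; apply: hQ => //.
  have sN : N^T = N by case: lN.
  rewrite (_ : read_mx s3 70 = diag_mx dv - (n%:R * q%:R + (n * q ^ 2)%:R * (q%:R / (q%:R - 3)))^-1
    *: read_mx s2 52); first exact: bss_level_step.
  rewrite h3; apply/matrixP => i j; have [_ _ hrc _ [h40 _]] := t2.
  have [_ hc] := hrc i j.
  have d2 : rmem s2 71 j = dv 0 j by rewrite f2.2 // f1.2.
  rewrite [LHS]mxE /= hc !read_mxE h40 u2 d2 [RHS]mxE [X in _ = X + _]mxE [X in _ = _ + X]mxE.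
  rewrite [X in _ = _ - X]mxE [X in _ = _ - X]mulrC; congr (_ - _).
  by rewrite [1%:M _ _]mxE; case: eqP => [->|_]; rewrite ?mulr1n ?mulr0n ?mul1r ?mul0r.
Qed.

End LevelProgram.

(** * Writing a level in compressed sparse row format *)

Section AppendProgram.
Variable R : realType.
Implicit Types (s : memory R) (Q : memory R -> Prop).
Variable n : nat.
Implicit Types (L : seq (nat * R)) (rs : seq 'rV[R]_n).
Local Notation tables := (@tables R n).
Local Notation read_mx := (@read_mx R n).

(* The matrix under construction is in compressed sparse row format in arrays
   4, 5 and 1; the cells 74 and 75 count its rows and its entries. *)
Definition append_entry :=
  let x := RGet 70 (NAdd (NGet 43 (n0 76)) (n0 77)) in
  If (BAnd (BNot (BRLt (RConst 0) x)) (BNot (BRLt x (RConst 0)))) Skip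
    (Seq (setn 5 (n0 75) (n0 77))
    (Seq (setr 1 (n0 75) x)
         (setn 75 (NConst 0) (NAdd (n0 75) (NConst 1))))).

Definition append_row :=
  Seq (setn 4 (n0 74) (n0 75))
 (Seq (For 77 (n0 0) append_entry)
      (setn 74 (NConst 0) (NAdd (n0 74) (NConst 1)))).

Definition append_level :=
  Seq (vecR (NAdd (n0 74) (n0 0)) (ge_guard 74) 2 (RGet 71 (NSub NProc (n0 74))))
      (For 76 (n0 0) append_row).

Definition stored_entries s L :=
  nmem s 75 0 = size L /\ forall k, (k < size L)%N ->
    (nmem s 5 k, rmem s 1 k) = nth (0%N, 0) L k.

(** Unlike [stores_rows] this leaves out the pointer past the last row, which is written when the
    next row starts or at the end of [build]. *)
Definition stored_csr s rs :=
  [/\ stored_entries s (entries rs), nmem s 74 0 = size rs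
    & forall i, (i < size rs)%N -> nmem s 4 i = size (entries (take i rs))].

Lemma runw_append_entry s Q L (i j : 'I_n) (x := read_mx s 70 i j) :
  tables s -> nmem s 76 0 = i -> nmem s 77 0 = j -> stored_entries s L ->
  (forall s', frame append_entry s s' ->
     stored_entries s' (L ++ if x != 0 then [:: (nat_of_ord j, x)] else [::]) -> Q s') ->
  runw s append_entry 400 Q.
Proof.
move=> ts h76 h77 [cL eL] hQ; apply: runw_frame; have [_ _ _ h43 _] := ts.
apply: (@runw_if _ _ _ _ _ 300) => //.
have xE : rmem s 70 (nmem s 43 (nmem s 76 0) + nmem s 77 0)%N = x.
  by rewrite h76 h77 h43 // read_mxE.
rewrite [beval _ _ _]/= xE -!leNgt -eq_le; case: eqP => [x0|/eqP x0].
  apply: runw_run; apply: run_weaken (run_skip _) _ _ _; [|by []|exact: leqnn|by move=> s' h _; exact: h].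
  by move=> f; apply: hQ => //; rewrite x0 eqxx cats0.
apply: (@runw_seq _ _ _ _ 100 200); apply: runw_setn => //.
apply: (@runw_seq _ _ _ _ 100 100); apply: runw_setr => //; apply: runw_setn => // f.
apply: hQ => //; rewrite x0; split; first by rewrite /= size_cat cL addn1.
move=> k; rewrite size_cat addn1 ltnS leq_eqVlt nth_cat /= cL => /orP[/eqP->|kL].
  by rewrite eqxx ltnn subnn xE h77.
by rewrite kL ltn_eqF // eL.
Qed.

Definition row_prefix (r : 'rV[R]_n) k : seq (nat * R) :=
  [seq (nat_of_ord j, r 0 j) | j <- [seq j <- take k (enum 'I_n) | r 0 j != 0]].

Lemma row_prefixS r (j : 'I_n) :
  row_prefix r j.+1 = row_prefix r j ++
    if r 0 j != 0 then [:: (nat_of_ord j, r 0 j)] else [::].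
Proof.
rewrite /row_prefix (take_nth j) ?size_enum_ord // nth_ord_enum filter_rcons.
by case: ifP => _; rewrite ?cats0 // map_rcons cats1.
Qed.

Lemma row_prefix_all r : row_prefix r n = row_entries r.
Proof. by rewrite /row_prefix take_oversize // size_enum_ord. Qed.

Definition w_append_row := (100 + ((n * (400 + 200) + 200) + 100))%N.

Lemma runw_append_row s Q rs (i : 'I_n) :
  tables s -> nmem s 76 0 = i -> stored_csr s rs ->
  (forall s', frame append_row s s' ->
     stored_csr s' (rcons rs (row i (read_mx s 70))) -> Q s') ->
  runw s append_row w_append_row Q.
Proof.
move=> ts h76 [[cE eE] cR pR] hQ; apply: runw_frame.
apply: runw_seq; apply: runw_setn => //; set s1 := setn_mem _ _ _ _.
have t1 : tables s1 by [].
apply: runw_seq; apply: (runw_for (I := fun k s' =>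
   stored_entries s' (entries rs ++ row_prefix (row i (read_mx s 70)) k))) => //.
- by rewrite /row_prefix take0 cats0.
- by move=> k s2 f2 _; have [//] : tables s2; apply: tables_frame f2 t1.
- move=> k s2 kn f2 h2 hk; have t2 : tables s2 by apply: tables_frame f2 t1.
  have M2 : read_mx s2 70 = read_mx s 70 by rewrite (read_mx_frame _ f2).
  apply: (runw_append_entry (i := i) (j := Ordinal kn) t2 _ hk h2).
    by rewrite f2.1.
  move=> s3 f3; rewrite M2 => h3; rewrite (row_prefixS _ (Ordinal kn)) catA mxE.
  exact: h3.
move=> s2 f2; rewrite row_prefix_all -entries_rcons => -[c2 e2].
have r2 : nmem s2 74 0 = size rs by rewrite f2.1 //= cR.
apply: runw_setn => // f; apply: hQ => //; split=> //.
  by rewrite /= r2 addn1 size_rcons.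
move=> k; rewrite size_rcons ltnS leq_eqVlt [nmem _ _ _]/= f2.1 //= cR cE.
case/orP => [/eqP->|kr].
  by rewrite eqxx -cats1 take_cat ltnn subnn take0 cats0.
by rewrite ltn_eqF // pR // -cats1 take_cat kr.
Qed.

Lemma take_rows (X : 'M[R]_n) (k : 'I_n) :
  take k.+1 (rows X) = rcons (take k (rows X)) (row k X).
Proof. by rewrite (take_nth 0) ?size_rows // nth_rows. Qed.

Definition w_append_level k :=
  (100 * (k + n).+1 + (n * (w_append_row + 200) + 200))%N.

Lemma runw_append_level s Q rs (dv : 'rV[R]_n) v :
  tables s -> (forall i : 'I_n, rmem s 71 i = dv 0 i) ->
  stored_csr s rs -> stores_vec s 2 v -> size v = size rs ->
  (forall s', frame append_level s s' -> stored_csr s' (rs ++ rows (read_mx s 70)) ->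
     stores_vec s' 2 (v ++ [seq dv 0 j | j <- enum 'I_n]) -> Q s') ->
  runw s append_level (w_append_level (size rs)) Q.
Proof.
move=> ts hd [hE cR pR] hv sv hQ; apply: runw_frame; have [h0 _ _ _ _] := ts.
apply: runw_seq; apply: runw_frame; apply: runw_run.
apply: run_vecR_len => //; first by rewrite /= cR h0.
set s1 := vecR_mem _ _ _ _ _ => f1.
have t1 : tables s1 by [].
have v1 : stores_vec s1 2 (v ++ [seq dv 0 j | j <- enum 'I_n]).
  move=> k; rewrite size_cat size_map size_enum_ord nth_cat /= cR h0 sv => kn.
  rewrite kn /= -leqNgt; have [kr|rk] := ltnP k (size rs); first by rewrite hv ?sv.
  have kl : (k - size rs < n)%N by lia.
  by rewrite (nth_map (Ordinal kl)) ?size_enum_ord // -(hd (nth _ _ _)) nth_enum_ord.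
apply: (runw_for (I := fun k s' => stored_csr s' (rs ++ take k (rows (read_mx s 70))))) => //.
- by rewrite take0 cats0.
- move=> k s2 f2 _; have [//] : tables s2; exact: tables_frame f2 t1.
- move=> k s2 kn f2 h2 hk; have t2 : tables s2 by apply: tables_frame f2 t1.
  have M2 : read_mx s2 70 = read_mx s 70 by rewrite (read_mx_frame _ f2).
  apply: (runw_append_row (i := Ordinal kn) t2 hk h2) => s3 f3; rewrite M2 => h3.
  by have /= -> := take_rows (read_mx s 70) (Ordinal kn); rewrite -rcons_cat.
- move=> s2 f2 h2 f; apply: hQ => //.
    by move: h2; rewrite take_oversize // size_rows.
  by move=> k kl; rewrite f2.2 //; apply: v1.
Qed.

End AppendProgram.

(** * The complete construction *)

Section BuildProgram.
Variable R : realType.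
Implicit Types (s : memory R) (Q : memory R -> Prop).
Variable n : nat.
Local Notation tables := (@tables R n).
Local Notation read_mx := (@read_mx R n).

(** Cell 0 of array 40 runs through the positions by unit steps, so coordinates, row starts and n^2
    are obtained without multiplication or division. *)
Definition init_cell :=
  Seq (setn 41 (n0 40) (n0 46))
 (Seq (setn 42 (n0 40) (n0 47))
      (setn 40 (NConst 0) (NAdd (n0 40) (NConst 1)))).

Definition init_row :=
  Seq (setn 43 (n0 46) (n0 40))
 (Seq (For 47 (n0 0) init_cell)
      (setr 41 (NConst 0) (RAdd (r0 41) (RConst 1)))).

Definition init_tables :=
  Seq (setn 40 (NConst 0) (NConst 0))
 (Seq (setr 41 (NConst 0) (RConst 0))
 (Seq (For 46 (n0 0) init_row)
 (Seq (vecR (n0 40) BTrue 40 (RConst 0))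
      (vecR (n0 40) (BAnd (BNot (BNLt rowx colx)) (BNot (BNLt colx rowx))) 40
         (RConst 1))))).

Definition w_init_row := (100 + ((n * (300 + 200) + 200) + 100))%N.
Definition w_init_tables :=
  (100 + (100 + ((n * (w_init_row + 200) + 200) + (w_mat n + w_mat n))))%N.

Definition cells s c := nmem s 40 0 = c /\
  forall p, (p < c)%N -> nmem s 41 p = (p %/ n)%N /\ nmem s 42 p = (p %% n)%N.

Lemma runw_init_row s Q i : (i < n)%N -> nmem s 0 0 = n -> nmem s 46 0 = i ->
  cells s (i * n) ->
  (forall s', frame init_row s s' -> cells s' (i.+1 * n) ->
     nmem s' 43 = (fun x => if x == i then (i * n)%N else nmem s 43 x) ->
     rmem s' 41 0 = rmem s 41 0 + 1 -> Q s') ->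
  runw s init_row w_init_row Q.
Proof.
move=> iltn hn h46 hc hQ; apply: runw_frame.
apply: runw_seq; apply: runw_setn => //.
apply: runw_seq; apply: (runw_for (I := fun j s' => cells s' (i * n + j))) => //.
- by rewrite addn0.
- by move=> j s2 f2 _; rewrite /= f2.1.
- move=> j s2 jn f2 [c2 e2] hj.
  have i2 : nmem s2 46 0 = i by rewrite f2.1.
  apply: (@runw_seq _ _ _ _ 100 200); apply: runw_setn => //.
  apply: (@runw_seq _ _ _ _ 100 100); apply: runw_setn => //; apply: runw_setn => //.
  split; first by rewrite /= c2 addn1 addnS.
  move=> p; rewrite addnS ltnS leq_eqVlt /= c2 i2 hj => /orP[/eqP->|h].
    rewrite eqxx divnMDl ?(leq_ltn_trans _ iltn) // modnMDl.
    by rewrite divn_small // modn_small // addn0.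
  by rewrite ltn_eqF //; exact: e2.
- move=> s2 f2 c2; apply: runw_setr => // f; apply: hQ => //.
  + by rewrite mulSnr.
  + rewrite [LHS](_ : _ = nmem s2 43) // f2.1 //; apply/funext => x.
    by rewrite /= h46 hc.1.
  + by rewrite /= f2.2.
Qed.

Lemma runw_init_tables s Q : nmem s 0 0 = n ->
  (forall s', frame init_tables s s' -> tables s' -> Q s') ->
  runw s init_tables w_init_tables Q.
Proof.
move=> hn hQ; apply: runw_frame.
apply: runw_seq; apply: runw_setn => //; apply: runw_seq; apply: runw_setr => //.
apply: runw_seq; apply: (runw_for (I := fun i s' => [/\ cells s' (i * n),
  forall i', (i' < i)%N -> nmem s' 43 i' = (i' * n)%N & rmem s' 41 0 = i%:R])) => //.
- by move=> i s2 f2 _; rewrite /= f2.1.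
- move=> i s2 iltn f2 [c2 e2 r2] hi.
  have n2 : nmem s2 0 0 = n by rewrite f2.1.
  apply: (runw_init_row iltn n2 hi c2) => s3 f3 c3 e3 r3; split=> //.
  + move=> i'; rewrite ltnS leq_eqVlt [nmem _ _ _](_ : _ = nmem s3 43 i') // e3 /=.
    by case/orP => [/eqP->|h]; rewrite ?eqxx // ltn_eqF // e2.
  + by rewrite [LHS](_ : _ = rmem s3 41 0) // r3 r2 natr1.
move=> s2 f2 [[c2 e2] h43 r2].
apply: runw_seq; apply: runw_run; apply: run_vecR_len => //.
apply: runw_run; apply: run_vecR_len => // f; apply: hQ => //.
have hrc (i j : 'I_n) : nmem s2 41 (i * n + j) = i /\ nmem s2 42 (i * n + j) = j.
  have [-> ->] := e2 _ (index_lt i j); rewrite divnMDl ?modnMDl.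
    by rewrite divn_small // modn_small // addn0.
  exact: leq_ltn_trans (ltn_ord i).
split=> //; first by rewrite /= f2.1.
split=> //; apply/matrixP => i j; have [hr hc] := hrc i j.
rewrite !mxE /= c2 index_lt hr hc /= -!leqNgt -eqn_leq eq_sym -val_eqE /=.
by case: eqP.
Qed.

(** Column k is obtained as M e_k from the sparse product, and its outer product with e_k is added
    to the dense copy. *)
Definition dense_column :=
  Seq (vecset 20 (RGet 40 (NAdd (NGet 43 NProc) (n0 49))))
 (Seq (setn 20 (NConst 0) (NConst 0))
 (Seq (matvec 1 2 0)
      (matset 76 (RAdd (RGet 76 NProc)
         (RMul (RGet 21 rowx) (RGet 40 (NAdd (NGet 43 (n0 49)) colx))))))).

Definition dense := Seq (matset 76 (RConst 0)) (For 49 (n0 0) dense_column).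

Definition w_dense_column :=
  (w_vec n + (100 + ((2 * 4000 * (n * n) + 100 * n + 4500) + w_mat n)))%N.
Definition w_dense := (w_mat n + (n * (w_dense_column + 200) + 200))%N.

Lemma stores_matrix_frame c s s' (M : 'M[R]_n) :
  all (fun a => a \notin nmods c) [:: 0; 1; 2]%N -> 0%N \notin rmods c ->
  frame c s s' -> stores_matrix s M -> stores_matrix s' M.
Proof.
move=> /and4P[h0 h1 h2 _] r0 [fn fr].
by rewrite /stores_matrix /stores_rows !fn // fr.
Qed.

Lemma runw_dense s Q (M : 'M[R]_n) : tables s -> stores_matrix s M ->
  (forall s', frame dense s s' -> read_mx s' 76 = M -> Q s') ->
  runw s dense w_dense Q.
Proof.
move=> ts hM hQ; apply: runw_frame.
apply: runw_seq; apply: runw_matset => // s1 f1 _ h1.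
have t1 : tables s1 by apply: tables_frame f1 ts.
have M1 : stores_matrix s1 M by apply: stores_matrix_frame f1 hM.
apply: (runw_for (I := fun k s' => read_mx s' 76 =
   \matrix_(i, j) if (j < k)%N then M i j else 0)) => //.
- by move=> k s2 f2 _; have [//] : tables s2; apply: tables_frame f2 t1.
- move=> k s2 kn f2 h2 hk; have t2 : tables s2 by apply: tables_frame f2 t1.
  have M2 : stores_matrix s2 M by apply: stores_matrix_frame f2 M1.
  have [_ _ _ h43 [h40 _]] := t2.
  apply: runw_seq; apply: runw_vecset => // s3 f3 n3 h3.
  have t3 : tables s3 by apply: tables_frame f3 t2.
  have M3 : stores_matrix s3 M by apply: stores_matrix_frame f3 M2.
  apply: runw_seq; apply: runw_setn => //; set s4 := setn_mem _ _ _ _.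
  have t4 : tables s4 by [].
  have M4 : stores_matrix s4 M by [].
  apply: runw_seq; apply: (@runw_weaken _ _ _ (2 * 4000 * nnz M + 100 * n + 4500)
    _ (fun s' => read_cv n s' 21 = M *m read_cv n s4 20)).
  + by apply: runw_run; apply: run_matvec_matrix.
  + by have := nnz_le_sqr M; lia.
  move=> s5 h5 f5; have t5 : tables s5 by apply: tables_frame f5 t4.
  apply: runw_matset => // s6 f6 _ h6.
  rewrite [read_mx _ 76](_ : _ = read_mx s6 76) // h6; apply/matrixP => i j.
  have [_ _ hrc5 h435 [h405 _]] := t5; have [hr hc] := hrc5 i j.
  have k5 : nmem s5 49 0 = k by rewrite f5.1 //= n3.
  have D5 : read_mx s5 76 = read_mx s2 76.
    by rewrite (read_mx_frame _ f5) // [LHS](_ : _ = read_mx s3 76) // (read_mx_frame _ f3).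
  have V4 : read_cv n s4 20 = col (Ordinal kn) 1%:M.
    rewrite [LHS](_ : _ = read_cv n s3 20) // h3; apply/matrixP => a b.
    by rewrite [LHS]mxE /= h43 // hk -h40 !mxE.
  rewrite [LHS]mxE [RHS]mxE /= hr hc k5 h435 // !read_mxE D5 h2 (read_mxE s5 40 (Ordinal kn)) h405.
  rewrite (read_cvE s5 21 i) h5 V4 colE mul1mx -colE !mxE -val_eqE /= ltnS.
  case: (ltngtP j k) => jk; rewrite ?mulr0 ?addr0 // mulr1 add0r.
  by congr (M _ _); apply: val_inj.
- move=> s2 f2 h2 f; apply: hQ => //; rewrite h2; apply/matrixP => i j.
  by rewrite mxE ltn_ord.
Qed.

(* Real array 74 holds (5/4)^k, array 73 the number q = 30 d; natural number
   array 3 holds d = k + 3. *)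
Definition search_step :=
  Seq (setr 74 (NConst 0) (RDiv (RMul (r0 74) (RConst 5)) (RConst 4)))
 (Seq (setn 3 (NConst 0) (NAdd (n0 3) (NConst 1)))
 (Seq (setr 73 (NConst 0) (RAdd (r0 73) (RConst 30)))
 (Seq (matset 77 (RSub (RMul (r0 74) (RGet 76 NProc))
                       (RMul (RGet 40 NProc) (RGet 71 colx))))
      (invert 78 77)))).

(** The initial values 4/5, 2 and 60 are those for k = -1, because each round advances them before
    testing. *)
Definition search :=
  Seq (setr 74 (NConst 0) (RDiv (RConst 4) (RConst 5)))
 (Seq (setn 3 (NConst 0) (NConst 2))
 (Seq (setr 73 (NConst 0) (RConst 60))
 (Seq (setn 45 (NConst 0) (NConst 0))
      (While (BNLt (n0 45) (NConst 1)) search_step)))).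

Definition w_search K :=
  (100 + (100 + (100 + (100 +
   (K.+1 * ((100 + (100 + (100 + (w_mat n + w_invert n)))) + 100) + 100)))))%N.

Lemma runw_search s Q (M : 'M[R]_n) (dv : 'rV[R]_n) K :
  tables s -> read_mx s 76 = M -> (forall i : 'I_n, rmem s 71 i = dv 0 i) ->
  M^T = M -> posdef ((5 / 4) ^+ K *: M - diag_mx dv) ->
  (forall k, (k < K)%N -> ~ posdef ((5 / 4) ^+ k *: M - diag_mx dv)) ->
  (forall s', frame search s s' -> nmem s' 3 0 = K.+3 ->
     rmem s' 73 0 = (30 * K.+3)%:R -> Q s') ->
  runw s search (w_search K) Q.
Proof.
move=> ts hM hd sM pK nK hQ; apply: runw_frame.
apply: runw_seq; apply: runw_setr => //; apply: runw_seq; apply: runw_setn => //.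
apply: runw_seq; apply: runw_setr => //; apply: runw_seq; apply: runw_setn => //.
set s1 := setn_mem _ 45 _ _; have t1 : tables s1 by [].
(* The flag in cell 45 is raised only by the round that tests K, which is round K + 1, since no
   smaller exponent passes. *)
apply: (runw_while (I := fun k s' => [/\ rmem s' 74 0 = (5 / 4) ^+ k * (4 / 5),
   nmem s' 3 0 = k.+2, rmem s' 73 0 = (30 * k.+2)%:R & nmem s' 45 0 = (k == K.+1)])) => //.
- by split=> //=; rewrite ?expr0 ?mul1r // muln2 //.
- move=> k s2 kK f2 [p2 n2 q2 b2]; have t2 : tables s2 by apply: tables_frame f2 t1.
  split; first by rewrite /= b2 ltn_eqF.
  apply: runw_seq; apply: runw_setr => //; apply: runw_seq; apply: runw_setn => //.
  apply: runw_seq; apply: runw_setr => //; set s3 := setr_mem _ 73 _ _.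
  have t3 : tables s3 by [].
  apply: runw_seq; apply: runw_matset => // s4 f4 n4 h4.
  have t4 : tables s4 by apply: tables_frame f4 t3.
  have p3 : rmem s3 74 0 = (5 / 4) ^+ k.
    by rewrite /= p2; field.
  have X4 : read_mx s4 77 = (5 / 4) ^+ k *: M - diag_mx dv.
    rewrite h4; apply/matrixP => i j; have [_ _ hrc _ [h40 _]] := t3.
    have [_ hc] := hrc i j.
    have M3 : read_mx s3 76 = M by rewrite [LHS](_ : _ = read_mx s2 76) // (read_mx_frame _ f2).
    have d3 : rmem s3 71 j = dv 0 j by rewrite [LHS](_ : _ = rmem s2 71 j) // f2.2 //; exact: hd.
    rewrite mxE [reval _ _ _](_ : _ = rmem s3 74 0 * rmem s3 76 (i * n + j)%N -
      rmem s3 40 (i * n + j)%N * rmem s3 71 (nmem s3 42 (i * n + j)%N)) //.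
    rewrite hc d3 p3 !read_mxE M3 h40 !mxE.
    by case: eqP => [->|_]; rewrite ?mulr1n ?mulr0n ?mul1r ?mul0r.
  apply: runw_invert => //; rewrite X4.
    by rewrite linearB linearZ /= sM tr_diag_mx.
  move=> s5 f5 hp hn; split.
  + by rewrite f5.2 // f4.2 // p3 exprS; field.
  + by rewrite f5.1 // n4 /= n2 addn1.
  + rewrite f5.2 // f4.2 // [LHS](_ : _ = rmem s2 73 0 + 30) // q2.
    by rewrite (mulnS 30 k.+2) natrD addrC.
  + rewrite eqSS; have [kK'|kK'] := eqVneq k K.
      by rewrite kK' in hp; rewrite (hp pK).2.
    by rewrite hn //; apply: nK; rewrite ltn_neqAle kK'.
- move=> s2 f2 [p2 n2 q2 b2]; split; first by rewrite /= b2 eqxx.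
  by move=> f; apply: hQ.
Qed.

Definition prepare :=
  Seq init_tables
 (Seq dense
 (Seq (vecset 71 (RMul (RConst 2) (RGet 76 (NAdd (NGet 43 NProc) NProc))))
 (Seq (matset 70 (RSub (RMul (RGet 40 NProc) (RGet 71 colx)) (RGet 76 NProc)))
      search))).

Definition w_prepare K :=
  (w_init_tables + (w_dense + (w_vec n + (w_mat n + w_search K))))%N.

Lemma runw_prepare s Q (M : 'M[R]_n) K :
  stores_matrix s M -> M^T = M ->
  posdef ((5 / 4) ^+ K *: M - diag_mx (diag2 M)) ->
  (forall k, (k < K)%N -> ~ posdef ((5 / 4) ^+ k *: M - diag_mx (diag2 M))) ->
  (forall s', frame prepare s s' -> tables s' -> nmem s' 3 0 = K.+3 ->
     rmem s' 73 0 = (30 * K.+3)%:R -> (forall i : 'I_n, rmem s' 71 i = diag2 M 0 i) ->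
     read_mx s' 70 = diag_mx (diag2 M) - M -> Q s') ->
  runw s prepare (w_prepare K) Q.
Proof.
move=> hM sM pK nK hQ; apply: runw_frame.
apply: runw_seq; apply: runw_init_tables => [|s1 f1 t1]; first by case: hM.
have M1 : stores_matrix s1 M by apply: stores_matrix_frame f1 hM.
apply: runw_seq; apply: (runw_dense t1 M1) => s2 f2 h2.
have t2 : tables s2 by apply: tables_frame f2 t1.
apply: runw_seq; apply: runw_vecset => // s3 f3 _ h3.
have t3 : tables s3 by apply: tables_frame f3 t2.
have d3 (i : 'I_n) : rmem s3 71 i = diag2 M 0 i.
  have [_ _ _ h43 _] := t2.
  by rewrite (read_cvE s3 71 i) h3 !mxE /= h43 // read_mxE h2.
have M3 : read_mx s3 76 = M by rewrite (read_mx_frame _ f3).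
apply: runw_seq; apply: runw_matset => // s4 f4 _ h4.
have t4 : tables s4 by apply: tables_frame f4 t3.
have d4 (i : 'I_n) : rmem s4 71 i = diag2 M 0 i by rewrite f4.2.
have M4 : read_mx s4 76 = M by rewrite (read_mx_frame _ f4).
have A4 : read_mx s4 70 = diag_mx (diag2 M) - M.
  rewrite h4; apply/matrixP => i j; have [_ _ hrc _ [h40 _]] := t3.
  have [_ hc] := hrc i j.
  rewrite [LHS]mxE /= hc d3 !read_mxE h40 M3 [RHS]mxE [X in _ = X + _]mxE [X in _ = _ + X]mxE.
  congr (_ - _); rewrite [1%:M _ _]mxE.
  by case: eqP => [->|_]; rewrite ?mulr1n ?mulr0n ?mul1r ?mul0r.
apply: (runw_search t4 M4 d4 sM pK nK) => s5 f5 n5 q5 f.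
apply: hQ => //; first by apply: tables_frame f5 t4.
- by move=> i; rewrite f5.2.
- by rewrite (read_mx_frame _ f5).
Qed.

(** A level is appended before the next one overwrites it; the last is appended after the loop, and
    the final instruction stores the closing row pointer. *)
Definition build :=
  Seq prepare
 (Seq (setn 74 (NConst 0) (NConst 0))
 (Seq (setn 75 (NConst 0) (NConst 0))
 (Seq (For 49 (n0 3) (Seq append_level level_prog))
 (Seq append_level (setn 4 (n0 74) (n0 75)))))).

Definition w_build K :=
  (w_prepare K + (100 + (100 +
   ((K.+3 * ((w_append_level n (K.+3 * n) + w_level n (30 * K.+3)) + 200) + 200) +
    (w_append_level n (K.+3 * n) + 100)))))%N.

Lemma size_flatten_iota (T : Type) (F : nat -> seq T) k :
  (forall i, size (F i) = n) -> size (flatten [seq F i | i <- iota 0 k]) = (k * n)%N.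
Proof.
move=> h; rewrite size_flatten /shape -map_comp sumnE big_map.
under eq_bigr do rewrite /= h.
by rewrite big_const_seq count_predT size_iota iter_addn_0 mulnC.
Qed.

Lemma flatten_iotaS (T : Type) (F : nat -> seq T) k :
  flatten [seq F i | i <- iota 0 k.+1] = flatten [seq F i | i <- iota 0 k] ++ F k.
Proof. by rewrite -addn1 iotaD map_cat flatten_cat /= cats0. Qed.

Lemma runw_build s Q (M : 'M[R]_n) K :
  (0 < n)%N -> sddm M -> stores_matrix s M ->
  posdef ((5 / 4) ^+ K *: M - diag_mx (diag2 M)) ->
  (forall k, (k < K)%N -> ~ posdef ((5 / 4) ^+ k *: M - diag_mx (diag2 M))) ->
  (forall s' A, good_chain M K.+3 A ->
     stores_chain s' K.+3 (fun=> diag_mx (diag2 M)) A -> Q s') ->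
  runw s build (w_build K) Q.
Proof.
move=> n_gt0 M_sddm hM pK nK hQ; have sM : M^T = M by case: M_sddm => -[].
set dv := diag2 M in pK nK hQ.
pose dl := [seq (diag_mx dv) j j | j <- enum 'I_n].
have dlE : dl = [seq dv 0 j | j <- enum 'I_n].
  by apply: eq_map => j; rewrite mxE eqxx mulr1n.
apply: runw_seq; apply: (runw_prepare hM sM pK nK) => s1 f1 t1 n1 q1 d1 A1.
apply: runw_seq; apply: runw_setn => //; apply: runw_seq; apply: runw_setn => //.
set s2 := setn_mem _ _ _ _; have t2 : tables s2 by [].
pose S i A s' := [/\ chain_prefix M K.+3 i A, read_mx s' 70 = A i,
  stored_csr s' (flatten [seq rows (A j) | j <- iota 0 i]) &
  stores_vec s' 2 (flatten [seq dl | _ <- iota 0 i])].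
have size_dl i : size (flatten [seq dl | _ <- iota 0 i]) = (i * n)%N.
  by apply: size_flatten_iota => _; rewrite size_map size_enum_ord.
have size_rs i (A : nat -> 'M[R]_n) :
    size (flatten [seq rows (A j) | j <- iota 0 i]) = (i * n)%N.
  by apply: size_flatten_iota => j; exact: size_rows.
have append i A s3 Q' : (i <= K.+3)%N -> tables s3 -> S i A s3 ->
    (forall i : 'I_n, rmem s3 71 i = dv 0 i) ->
    (forall s', frame append_level s3 s' ->
       stored_csr s' (flatten [seq rows (A j) | j <- iota 0 i.+1]) ->
       stores_vec s' 2 (flatten [seq dl | _ <- iota 0 i.+1]) -> Q' s') ->
    runw s3 append_level (w_append_level n (K.+3 * n)) Q'.
  move=> iK t3 [_ A3 c3 v3] d3 hQ'.
  apply: (@runw_weaken _ _ _ (w_append_level n (i * n)) _ Q') => //; last first.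
    by rewrite /w_append_level leq_add2r leq_mul2l /= ltnS leq_add2r leq_mul2r iK orbT.
  rewrite -(size_rs i A).
  apply: (runw_append_level t3 d3 c3 v3) => [|s4 f4 c4 v4].
    by rewrite size_dl size_rs.
  apply: hQ' => //; first by rewrite flatten_iotaS -A3.
  by rewrite (flatten_iotaS (fun=> dl)) dlE in v4 *.
have frame2 s3 : frame (Seq (Seq append_level level_prog) (setn 49 (NConst 0) (NConst 0))) s2 s3 ->
  [/\ tables s3, forall i : 'I_n, rmem s3 71 i = dv 0 i & rmem s3 73 0 = (30 * K.+3)%:R].
  move=> f; split; first by apply: tables_frame f t2.
    by move=> i; rewrite f.2 //; exact: d1.
  by rewrite f.2.
apply: runw_seq; apply: (runw_for (I := fun i s' => exists A, S i A s')) => //.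
- exists (fun=> diag_mx dv - M); split=> //; split=> //.
  by rewrite (_ : (K.+3 - 3 = K)%N) //; lia.
- by move=> i s3 f3 _; rewrite /= f3.1.
- move=> i s3 iK f3 [A SA] hi; have [t3 d3 q3] := frame2 _ f3.
  apply: runw_seq; apply: (append i A) => //; first exact: ltnW.
  move=> s4 f4 c4 v4; have [pA A3 _ _] := SA.
  have t4 : tables s4 by apply: tables_frame f4 t3.
  have lA := chain_prefix_level M_sddm pA.
  have dp := diag2_gt0 M_sddm.
  apply: (@runw_level _ n s4 _ dv (A i) (30 * K.+3)%N) => //.
  + by lia.
  + by rewrite (read_mx_frame _ f4).
  + by move=> j; rewrite f4.2.
  + by rewrite f4.2.
  + exact: reduced_lap lA.
  + by apply: reduced_posdef lA; rewrite ?level_bound_gt0 ?level_bound_lt1.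
  move=> s5 f5 st.
  (* The chain exists only in the proof. Its matrix i + 1 is read off the memory, and the levels
     already written keep their values. *)
  pose A' j := if (j <= i)%N then A j else read_mx s5 70.
  have eA j : (j <= i)%N -> A' j = A j by rewrite /A' => ->.
  have eS : A' i.+1 = read_mx s5 70 by rewrite /A' ltnn.
  exists A'; split.
  + case: pA => h1 h2 h3 h4; split=> //.
    move=> j; rewrite ltnS leq_eqVlt => /orP[/eqP->|ji].
      rewrite eA // eS; rewrite natrM in st; exact: st.
    by rewrite !eA ?(ltnW ji) //; exact: h4.
  + by rewrite eS.
  + have -> : [seq rows (A' j) | j <- iota 0 i.+1] = [seq rows (A j) | j <- iota 0 i.+1].
      by apply/eq_in_map => j; rewrite mem_iota => /andP[_ ji]; rewrite eA.
    case: c4 => -[c4 e4] h4 r4; split.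
    * split; first by rewrite /= f5.1.
      by move=> k kl; rewrite /= f5.1 // f5.2 //; exact: e4.
    * by rewrite /= f5.1.
    * by move=> k kl; rewrite /= f5.1 //; exact: r4.
  + by move=> k kl; rewrite /= f5.2 //; exact: v4.
move=> s3 f3 [A SA]; have [t3 d3 q3] := frame2 _ f3; have [pA _ _ _] := SA.
apply: runw_seq; apply: (append K.+3 A) => // s4 f4 [[c4 e4] h4 r4] v4.
apply: runw_setn => //; apply: (hQ _ A) => //; split.
- by rewrite /= f4.1 // f3.1.
- split=> [i|k kl]; last exact: e4.
  rewrite leq_eqVlt /= h4 c4 => /orP[/eqP->|il].
    by rewrite eqxx take_size.
  by rewrite ltn_eqF // r4.
- by move=> k kl; exact: v4.
Qed.

End BuildProgram.

(** * Cost bounds *)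

Section Polynomials.

(** For the construction the second argument is the search result K, which is logarithmic in
    kappa. *)
Definition poly_bounded (f : nat -> nat -> nat) : Prop :=
  exists C k, forall n d, (f n d <= C * (n + d + 1) ^ k)%N.

Lemma poly_const c : poly_bounded (fun _ _ => c).
Proof. by exists c, 0%N => n d; rewrite expn0 muln1. Qed.

Lemma poly_fst : poly_bounded (fun n _ => n).
Proof. by exists 1%N, 1%N => n d; lia. Qed.

Lemma poly_snd : poly_bounded (fun _ d => d).
Proof. by exists 1%N, 1%N => n d; lia. Qed.

Lemma poly_add f g : poly_bounded f -> poly_bounded g ->
  poly_bounded (fun n d => f n d + g n d)%N.
Proof.
move=> [C [k hf]] [C' [k' hg]]; exists (C + C')%N, (k + k')%N => n d.
rewrite mulnDl; apply: leq_add; [apply: leq_trans (hf n d) _ | apply: leq_trans (hg n d) _];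
  by rewrite leq_mul2l leq_pexp2l ?orbT ?addn1 ?leq_addr ?leq_addl.
Qed.

Lemma poly_mul f g : poly_bounded f -> poly_bounded g ->
  poly_bounded (fun n d => f n d * g n d)%N.
Proof.
move=> [C [k hf]] [C' [k' hg]]; exists (C * C')%N, (k + k')%N => n d.
by rewrite expnD mulnACA; exact: leq_mul.
Qed.

Lemma poly_succ f : poly_bounded f -> poly_bounded (fun n d => (f n d).+1).
Proof.
move=> h; have := poly_add h (poly_const 1).
by move=> [C [k hk]]; exists C, k => n d; rewrite -addn1.
Qed.

Lemma poly_sqr f : poly_bounded f -> poly_bounded (fun n d => f n d ^ 2)%N.
Proof. by move=> h; have := poly_mul h h. Qed.

Lemma poly_w_build : poly_bounded w_build.
Proof.
rewrite /w_build /w_prepare /w_init_tables /w_init_row /w_dense /w_dense_column.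
rewrite /w_search /w_append_level /w_append_row /w_level /w_level_init /w_bss_step.
rewrite /w_bss_inverses /w_bss_select /w_bss_update /w_invert /w_invert_step.
rewrite /w_matmul /w_rowsums /w_trprod /w_mat /w_vec.
repeat lazymatch goal with
| |- poly_bounded (fun _ _ => ?c) => exact: (poly_const c)
| |- poly_bounded (fun n _ => n) => exact: poly_fst
| |- poly_bounded (fun _ d => d) => exact: poly_snd
| |- poly_bounded (fun n d => addn (@?f n d) (@?g n d)) => apply: (@poly_add f g)
| |- poly_bounded (fun n d => muln (@?f n d) (@?g n d)) => apply: (@poly_mul f g)
| |- poly_bounded (fun n d => expn (@?f n d) 2) => apply: (@poly_sqr f)
| |- poly_bounded (fun n d => (@?f n d).+1) => apply: (@poly_succ f)
end.
Qed.

End Polynomials.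

(** * Logarithmic bounds on iterations and levels *)

Section Logarithms.
Variable R : realType.

Lemma lg_ge1 (x : R) : 1 <= lg x.
Proof. by rewrite /lg le_max lexx. Qed.

Lemma ln_le_lg (x : R) : ln x <= lg x.
Proof. by rewrite /lg le_max lexx orbT. Qed.

(** Uses ln a >= 1 - 1/a, which is ln (1 + t) <= t at t = 1/a - 1; rational constants thus replace
    values of [ln]. *)
Lemma ln_ge_expn (a x : R) j : 1 < a -> 0 < x -> a ^+ j <= x ->
  j%:R * (1 - a^-1) <= ln x.
Proof.
move=> a1 x0 h; have a0 : 0 < a by apply: lt_trans a1.
have la : 1 - a^-1 <= ln a.
  have ai : 0 < a^-1 by rewrite invr_gt0.
  have h1 : -1 < a^-1 - 1 by lra.
  by have := le_ln1Dx h1; rewrite [1 + _]addrC subrK lnV ?posrE //; lra.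
apply: (@le_trans _ _ (ln (a ^+ j))); last by rewrite ler_ln ?posrE ?exprn_gt0.
by rewrite lnXn // mulr_natl ler_wMn2r.
Qed.

(** If h is the rounded logarithm then 2^(h-1) <= n^2, so (h - 1) / 2 <= 2 ln n and h <= 4 lg n +
    1. *)
Lemma up_log_le_lg n : (0 < n)%N -> (up_log 2 (n * n).+1)%:R <= 5 * lg n%:R :> R.
Proof.
move=> n0; have n0R : (0 : R) < n%:R by rewrite ltr0n.
have := @up_log_gtn 2 (n * n).+1 isT; rewrite ltnS muln_gt0 n0 => /(_ isT).
move: (up_log _ _) => h; rewrite ltnS => hn.
have : (2 : R) ^+ h.-1 <= n%:R * n%:R by rewrite -natrX -natrM ler_nat.
move=> /ln_ge_expn; rewrite mulr_gt0 // ltr1n => /(_ isT isT).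
rewrite lnM ?posrE // => hl; have := ln_le_lg (n%:R : R); have := lg_ge1 (n%:R : R).
have : (h%:R : R) <= h.-1%:R + 1 by rewrite natr1 ler_nat; lia.
lra.
Qed.

(** The least T works. Unless it is 0, (4/3)^(T-1) <= 1/eps^2 gives (T - 1) / 4 <= 2 ln (1/eps),
    hence T <= 8 lg (1/eps) + 1. *)
Lemma iteration_count (eps : R) : 0 < eps -> exists T : nat,
  [/\ (3 / 4) ^+ T <= eps ^+ 2, forall k, (k < T)%N -> eps ^+ 2 < (3 / 4) ^+ k
    & T%:R <= 9 * lg (1 / eps)].
Proof.
move=> e0; have e2 : 0 < eps ^+ 2 by rewrite exprn_gt0.
have q0 : 0 < (3 / 4 : R) by lra.
have ex : exists T, (3 / 4) ^+ T <= eps ^+ 2.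
  have [T hT] : exists T : nat, (eps ^+ 2)^-1 < T%:R / 3.
    exists (Num.bound (3 * (eps ^+ 2)^-1)).
    have h : 0 <= 3 * (eps ^+ 2)^-1 by rewrite mulr_ge0 // invr_ge0 ltW.
    by have := archi_boundP h; lra.
  exists T; rewrite -[leLHS]invrK -[leRHS]invrK lef_pV2 ?posrE ?invr_gt0 ?exprn_gt0 //.
  apply: ltW; apply: lt_le_trans hT _; rewrite -exprVn.
  have : 1 + T%:R / 3 <= (3 / 4 : R)^-1 ^+ T; last by lra.
  elim: T => [|T IH]; first by rewrite mul0r addr0 expr0.
  rewrite (exprSr _ T) (_ : (3 / 4 : R)^-1 = 4 / 3) in IH *; last by field.
  have : 0 <= (T%:R : R) by []; rewrite -[T.+1%:R]natr1.
  by move: IH; move: (_ ^+ T) => P; lra.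
case: (ex_minnP ex) => T hT mT; exists T; split=> //.
  by move=> k kT; rewrite ltNge; apply/negP => /mT; lia.
case: T hT mT => [_ _|T _ mT]; first by have := lg_ge1 (1 / eps); lra.
have hk : eps ^+ 2 < (3 / 4) ^+ T by rewrite ltNge; apply/negP => /mT; lia.
have i0 : 0 < 1 / eps by rewrite divr_gt0.
have : (4 / 3 : R) ^+ T <= (1 / eps) * (1 / eps).
  rewrite (_ : 1 / eps * (1 / eps) = (eps ^+ 2)^-1); last by field; rewrite gt_eqF.
  rewrite (_ : 4 / 3 = (3 / 4 : R)^-1); last by field.
  by rewrite exprVn lef_pV2 ?posrE ?exprn_gt0 // ltW.
move=> /ln_ge_expn; rewrite mulr_gt0 // => /(_ _ isT) h.
have /h : 1 < 4 / 3 :> R by lra.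
rewrite lnM ?posrE // (_ : (4 / 3)^-1 = 3 / 4 :> R); last by field.
have := ln_le_lg (1 / eps); have := lg_ge1 (1 / eps); rewrite -[T.+1%:R]natr1.
lra.
Qed.

(** The least K works. Unless it is 0, (5/4)^(K-1) <= 2 kappa gives (K - 1) / 5 <= 1 + lg kappa,
    hence K + 3 <= 9 + 5 lg kappa. *)
Lemma chain_length n (M : 'M[R]_n) (kappa : R) :
  (0 < n)%N -> sddm M -> cond_number M <= kappa -> exists K : nat,
  [/\ posdef ((5 / 4) ^+ K *: M - diag_mx (diag2 M)),
      forall k, (k < K)%N -> ~ posdef ((5 / 4) ^+ k *: M - diag_mx (diag2 M))
    & K.+3%:R <= 14 * lg kappa].
Proof.
move=> n0 M_sddm hk; have [k1 hl] := sddm_cond_number n0 M_sddm hk.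
have k0 : 0 < kappa by lra.
have pM : posdef M by case: M_sddm.
have sM := pM.1.
have pk k : 2 * kappa < (5 / 4) ^+ k -> posdef ((5 / 4) ^+ k *: M - diag_mx (diag2 M)).
  move=> h; split; first by rewrite linearB linearZ /= sM tr_diag_mx.
  move=> x x0; rewrite quadB quadZ subr_gt0.
  have := hl x; rewrite quadZ => hx.
  apply: (@le_lt_trans _ _ (2 * kappa * quad M x)); last first.
    by rewrite ltr_pM2r // pM.2.
  by rewrite -ler_pdivrMl // mulr_gt0.
have ex : exists K, `[< posdef ((5 / 4) ^+ K *: M - diag_mx (diag2 M)) >].
  have [K hK] : exists K : nat, 2 * kappa < 1 + K%:R / 4.
    exists (Num.bound (8 * kappa)).
    have h : 0 <= 8 * kappa by lra.
    by have := archi_boundP h; lra.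
  exists K; apply/asboolP/pk; apply: lt_le_trans hK _.
  elim: K => [|K IH]; first by rewrite mul0r addr0 expr0.
  rewrite (exprSr _ K); have : 0 <= (K%:R : R) by []; rewrite -[K.+1%:R]natr1.
  by move: IH; move: (_ ^+ K) => P; lra.
case: (ex_minnP ex) => K /asboolP hK mK; exists K; split=> //.
  by move=> k kK /asboolP /mK; lia.
have L1 := lg_ge1 kappa.
case: K hK mK => [_ _|K _ mK]; first by lra.
have : (5 / 4) ^+ K <= 2 * kappa.
  by rewrite leNgt; apply/negP => /pk /asboolP /mK; lia.
move=> /ln_ge_expn; rewrite mulr_gt0 // => /(_ _ isT) h.
have /h : 1 < 5 / 4 :> R by lra.
rewrite lnM ?posrE // (_ : (5 / 4)^-1 = 4 / 5 :> R); last by field.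
have l2 : ln 2 <= 1 :> R.
  by have := @le_ln1Dx R 1; rewrite (_ : 1 + 1 = 2 :> R) // => -> //; lra.
have := ln_le_lg kappa; rewrite (_ : K.+4%:R = K%:R + 4 :> R); last by rewrite -addn4 natrD.
lra.
Qed.

End Logarithms.

(** * Constants of the final bounds *)

Section Arithmetic.
Variable R : realType.

(** The entries of d levels are at most 4 n (30 d)^2 d = 3600 n d^3 with d <= 14 L; the 15 covers n
    + n d. *)
Definition nnz_const : R := 3600 * (14 * (14 * 14)) + 15.
Definition work_const : R := 9 * (2 * (2 * 4000) * (nnz_const + 100)) + 400.
Definition depth_const : R := 9 * (70 * (70 * 100)) + 300.

Lemma nnz_const_ge0 : 0 <= nnz_const. Proof. by rewrite /nnz_const; lra. Qed.

Lemma work_const_ge0 : 0 <= work_const.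
Proof. by have := nnz_const_ge0; rewrite /work_const; lra. Qed.

Lemma depth_const_ge0 : 0 <= depth_const. Proof. by rewrite /depth_const; lra. Qed.

(** With n d and n d^2 bounded by multiples of x the cost of a round is linear in m + x; only its
    product with T is not linear. *)
Lemma work_arith (m n d S T : nat) (L E : R) (x := n%:R * L ^+ 3) :
  1 <= n%:R :> R -> n%:R <= x -> d%:R <= 14 * x ->
  n%:R * d%:R ^+ 1 <= 14 ^+ 1 * x -> n%:R * d%:R ^+ 2 <= 14 ^+ 2 * x ->
  S%:R <= m%:R + nnz_const * x -> 1 <= E -> T%:R <= 9 * E ->
  (T * (2 * 4000 * m + 2 * (2 * 4000 * S + d * (100 * n * (d + 10) + 2 * 3000 + 100)) +
    600 * n + 2 * 3000 + 100) + 100 * n + 300)%:R <=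
  work_const * ((m%:R + x) * E).
Proof.
move=> n1 nx dx ndx nd2x Sb E1 TE; rewrite /work_const.
have := nnz_const_ge0; move: Sb; move: nnz_const => c0 Sb c0_ge0.
have {ndx} ndx : n%:R * d%:R <= 14 * x by move: ndx; rewrite !expr1.
have {nd2x} nd2x : n%:R * d%:R ^+ 2 <= 196 * x.
  by move: nd2x; rewrite (_ : 14 ^+ 2 = 196 :> R) //; ring.
set W := (2 * 4000 * m + _ + _ + _ + _)%N.
have WE : W%:R = 2 * 4000 * m%:R + 2 * (2 * 4000 * S%:R + (100 * (n%:R * d%:R ^+ 2) +
    1000 * (n%:R * d%:R) + 6100 * d%:R)) + 600 * n%:R + 6100 :> R.
  by rewrite /W !(natrD, natrM); ring.
have W0 : 0 <= W%:R :> R by exact: ler0n.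
have m0 : 0 <= m%:R :> R by exact: ler0n.
have n0 : 0 <= n%:R :> R by exact: ler0n.
have T0 : 0 <= T%:R :> R by exact: ler0n.
rewrite (natrD _ _ 300) (natrD _ _ (100 * n)) (natrM _ T) (natrM _ 100).
clearbody W; clearbody x.
move: (n%:R * d%:R ^+ 2) (n%:R * d%:R) ndx nd2x WE => nd2 nd ndx nd2x WE.
have {nd nd2 ndx nd2x dx Sb} WE : W%:R <= 2 * (2 * 4000) * (c0 + 100) * (m%:R + x).
  have cm := mulr_ge0 c0_ge0 m0; rewrite WE; move: cm m0 n1 nx dx ndx nd2x Sb; clear.
  move: (m%:R) (n%:R) (d%:R) (S%:R) => m' n' d' S'; lra.
have TW : T%:R * W%:R <= 9 * E * (2 * (2 * 4000) * (c0 + 100) * (m%:R + x)).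
  by apply: ler_pM T0 W0 TE WE.
have nE : n%:R <= (m%:R + x) * E.
  have h1 : n%:R <= m%:R + x by move: nx m0; clear; move: (n%:R) (m%:R) => n' m'; lra.
  have h2 : 0 <= 1 :> R by exact: ler01.
  by have := ler_pM n0 h2 h1 E1; rewrite mulr1.
move: TW nE n1; rewrite [X in _ <= X -> _](_ : _ =
  9 * (2 * (2 * 4000) * (c0 + 100)) * ((m%:R + x) * E)); last by ring.
clear; move: (T%:R * W%:R) ((m%:R + x) * E) (n%:R) => TW z n'; lra.
Qed.

Lemma depth_arith (md d T : nat) (L E l : R) : 1 <= l -> 1 <= L ->
  md%:R <= 66 * (100 * l) -> d%:R <= 14 * L -> 1 <= E -> T%:R <= 9 * E ->
  (T * (md + 2 * (d * (md + 700 + 100)) + 1100 + 100) + 300)%:R <=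
  depth_const * (l * L * E).
Proof.
rewrite /depth_const.
move=> l1 L1 hm dL E1 TE.
set W := (md + _ + _ + _)%N; rewrite (natrD _ _ 300) (natrM _ T).
have WE : W%:R = md%:R + 2 * (d%:R * (md%:R + 800)) + 1200 :> R.
  by rewrite /W !(natrD, natrM); ring.
have m0 : 0 <= md%:R :> R by exact: ler0n.
have d0 : 0 <= d%:R :> R by exact: ler0n.
have W0 : 0 <= W%:R :> R by exact: ler0n.
have T0 : 0 <= T%:R :> R by exact: ler0n.
clearbody W.
have lL : l <= l * L by rewrite ler_peMr //; move: l1; clear; lra.
have {}WE : W%:R <= 70 * (70 * 100) * (l * L).
  have h1 : 0 <= md%:R + 800 :> R by move: m0; clear; move: (md%:R) => m'; lra.
  have h2 : md%:R + 800 <= 74 * (100 * l).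
    by move: hm l1; clear; move: (md%:R) => m'; lra.
  have := ler_pM d0 h1 dL h2; rewrite WE.
  rewrite (_ : 14 * L * (74 * (100 * l)) = 14 * (74 * (100 * (l * L)))); last by ring.
  move: (d%:R * _) => dmd; move: lL l1 hm; clear.
  move: (l * L) (md%:R) => P m'; lra.
have TW : T%:R * W%:R <= 9 * E * (70 * (70 * 100) * (l * L)).
  by apply: ler_pM T0 W0 TE WE.
have oE : 1 <= l * L * E.
  have l0 : 0 <= l by move: l1; clear; lra.
  have p1 : 1 <= l * L by apply: le_trans l1 lL.
  by have := ler_pM ler01 ler01 p1 E1; rewrite mulr1.
move: TW oE; rewrite (_ : 9 * E * (70 * (70 * 100) * (l * L)) =
  9 * (70 * (70 * 100)) * (l * L * E)); last by ring.
clear; move: (T%:R * W%:R) (l * L * E) => TW z; lra.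
Qed.

End Arithmetic.

Section Bounds.
Variables (R : realType) (n : nat) (M : 'M[R]_n) (d : nat) (A : nat -> 'M[R]_n).
Hypotheses (n_gt0 : (0 < n)%N) (A_good : good_chain M d A).
Variable L : R.
Hypotheses (L1 : 1 <= L) (dL : d%:R <= 14 * L).

Lemma nnz_good_chain i : (i <= d)%N ->
  (nnz (A i) <= if i == 0 then n + nnz M else n + 4 * n * (30 * d) ^ 2)%N.
Proof.
move=> id; have [_ A0 _ st] := A_good.
case: i id => [_|i id].
  rewrite A0; apply: leq_trans (nnzD _ _) _; rewrite leq_add ?nnz_diag //.
  exact: nnzN.
have [_ hk _ _] := st i id.
have -> : A i.+1 = diag_mx (diag2 M) - (diag_mx (diag2 M) - A i.+1).
  by rewrite opprB addrC subrK.
apply: leq_trans (nnzD _ _) _; rewrite leq_add ?nnz_diag //.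
exact: leq_trans (nnzN _) hk.
Qed.

Lemma sum_nnz_good_chain :
  (\sum_(0 <= i < d.+1) nnz (A i) <= nnz M + n + d * (n + 4 * n * (30 * d) ^ 2))%N.
Proof.
rewrite big_nat_recl // leq_add //; first by rewrite addnC nnz_good_chain.
rewrite -[X in (_ <= X * _)%N](subn0 d) -sum_nat_const_nat.
rewrite big_nat_cond [leqRHS]big_nat_cond; apply: leq_sum => i /andP[/andP[_ id] _].
exact: nnz_good_chain.
Qed.

Local Notation m := ((nnz M)%:R : R).
Local Notation x := (n%:R * L ^+ 3 : R).
Local Notation c0 := (nnz_const R).

Let nx : n%:R <= x.
Proof. by rewrite ler_peMr // exprn_ege1. Qed.

Let dx : d%:R <= 14 * x.
Proof.
have l1 := L1; apply: le_trans dL _; rewrite ler_pM2l //.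
apply: (@le_trans _ _ (1 * L ^+ 3)); first by rewrite mul1r ler_eXnr.
by rewrite ler_wpM2r ?ler1n // exprn_ge0 //; lra.
Qed.

(** All costs are combinations of n d^k with k <= 3, and L >= 1 lets n L^3 dominate each of them. *)
Let ndx k : (0 < k <= 3)%N -> n%:R * d%:R ^+ k <= 14 ^+ k * x.
Proof.
have l1 := L1; move=> /andP[k0 k3]; rewrite [leRHS]mulrCA ler_wpM2l //.
apply: (@le_trans _ _ ((14 * L) ^+ k)).
  by rewrite lerXn2r ?nnegrE //; lra.
rewrite exprMn ler_wpM2l ?exprn_ge0 //.
exact: ler_weXn2l.
Qed.

Lemma sum_nnz_bound :
  (\sum_(0 <= i < d.+1) nnz (A i))%:R <= m + c0 * x.
Proof.
have : ((\sum_(0 <= i < d.+1) nnz (A i))%:R : R) <=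
    m + n%:R + d%:R * (n%:R + 4 * n%:R * (30 * d%:R) ^+ 2).
  by rewrite -!(natrM, natrX, natrD) ler_nat sum_nnz_good_chain.
have := ndx (isT : (0 < 1 <= 3)%N); have := ndx (isT : (0 < 3 <= 3)%N); have := nx.
rewrite expr1 (_ : 14 ^+ 3 = 14 * (14 * 14) :> R); last by ring.
rewrite (_ : d%:R * (n%:R + 4 * n%:R * (30 * d%:R) ^+ 2) =
  n%:R * d%:R + 3600 * (n%:R * d%:R ^+ 3) :> R); last by ring.
move: (n%:R * d%:R ^+ 3) => nd3; move: (n%:R * d%:R) => nd.
rewrite /nnz_const; move: x => y; lra.
Qed.

Lemma chain_nnz_bound :
  (\sum_(0 <= i < d.+1) (nnz (diag_mx (diag2 M)) + nnz (A i)))%:R <=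
  (c0 + 15) * (m + x).
Proof.
rewrite big_split natrD /=.
have : ((\sum_(0 <= i < d.+1) nnz (diag_mx (diag2 M)))%:R : R) <= n%:R + n%:R * d%:R.
  rewrite -natrM -natrD ler_nat sum_nat_const_nat subn0 mulSn mulnC.
  by rewrite leq_add ?nnz_diag // leq_mul2r nnz_diag orbT.
have := sum_nnz_bound; have := ndx (isT : (0 < 1 <= 3)%N); have := nx; rewrite !expr1.
have : 0 <= m by [].
have := nnz_const_ge0 R.
move: (n%:R * d%:R) (m) (x) (c0) => nd m' y c c_ge0 m0 nx' ndx' Sb Db.
have := mulr_ge0 c_ge0 m0; lra.
Qed.

Lemma sum_level_work :
  (\sum_(k < d) (level_work d A k + 100) =
   2 * 4000 * (\sum_(0 <= i < d) nnz (A i)) + d * (100 * n * (d + 10) + 2 * 3000 + 100))%N.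
Proof.
rewrite (eq_bigr (fun k : 'I_d => 2 * 4000 * nnz (A k) +
  (100 * n * (d + 10) + 2 * 3000 + 100))%N); last first.
  by move=> k _; rewrite /level_work !addnA.
by rewrite big_split -big_distrr /= sum_nat_const card_ord big_mkord.
Qed.

Lemma solve_work_bound (T : nat) (E : R) : 1 <= E -> T%:R <= 9 * E ->
  (T * (2 * 4000 * nnz M + 2 * \sum_(k < d) (level_work d A k + 100) + 600 * n +
    2 * 3000 + 100) + 100 * n + 300)%:R <=
  work_const R * ((m + x) * E).
Proof.
move=> E1 TE; rewrite sum_level_work.
have Sb : (\sum_(0 <= i < d) nnz (A i))%:R <= m + c0 * x.
  apply: le_trans sum_nnz_bound; rewrite ler_nat big_nat_recr //=.
  exact: leq_addr.
have n1 : 1 <= (n%:R : R) by rewrite ler1n.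
have h3 := ndx (isT : (0 < 1 <= 3)%N); have h4 := ndx (isT : (0 < 2 <= 3)%N).
move: Sb; move: (\sum_(0 <= i < d) nnz (A i))%N => S Sb.
exact: work_arith n1 nx dx h3 h4 Sb E1 TE.
Qed.

Lemma solve_depth_bound (T : nat) (E : R) : 1 <= E -> T%:R <= 9 * E ->
  (T * (matvec_depth n + 2 * (d * (level_depth n + 100)) + 1100 + 100) + 300)%:R <=
  depth_const R * (lg n%:R * L * E).
Proof.
move=> E1 TE; have hm : (matvec_depth n)%:R <= 66 * (100 * lg n%:R) :> R.
  rewrite /matvec_depth natrD natrM; have := up_log_le_lg R n_gt0.
  have := lg_ge1 (n%:R : R).
  by move: (lg _) ((up_log _ _)%:R) => l u; lra.
exact: depth_arith (lg_ge1 _) L1 hm dL E1 TE.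
Qed.

End Bounds.

Theorem theorem1p1 (R : realType) :
  exists (build solve : cmd) (C : R) (k : nat),
  forall (n : nat) (M : 'M[R]_n) (kappa : R),
    (0 < n)%N -> sddm M -> cond_number M <= kappa ->
  forall s : memory R, stores_matrix s M ->
  exists (d : nat) (D A : nat -> 'M[R]_n),
    (exists (s' : memory R) (w t : nat),
       [/\ exec build s s' w t,
           stores_chain s' d D A
         & w%:R <= C * (n%:R * lg kappa) ^+ k]) /\
    approx_inverse_chain M d D A /\
    (\sum_(0 <= i < d.+1) (nnz (D i) + nnz (A i)))%:R
      <= C * ((nnz M)%:R + n%:R * lg kappa ^+ 3) /\
    forall (b : 'cV[R]_n) (eps : R), 0 < eps ->
    forall s1 : memory R,
      stores_matrix s1 M -> stores_chain s1 d D A -> stores_rhs s1 b eps ->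
    exists (s2 : memory R) (w t : nat),
      [/\ exec solve s1 s2 w t,
          approx_solution M b eps (read_solution s2 n),
          w%:R <= C * (((nnz M)%:R + n%:R * lg kappa ^+ 3) * lg (1 / eps))
        & t%:R <= C * (lg n%:R * lg kappa * lg (1 / eps))].
Proof.
have [Cb [kb hb]] := poly_w_build.
pose C1 := Cb%:R * 15 ^+ kb : R.
have C1_ge0 : 0 <= C1 by rewrite mulr_ge0 // exprn_ge0.
pose C2 := nnz_const R + 15.
have C2_ge0 : 0 <= C2 by rewrite /C2; have := nnz_const_ge0 R; lra.
have C3_ge0 := work_const_ge0 R; have C4_ge0 := depth_const_ge0 R.
(* One constant serves all four bounds because its summands are nonnegative. *)
exists build, solve, (C1 + C2 + work_const R + depth_const R), kb => n M kappa n0 M_sddm hk s hM.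
have L1 := lg_ge1 kappa; have l1 := lg_ge1 (n%:R : R).
have n1 : 1 <= (n%:R : R) by rewrite ler1n.
have [K [pK nK dL]] := chain_length n0 M_sddm hk.
(* The chain is taken from the postcondition of the run, which only asserts that some good chain is
   stored. *)
have [t [s' [w [t' [ex hw _ [[A [gA sA]] _]]]]]] := @runw_build R n s
  (fun s' => exists A, good_chain M K.+3 A /\
     stores_chain s' K.+3 (fun=> diag_mx (diag2 M)) A) M K n0 M_sddm hM pK nK
  (fun s' A gA sA => ex_intro _ A (conj gA sA)).
exists K.+3, (fun=> diag_mx (diag2 M)), A; split; last split; last split.
- exists s', w, t'; split=> //.
  have nL0 : 0 <= n%:R * lg kappa by apply: mulr_ge0 => //; lra.
  apply: (@le_trans _ _ (C1 * (n%:R * lg kappa) ^+ kb)); last first.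
    by rewrite ler_wpM2r ?exprn_ge0 //; lra.
  apply: (@le_trans _ _ (Cb * (n + K + 1) ^ kb)%:R).
    by rewrite ler_nat (leq_trans hw).
  have nL : n%:R <= n%:R * lg kappa by rewrite ler_peMr //; lra.
  have Ln : lg kappa <= n%:R * lg kappa by rewrite ler_peMl //; lra.
  (* Both n and 14 lg kappa, which bounds K + 3, are controlled by n lg kappa since each factor is
     at least 1. *)
  have key : (n + K + 1)%:R <= 15 * (n%:R * lg kappa).
    by move: dL; rewrite -(addn3 K) !natrD; lra.
  have key0 : 0 <= 15 * (n%:R * lg kappa) by lra.
  have := lerXn2r kb (ler0n _ _ : _ \in Num.nneg) key0 key.
  by rewrite natrM natrX /C1 -mulrA -exprMn; apply: ler_wpM2l.
- exact: (good_chain_approx_inverse M_sddm gA).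
- apply: le_trans (chain_nnz_bound gA L1 dL) _.
  rewrite -/C2 ler_wpM2r //; last by lra.
  by rewrite addr_ge0 // mulr_ge0 // exprn_ge0 //; lra.
move=> b eps eps0 s1 h1 h2 h3.
have [T [hT1 hT2 TE]] := iteration_count eps0; have E1 := lg_ge1 (1 / eps).
have [s2 [w2 [t2 [ex2 hw2 ht2 [q _]]]]] := run_solve M_sddm gA eps0 (And3 h1 h2 h3) hT1 hT2.
have L0 : 0 <= lg kappa by lra.
have l0 : 0 <= lg (n%:R : R) by lra.
have E0 : 0 <= lg (1 / eps) by lra.
exists s2, w2, t2; split=> //.
- apply: (@le_trans _ _ (work_const R * (((nnz M)%:R + n%:R * lg kappa ^+ 3) * lg (1 / eps)))).
    by apply: le_trans (solve_work_bound n0 gA L1 dL E1 TE); rewrite ler_nat.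
  apply: ler_wpM2r; last by lra.
  by apply: mulr_ge0 => //; apply: addr_ge0 => //; apply: mulr_ge0 => //; apply: exprn_ge0.
- apply: (@le_trans _ _ (depth_const R * (lg n%:R * lg kappa * lg (1 / eps)))).
    by apply: le_trans (solve_depth_bound n0 L1 dL E1 TE); rewrite ler_nat.
  apply: ler_wpM2r; last by lra.
  by apply: mulr_ge0 => //; apply: mulr_ge0.
Qed.
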